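(* Let $\Omega\subset\mathbb{R}^d$, $\mathbb{D}$, the simplicial mesh $\mathcal{T}_h$ with $N$ elements, the mass matrix $M$ and the stiffness matrix $A$ be as in the context, and let $\Delta t>0$. Then the 2-norm condition number of $M+\Delta t\,A$ satisfies $$\kappa(M+\Delta t\,A)\;\le\; C\;\frac{\displaystyle\max_{j}\frac{|\omega_j|}{|\omega_{\min}|}\left(1+\Delta t\,h_{\mathbb{D}^{-1}}^{-2}\sum_{K\in\omega_j}\frac{|K|}{|\omega_j|}\left(\frac{h_{\mathbb{D}^{-1}}}{a_{K,\mathbb{D}^{-1}}}\right)^2\right)}{1+\Delta t\,d_{\min}\,N^{-1}\,|\omega_{\min}|^{-1}\,\Psi_E^{-1}},$$ where $$\Psi_E=\begin{cases}1,& d=1,\\ 1+\ln\left(\dfrac{|\bar K|}{|K_{\min}|}\right),& d=2,\\ \left(\dfrac1N\sum_{K\in\mathcal{T}_h}\left(\dfrac{|\bar K|}{|K|}\right)^{\frac{d-2}{2}}\right)^{\frac2d},& d\ge 3,\end{cases}$$ $|K_{\min}|$ is the minimal element volume and $|\bar K|=|\Omega|/N$ is the average element volume.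
   Context: Setting. $\Omega\subset\mathbb{R}^d$ ($d\ge1$) is a fixed bounded polygonal/polyhedral domain. $\mathbb{D}=\mathbb{D}(\boldsymbol{x})$ is a symmetric matrix-valued function with $d_{\min}I\le\mathbb{D}(\boldsymbol{x})\le d_{\max}I$ for all $\boldsymbol{x}\in\Omega$, for some constants $d_{\min},d_{\max}>0$ (inequalities in the sense of symmetric matrices). $\mathcal{T}_h$ is a (conforming) simplicial mesh of $\Omega$ with $N$ elements and $N_{vi}$ interior vertices, numbered $1,\dots,N_{vi}$; no mesh regularity is assumed. $|K|$ is the volume of an element $K$; $\omega_j$ is the patch of elements containing the $j$-th vertex and $|\omega_j|=\sum_{K\in\omega_j}|K|$; $|\omega_{\min}|$ is the minimal patch volume; $j$ ranges over the interior vertices. $\phi_j$ is the continuous piecewise linear nodal basis function of the $j$-th interior vertex (homogeneous Dirichlet conditions). $M,A\in\mathbb{R}^{N_{vi}\times N_{vi}}$ are $$M_{kj}=\int_\Omega\phi_k\phi_j\,d\boldsymbol{x},\qquad A_{kj}=\int_\Omega\nabla\phi_k\cdot\mathbb{D}\nabla\phi_j\,d\boldsymbol{x}.$$ Metric quantities. $\mathbb{D}_K=\frac1{|K|}\int_K\mathbb{D}\,d\boldsymbol{x}$. $a_{K,\mathbb{D}^{-1}}$ is the minimal height of the simplex $K$ measured in the metric $\mathbb{D}_K^{-1}$ (i.e. with length $\sqrt{\boldsymbol{v}^T\mathbb{D}_K^{-1}\boldsymbol{v}}$; equivalently the minimal Euclidean height of $\mathbb{D}_K^{-1/2}K$). $h_{\mathbb{D}^{-1}}=\left(|\Omega|_{\mathbb{D}^{-1}}/N\right)^{1/d}$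 with $|\Omega|_{\mathbb{D}^{-1}}=\sum_{K\in\mathcal{T}_h}|K|\sqrt{\det(\mathbb{D}_K^{-1})}$. Constant. $C>0$ is a constant that may depend on the dimension $d$ (and the choice of reference element and reference basis functions) and on the fixed domain $\Omega$, but is independent of the mesh, of $\mathbb{D}$ and of $\Delta t$. *)

(* Defs.v *)
From HB Require Import structures.
From mathcomp Require Import all_boot all_order all_algebra.
From mathcomp Require Import all_classical all_reals all_analysis.

Set Implicit Arguments.
Unset Strict Implicit.
Unset Printing Implicit Defensive.

Import Order.TTheory GRing.Theory Num.Theory.
Import numFieldNormedType.Exports.

Local Open Scope classical_set_scope.
Local Open Scope ring_scope.

(* The sigma-algebra on ['rV[R]_n] is generated by the coordinate maps, like the
   library's one on [n.-tuple T]; [lebesgue_rV n] below is the [n]-fold product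
   of the one-dimensional Lebesgue measure. *)

Definition measure_rV_display : measure_display.
Proof. exact: default_measure_display. Qed.

Section measurable_rV.
Context {R : realType} (n : nat).

Let coord (i : 'I_n) (x : 'rV[R]_n) : measurableTypeR R := x ord0 i.

Let rV_set0 : g_sigma_preimage coord set0.
Proof. exact: sigma_algebra0. Qed.

Let rV_setC A : g_sigma_preimage coord A -> g_sigma_preimage coord (~` A).
Proof. exact: sigma_algebraC. Qed.

Let rV_bigcup (F : (set 'rV[R]_n)^nat) :
  (forall i, g_sigma_preimage coord (F i)) ->
  g_sigma_preimage coord (\bigcup_i (F i)).
Proof. exact: sigma_algebra_bigcup. Qed.

HB.instance Definition _ := @isMeasurable.Build measure_rV_display
  'rV[R]_n (g_sigma_preimage coord) rV_set0 rV_setC rV_bigcup.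

End measurable_rV.

Section measurable_rV_theory.
Context {R : realType}.

Lemma measurable_coord n (i : 'I_n) :
  measurable_fun [set: 'rV[R]_n]
    (fun x : 'rV[R]_n => x ord0 i : measurableTypeR R).
Proof.
move=> _ Y mY; rewrite setTI; apply: sub_sigma_algebra => /=.
rewrite -bigcup_seq/=; exists i => /=; first by rewrite mem_index_enum.
by exists Y => //; rewrite setTI.
Qed.

Lemma measurable_fun_rV d (T : measurableType d) n (f : T -> 'rV[R]_n) :
  (forall i, measurable_fun [set: T]
     (fun x => f x ord0 i : measurableTypeR R)) ->
  measurable_fun [set: T] f.
Proof.
move=> mf _ Y mY; rewrite setTI.
pose G := [set B : set 'rV[R]_n | measurable (f @^-1` B)].
suff /(_ Y mY) : measurable `<=` G by [].
apply: smallest_sub.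
  split => [|A GA|F GF]; rewrite /G/=.
  - by rewrite preimage_set0.
  - by rewrite setTD preimage_setC; exact: measurableC.
  - by rewrite preimage_bigcup; exact: bigcupT_measurable.
rewrite -bigcup_seq => B [i _ [A mA <-]].
rewrite /G/= setTI -comp_preimage.
by rewrite -[X in measurable X]setTI; exact: mf.
Qed.

Definition rV_cons n (p : measurableTypeR R * 'rV[R]_n) : 'rV[R]_n.+1 :=
  row_mx (const_mx (p.1 : R)) p.2 : 'rV[R]_(1 + n).

Definition rV_uncons n (x : 'rV[R]_n.+1) : measurableTypeR R * 'rV[R]_n :=
  (x ord0 ord0, \row_i x ord0 (lift ord0 i)).

Lemma rV_consK n : cancel (@rV_cons n) (@rV_uncons n).
Proof.
move=> [t y]; rewrite /rV_cons /rV_uncons; congr pair => /=.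
  by rewrite mxE; case: splitP => // j _; rewrite mxE.
apply/rowP => i; rewrite !mxE; case: splitP => /= [j|j].
  by rewrite ord1.
by rewrite /bump/= !add1n => -[] /val_inj ->.
Qed.

Lemma rV_unconsK n : cancel (@rV_uncons n) (@rV_cons n).
Proof.
move=> x; apply/rowP => i; rewrite /rV_cons /rV_uncons !mxE.
case: splitP => /= [j|j] ij; rewrite !mxE.
  by congr (x _ _); apply/val_inj; rewrite /= ij (ord1 j).
by congr (x _ _); apply/val_inj; rewrite /= ij.
Qed.

Lemma measurable_rV_cons n : measurable_fun setT (@rV_cons n).
Proof.
apply: measurable_fun_rV => i; case: (unliftP ord0 i) => [j ->|->].
- rewrite (_ : (fun x => _) =
    (fun x : 'rV[R]_n => x ord0 j : measurableTypeR R) \o snd).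
    exact: (measurableT_comp (measurable_coord j) measurable_snd).
  apply/funext => p /=.
  by rewrite -[in RHS](rV_consK p) /rV_uncons /= mxE.
- rewrite (_ : (fun x => _) = fst); first exact: measurable_fst.
  by apply/funext => p; rewrite -[in RHS](rV_consK p).
Qed.

Lemma measurable_rV_uncons n : measurable_fun setT (@rV_uncons n).
Proof.
apply: measurable_fun_pair; first exact: measurable_coord.
apply: measurable_fun_rV => i; under eq_fun do rewrite mxE.
exact: measurable_coord.
Qed.

End measurable_rV_theory.

Section rV_cons_measure.
Context {R : realType} (n : nat).
Variable mu : {sigma_finite_measure set 'rV[R]_n -> \bar R}.
Local Open Scope ereal_scope.

Definition rV_cons_measure : set 'rV[R]_n.+1 -> \bar R :=
  pushforward ((@lebesgue_measure R) \x mu) (@rV_cons R n).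

Let rV_cons_measure0 : rV_cons_measure set0 = 0.
Proof. by rewrite /rV_cons_measure /pushforward preimage_set0 measure0. Qed.

Let rV_cons_measure_ge0 A : 0 <= rV_cons_measure A.
Proof. by apply: integral_ge0 => x _; exact: measure_ge0. Qed.

Let rV_cons_measure_sigma_additive : semi_sigma_additive rV_cons_measure.
Proof.
move=> F mF tF mUF; rewrite /rV_cons_measure /pushforward preimage_bigcup.
apply: measure_semi_sigma_additive.
- by move=> k; rewrite -[X in measurable X]setTI; exact: measurable_rV_cons.
- apply/trivIsetP => /= i j _ _ ij; rewrite -preimage_setI.
  by move/trivIsetP : tF => /(_ _ _ _ _ ij) ->//; rewrite preimage_set0.
- rewrite -preimage_bigcup -[X in measurable X]setTI.
  exact: measurable_rV_cons.
Qed.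

HB.instance Definition _ := isMeasure.Build _ _ _ rV_cons_measure
  rV_cons_measure0 rV_cons_measure_ge0 rV_cons_measure_sigma_additive.

Let rV_cons_measure_sigma_finite : sigma_finite setT rV_cons_measure.
Proof.
have /sigma_finiteP[F [FT ndF Foo]] := sigma_finiteT (@lebesgue_measure R).
have /sigma_finiteP[G [GT ndG Goo]] := sigma_finiteT mu.
exists (fun k => @rV_uncons R n @^-1` (F k `*` G k)).
  rewrite -preimage_bigcup (_ : \bigcup_k (F k `*` G k) = setT) ?preimage_setT//.
  rewrite -subTset => -[x y] _.
  have [i _ Fx] : (\bigcup_k F k) x by rewrite -FT.
  have [j _ Gy] : (\bigcup_k G k) y by rewrite -GT.
  exists (maxn i j) => //; split => /=.
  - by move: Fx; exact/subsetPset/ndF/leq_maxl.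
  - by move: Gy; exact/subsetPset/ndG/leq_maxr.
move=> k; have [mF Fk] := Foo k; have [mG Gk] := Goo k; split.
  rewrite -[X in measurable X]setTI; apply: measurable_rV_uncons => //.
  exact: measurableX.
rewrite /rV_cons_measure /pushforward -comp_preimage.
rewrite (_ : _ \o _ = id) ?preimage_id; last first.
  by apply/funext => p /=; rewrite rV_consK.
by rewrite product_measure1E// lte_mul_pinfty// ge0_fin_numE.
Qed.

HB.instance Definition _ := Measure_isSigmaFinite.Build _ _ _
  rV_cons_measure rV_cons_measure_sigma_finite.

End rV_cons_measure.

Fixpoint lebesgue_rV {R : realType} (n : nat) :
    {sigma_finite_measure set 'rV[R]_n -> \bar R} :=
  if n is m.+1 then rV_cons_measure (lebesgue_rV m)
  else @dirac _ 'rV[R]_0 0 R.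

Section condition_number.
Context {R : realType} (n : nat).

Definition norm2 (x : 'cV[R]_n) : R := Num.sqrt (\sum_i x i ord0 ^+ 2).

Definition opnorm2 (B : 'M[R]_n) : R :=
  sup [set norm2 (B *m x) | x in [set x : 'cV[R]_n | norm2 x <= 1]].

(* [invmx] is the identity on singular matrices, whence the case split. *)
Definition cond2 (B : 'M[R]_n) : \bar R :=
  if B \in unitmx then (opnorm2 B * opnorm2 (invmx B))%:E else +oo%E.

Definition loewner_le (A B : 'M[R]_n) : Prop :=
  forall u : 'rV[R]_n, (u *m A *m u^T) ord0 ord0 <= (u *m B *m u^T) ord0 ord0.

End condition_number.

Section simplex.
Context {R : realType} (d n : nat) (p : 'I_n -> 'rV[R]_d).

(* A simplex is given by the set [S] of indices of its vertices. *)
Implicit Type S : {set 'I_n}.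

Definition conv_of S : set 'rV[R]_d :=
  [set x | exists l : 'I_n -> R, [/\ forall i, 0 <= l i,
     \sum_(i in S) l i = 1 & x = \sum_(i in S) l i *: p i]].

Definition aff_of S : set 'rV[R]_d :=
  [set x | exists l : 'I_n -> R,
     \sum_(i in S) l i = 1 /\ x = \sum_(i in S) l i *: p i].

Definition affinely_independent S : Prop :=
  forall l : 'I_n -> R, \sum_(i in S) l i = 0 ->
    \sum_(i in S) l i *: p i = 0 -> forall i, i \in S -> l i = 0.

Definition volume S : R := fine (lebesgue_rV d (conv_of S)).

(* Distance, in the metric [G], from [p i] to the hyperplane spanned by the
   facet of [S] opposite to it. *)
Definition height (G : 'M[R]_d) S (i : 'I_n) : R :=
  inf [set Num.sqrt (((p i - y) *m G *m (p i - y)^T) ord0 ord0)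
      | y in aff_of (S :\ i)].

Definition min_height (G : 'M[R]_d) S : R :=
  inf [set height G S i | i in [set i | i \in S]].

End simplex.

(* A bounded domain whose closure is a finite union of convex polytopes; it is
   required to be the interior of its closure, so that it has no slits or
   punctures. *)
Definition polyhedral_domain {R : realType} (d : nat) (Omega : set 'rV[R]_d) :
    Prop :=
  [/\ Omega !=set0, connected Omega, interior (closure Omega) = Omega &
     exists n (p : 'I_n -> 'rV[R]_d) (P : {set {set 'I_n}}),
       closure Omega = \bigcup_(S in [set S | S \in P]) conv_of p S].

(* The interior vertices come first in the numbering: they are the
   [vertex m (lshift _ j)] for [j : 'I_(nvi m)]. An element is the set of its
   vertices. *)
Record mesh (R : realType) (d : nat) := Mesh {
  nvi : nat;
  nvb : nat;
  vertex : 'I_(nvi + nvb) -> 'rV[R]_d;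
  elements : {set {set 'I_(nvi + nvb)}}
}.

Record conforming_mesh {R : realType} (d : nat) (Omega : set 'rV[R]_d)
    (m : mesh R d) : Prop := {
  vertex_inj : injective (@vertex _ _ m);
  element_simplex : forall K, K \in elements m ->
    #|K| = d.+1 /\ affinely_independent (@vertex _ _ m) K;
  elements_cover : closure Omega =
    \bigcup_(K in [set K | K \in elements m]) conv_of (@vertex _ _ m) K;
  (* two elements meet in a common face, possibly empty *)
  elements_meet : forall K L, K \in elements m -> L \in elements m ->
    conv_of (@vertex _ _ m) K `&` conv_of (@vertex _ _ m) L =
    conv_of (@vertex _ _ m) (K :&: L);
  vertex_used : forall i, exists2 K, K \in elements m & i \in K;
  vertex_interior : forall j : 'I_(nvi m), Omega (vertex (lshift (nvb m) j));
  vertex_boundary : forall j : 'I_(nvb m), ~ Omega (vertex (rshift (nvi m) j))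
}.

Section mesh_quantities.
Context {R : realType} (d : nat) (Omega : set 'rV[R]_d) (m : mesh R d).
Implicit Types (K : {set 'I_(nvi m + nvb m)}) (j : 'I_(nvi m)).
Implicit Type DD : 'rV[R]_d -> 'M[R]_d.

Definition elt K : set 'rV[R]_d := conv_of (@vertex _ _ m) K.

Definition vol K : R := volume (@vertex _ _ m) K.

Definition nelt : R := #|elements m|%:R.

Definition domain_vol : R := fine (lebesgue_rV d Omega).

Definition avg_vol : R := domain_vol / nelt.

(* The sets below are finite: [inf] is a minimum. *)
Definition min_vol : R := inf [set vol K | K in [set K | K \in elements m]].

Definition vpatch j : {set {set 'I_(nvi m + nvb m)}} :=
  [set K in elements m | lshift (nvb m) j \in K].

Definition patch_vol j : R := \sum_(K in vpatch j) vol K.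

Definition min_patch_vol : R := inf (range patch_vol).

(* The average is taken over the interior of [K], where the coefficient is
   defined; the boundary of [K] is Lebesgue-null. *)
Definition avg_on DD K : 'M[R]_d :=
  \matrix_(a, b)
    ((vol K)^-1 * \int[lebesgue_rV d]_(x in interior (elt K)) (DD x a b)).

Definition elt_min_height DD K : R :=
  min_height (@vertex _ _ m) (invmx (avg_on DD K)) K.

Definition metric_vol DD : R :=
  \sum_(K in elements m) vol K * Num.sqrt (\det (invmx (avg_on DD K))).

Definition metric_h DD : R := (metric_vol DD / nelt) `^ (d%:R^-1).

Definition Psi : R :=
  match d with
  | 1 => 1
  | 2 => 1 + ln (avg_vol / min_vol)
  | _ => (nelt^-1 * \sum_(K in elements m)
            (avg_vol / vol K) `^ ((d%:R - 2) / 2)) `^ (2 / d%:R)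
  end.

(* Homogeneous Dirichlet conditions are built in: the function vanishes at all
   boundary vertices, hence on the boundary. Values outside the closure of the
   domain are irrelevant. *)
Record nodal_basis j (phi : 'rV[R]_d -> R) : Prop := {
  nodal_continuous : {within closure Omega, continuous phi};
  nodal_affine : forall K, K \in elements m ->
    exists (g : 'rV[R]_d) (c : R),
      forall x, elt K x -> phi x = (x *m g^T) ord0 ord0 + c;
  nodal_values : forall i, phi (vertex i) = (i == lshift (nvb m) j)%:R
}.

(* For piecewise linear functions this is the gradient off the element
   boundaries, a null set on which the value is immaterial. *)
Definition grad (f : 'rV[R]_d -> R) (x : 'rV[R]_d) : 'rV[R]_d :=
  \row_i 'D_(delta_mx ord0 i) f x.

Definition mass_matrix (phi : 'I_(nvi m) -> 'rV[R]_d -> R) : 'M[R]_(nvi m) :=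
  \matrix_(k, j) \int[lebesgue_rV d]_(x in Omega) (phi k x * phi j x).

Definition stiffness_matrix DD (phi : 'I_(nvi m) -> 'rV[R]_d -> R) :
    'M[R]_(nvi m) :=
  \matrix_(k, j) \int[lebesgue_rV d]_(x in Omega)
    (grad (phi k) x *m DD x *m (grad (phi j) x)^T) ord0 ord0.

End mesh_quantities.

(* The third condition is Lebesgue (rather than Borel) measurability. *)
Record diffusion_matrix {R : realType} (d : nat) (Omega : set 'rV[R]_d)
    (dmin dmax : R) (DD : 'rV[R]_d -> 'M[R]_d) : Prop := {
  diffusion_sym : forall x, Omega x -> (DD x)^T = DD x;
  diffusion_bounds : forall x, Omega x ->
    loewner_le dmin%:M (DD x) /\ loewner_le (DD x) dmax%:M;
  diffusion_measurable : forall a b,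
    exists2 g : 'rV[R]_d -> R, measurable_fun Omega g &
      {ae lebesgue_rV d, forall x, Omega x -> DD x a b = g x}
}.

(* Main.v *)
Require Import Defs.
From mathcomp Require Import all_boot all_order all_algebra.
From mathcomp Require Import all_classical all_reals all_analysis.
From mathcomp Require Import measurable_realfun.
From mathcomp Require Import ring lra.
Set Implicit Arguments.
Unset Strict Implicit.
Unset Printing Implicit Defensive.

Import Order.TTheory GRing.Theory Num.Theory.
Import numFieldNormedType.Exports.
Local Open Scope classical_set_scope.
Local Open Scope ring_scope.

(**
Both bounds are statements about the quadratic form of [M + dt A].

Upper bound: with [D_K] the average of [D] over [K], the gradient [g] of a
barycentric coordinate of [K] satisfies [g D_K g^T = h ^- 2], with [h] the
corresponding height of [K] in the metric [D_K^-1]; elementwise Cauchy-Schwarz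
then bounds the form by its diagonal.

Lower bound: the mass matrix dominates the patch volumes because a finite
element function stays above half of its maximum modulus on a corner of each
element. For the stiffness matrix one needs the discrete Sobolev inequality
[sum_j u_j^2 <= C N Psi |grad u|^2]. It is obtained from level sets: if
[S = {u > s'}], [P = {u > s}], and a cube of side [L] has volume [4 |P|], some
translation [tau] in this cube moves half of [S] out of [P], and integrating the
increments of [u] along the segments [[x, x + tau]] gives
[((s' - s) |S|)^2 <= C L^2 |P| int_{s < u < s'} |grad u|^2]. Applied to the
quantiles [t_i] of [u] at volumes [8^(- d i) |Omega|], this bounds
[(t_(i+1) - t_i)^2] by [C 8^((d - 2) i)] times the energy [e_i] of the [i]-th
slab, with [sum_i e_i <= |grad u|^2]. Counting the elements on which [u] exceeds
[t_i] by their volumes, and summing over [i], yields the inequality.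
*)

(** * Lebesgue measure on row vectors *)

(** The obstacle is that no constant may depend on the shape of the elements. The level set argument
    uses only that [u] is continuous, piecewise affine and nonzero on a set of finite volume, and it
    sees the mesh through element volumes alone. Translations need a function on the whole space, so
    [u] is extended by zero; that this extension is continuous rests on [Omega] being the interior
    of its closure. The constant depends on [Omega] only through its volume.

    The ratio 8 of consecutive length scales serves dimensions [d >= 3]: from one level to the next
    the weights shrink by [64 / 8 ^+ d <= 1 / 8], which absorbs the factor 2 lost in squaring a sum.
    The three forms of [Psi] come from one slab inequality: the increments of the levels decay
    geometrically for [d = 1], lose a logarithm for [d = 2], and for [d >= 3] are compensated by the
    decreasing number of elements that reach high levels.

    Superlevel sets see only positive values, so elements are treated according to the sign of their
    extremal vertex value, by means of [u] and [- u]. *)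

(** For positive [a] the pushforward, rescaled by [a], agrees with Lebesgue measure on half-open
    intervals, which determine it; negative [a] is reduced to this case by reflection. *)
Lemma lebesgue_measure_affine (R : realType) (a b : R)
    (A : set (measurableTypeR R)) : a != 0 -> measurable A ->
  lebesgue_measure ((fun x : measurableTypeR R => a * x + b) @^-1` A) =
  ((`|a|^-1)%:E * lebesgue_measure A)%E.
Proof.
have pos (c e : R) (B : set (measurableTypeR R)) : 0 < c -> measurable B ->
    lebesgue_measure ((fun x : measurableTypeR R => c * x + e) @^-1` B) =
    ((`|c|^-1)%:E * lebesgue_measure B)%E.
  move=> c0 mB.
  have mf : measurable_fun [set: measurableTypeR R]
      (fun x : measurableTypeR R => c * x + e : measurableTypeR R).
    by apply: measurable_funD => //; exact: measurable_funM.
  pose nu : {measure set (measurableTypeR R) -> \bar R} :=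
    measure_function_pushforward__canonical__measure_function_Measure
      lebesgue_measure mf.
  have c0' : 0 <= c by exact: ltW.
  have := @lebesgue_measure_unique R (mscale (NngNum c0') nu) _ B mB.
  move=> ->.
    by rewrite /mscale /= muleA -EFinM gtr0_norm // mulVf ?mul1e ?gt_eqF.
  move=> _ [[u v] _ <-] /=.
  rewrite /mscale/= /pushforward.
  have -> : (fun x => c * x + e) @^-1` `]u, v] = `](u - e) / c, (v - e) / c]%classic.
    apply/seteqP; split => x /=; rewrite !in_itv/= ltr_pdivrMr// ler_pdivlMr// [x * c]mulrC;
    by rewrite ltrBlDr lerBrDr.
  rewrite !lebesgue_measure_itv /= !lte_fin ltr_pM2r ?invr_gt0// ltrD2r.
  case: ifP => _; rewrite ?mule0// -!EFinD -EFinM.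
  congr EFin; field; exact: lt0r_neq0.
move=> a0 mA; have [a1|a1] := ltP 0 a; first exact: pos.
have an : 0 < - a by rewrite oppr_gt0 lt_neqAle a0.
rewrite -normrN -(lebesgue_measureN mA) /pushforward.
have mN : measurable ((-%R : _ -> measurableTypeR R) @^-1` A).
  rewrite -[X in measurable X]setTI.
  by apply: (@measurable_funN _ _ _ setT id) => //; exact: measurableT.
rewrite -(pos _ (- b) _ an mN); congr lebesgue_measure.
by apply/funext => x /=; rewrite opprD opprK mulNr opprK.
Qed.

Lemma measurable_homothety (R : realType) (n : nat) (a : R) (b : 'rV[R]_n) :
  measurable_fun [set: 'rV[R]_n] (fun x : 'rV[R]_n => a *: x + b).
Proof.
apply: measurable_fun_rV => i.
under eq_fun do rewrite !mxE.
apply: measurable_funD => //; apply: measurable_funM => //.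
exact: measurable_coord.
Qed.

(** Induction on [n]: the pushforward under the pair of homotheties [h], rescaled by
    [|a| ^ (n + 1)], agrees with the product measure on rectangles, which determine it. *)
Lemma lebesgue_rV_homothety (R : realType) (n : nat) (a : R) (b : 'rV[R]_n)
    (A : set 'rV[R]_n) : a != 0 -> measurable A ->
  lebesgue_rV n ((fun x : 'rV[R]_n => a *: x + b) @^-1` A) =
  ((`|a| ^- n)%:E * lebesgue_rV n A)%E.
Proof.
move=> a0; elim: n b A => [b A mA|n IHn b A mA].
  rewrite expr0 invr1 mul1e /preimage; congr (lebesgue_rV 0 _).
  by apply/funext => x /=; rewrite [_ + _]thinmx0 [x]thinmx0.
pose b1 := rV_uncons b.
pose h (p : measurableTypeR R * 'rV[R]_n) : measurableTypeR R * 'rV[R]_n :=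
  (a * p.1 + b1.1, a *: p.2 + b1.2).
have mh1 : measurable_fun [set: measurableTypeR R]
    (fun t : measurableTypeR R => a * t + b1.1 : measurableTypeR R).
  by apply: measurable_funD => //; exact: measurable_funM.
have mh : measurable_fun setT h.
  apply: measurable_fun_pair => /=.
    exact: (measurableT_comp mh1 measurable_fst).
  exact: (measurableT_comp (measurable_homothety a b1.2) measurable_snd).
pose mu := ((@lebesgue_measure R) \x (lebesgue_rV n))%E.
have cge0 : 0 <= `|a| ^+ n.+1 by rewrite exprn_ge0.
pose nu : {measure set (measurableTypeR R * 'rV[R]_n) -> \bar R} :=
  mscale (NngNum cge0)
   (measure_function_pushforward__canonical__measure_function_Measure
      mu mh).
have an0 : `|a| ^+ n.+1 != 0 by rewrite expf_neq0// normr_eq0.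
have nuE : forall X, measurable X -> mu X = nu X.
  apply: product_measure_unique => U W mU mW.
  transitivity ((`|a| ^+ n.+1)%:E * mu (h @^-1` (U `*` W)))%E; first by [].
  have -> : mu (h @^-1` (U `*` W)) =
      ((`|a|^-1)%:E * lebesgue_measure U *
       ((`|a| ^- n)%:E * lebesgue_rV n W))%E.
    transitivity (lebesgue_measure ((fun t : measurableTypeR R => a * t + b1.1)%R @^-1` U) *
        lebesgue_rV n ((fun y : 'rV[R]_n => a *: y + b1.2)%R @^-1` W))%E.
      apply: product_measure1E.
        by rewrite -[X in measurable X]setTI; exact: mh1.
      by rewrite -[X in measurable X]setTI; exact: measurable_homothety.
    by congr (_ * _)%E; [exact: lebesgue_measure_affine|exact: IHn].
  rewrite muleACA -!EFinM [LHS]muleA -EFinM.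
  by rewrite [X in (X%:E * _)%E](_ : _ = 1) ?mul1e// -invfM -exprS mulfV.
have mA' : measurable (@rV_cons R n @^-1` A).
  by rewrite -[X in measurable X]setTI; exact: measurable_rV_cons.
transitivity (mu (h @^-1` (@rV_cons R n @^-1` A))).
  congr mu; apply/funext => p /=; congr A.
  apply/rowP => i; rewrite /rV_cons /h /b1 /rV_uncons !mxE.
  by case: splitP => /= j ij; rewrite !mxE; congr (_ + b _ _);
    apply/val_inj; rewrite /= ij ?(ord1 j).
transitivity ((`|a| ^- n.+1)%:E * mu (@rV_cons R n @^-1` A))%E; last by [].
rewrite (nuE _ mA') -[LHS]mul1e -[X in (X%:E * _)%E](mulVf an0) EFinM -muleA.
by [].
Qed.

Section null_sets.
Context d (T : measurableType d) (R : realType).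
Variable mu : {measure set T -> \bar R}.
Import HBNNSimple.

Let le_integral_off_null (N : set T) (f g : T -> \bar R) :
  measurable N -> mu N = 0 ->
  (forall x, 0 <= f x)%E -> (forall x, 0 <= g x)%E ->
  (forall x, ~ N x -> f x = g x) ->
  (\int[mu]_x f x <= \int[mu]_x g x)%E.
Proof.
move=> mN N0 f0 g0 fg; rewrite !ge0_integralTE//.
apply/ge_ereal_sup => _ [h hf <-].
have mNC : measurable (~` N) by exact: measurableC.
apply: ereal_sup_ubound; exists (proj_nnsfun h mNC) => /=.
  move=> x; rewrite mindicE; case: (boolP (x \in ~` N)).
    by rewrite inE => /= xN; rewrite mulr1 -fg.
  by rewrite mulr0.
rewrite -(mrestrict h mNC) -integral_nnsfun// -setTD.
rewrite -ge0_negligible_integral//.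
- by rewrite integral_nnsfun// patch_setT.
- exact/measurable_EFinP.
- by move=> x _; rewrite lee_fin.
Qed.

(* No measurability of [f] and [g]: the integral of a nonnegative function is
   the supremum of the integrals of the simple functions below it, and these
   can be cut off on a null set. *)
Lemma eq_integral_off_null (D N : set T) (f g : T -> \bar R) :
  measurable N -> mu N = 0 -> (forall x, D x -> ~ N x -> f x = g x) ->
  (\int[mu]_(x in D) f x = \int[mu]_(x in D) g x)%E.
Proof.
move=> mN N0 fg; rewrite [LHS]integralE [RHS]integralE.
have sub u v : (forall x, 0 <= u x)%E -> (forall x, 0 <= v x)%E ->
    (forall x, D x -> ~ N x -> u x = v x) ->
    (\int[mu]_(x in D) u x = \int[mu]_(x in D) v x)%E.
  move=> u0 v0 uv; rewrite integral_mkcond [RHS]integral_mkcond.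
  have uv' x : ~ N x -> (u \_ D) x = (v \_ D) x.
    by move=> Nx; rewrite !patchE; case: ifPn => //; rewrite inE => /uv ->.
  by apply/eqP; rewrite eq_le; apply/andP; split;
    apply: (le_integral_off_null mN N0) => [x|x|x /uv' ->//];
    rewrite patchE; case: ifP.
congr (_ - _)%E; apply: sub => x // Dx Nx.
  by rewrite !funeposE fg.
by rewrite !funenegE fg.
Qed.

End null_sets.

Section open_sets.
Context (R : realType) (n : nat).

(** The conjunct [0 < e] matters when [n = 0], where the other one is void. *)
Lemma ball_rV (x y : 'rV[R]_n) (e : R) :
  ball x e y <-> 0 < e /\ forall i, `|x ord0 i - y ord0 i| < e.
Proof.
split => [[e0 xy]|[e0 xy]].
  by split => // i; exact: (xy ord0 i).
by split => // i j; rewrite (ord1 i); exact: (xy j).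
Qed.

Lemma measurable_rV_forall (P : 'I_n -> R -> Prop) :
  (forall i, measurable ([set t | P i t] : set (measurableTypeR R))) ->
  measurable [set x : 'rV[R]_n | forall i, P i (x ord0 i)].
Proof.
move=> mP.
rewrite (_ : [set _ | _] =
  \bigcap_(i in [set: 'I_n]) ((fun x : 'rV[R]_n => x ord0 i) @^-1` [set t | P i t])).
  apply: fin_bigcap_measurable => // i _.
  by rewrite -[X in measurable X]setTI; exact: (measurable_coord i).
by apply/seteqP; split => x /= Px i; [move=> _|]; exact: Px.
Qed.

Lemma measurable_ball_rV (x : 'rV[R]_n) (e : R) : measurable (ball x e).
Proof.
have [e0|e0] := ltP 0 e; last first.
  rewrite (_ : ball x e = set0); first exact: measurable0.
  by rewrite -subset0 => y /ball_rV[]; rewrite ltNge e0.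
rewrite (_ : ball x e = [set y : 'rV[R]_n | forall i, ball (x ord0 i) e (y ord0 i)]).
  by apply: (measurable_rV_forall (P := fun i => ball (x ord0 i) e)) => i; exact: measurable_ball.
by apply/seteqP; split => y; [move=> /ball_rV[_ H]|move=> H; apply/ball_rV; split].
Qed.

(** The sigma-algebra is generated by the coordinates, so [U] is written as a countable union of
    measurable balls: those with rational center and radius [1 / (k + 1)] that it contains. *)
Lemma measurable_open_rV (U : set 'rV[R]_n) : open U -> measurable U.
Proof.
move=> oU.
pose c (p : 'rV[rat]_n) : 'rV[R]_n := map_mx ratr p.
pose F (p : 'rV[rat]_n * nat) : set 'rV[R]_n :=
  [set y | ball (c p.1) p.2.+1%:R^-1 `<=` U /\ ball (c p.1) p.2.+1%:R^-1 y].
rewrite (_ : U = \bigcup_p F p).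
  apply: countable_bigcupT_measurable => [|p]; first exact: countableP.
  have [pU|pU] := pselect (ball (c p.1) p.2.+1%:R^-1 `<=` U).
    rewrite (_ : F p = ball (c p.1) p.2.+1%:R^-1); first exact: measurable_ball_rV.
    by apply/seteqP; split => y // [].
  rewrite (_ : F p = set0); first exact: measurable0.
  by rewrite -subset0 => y [].
apply/seteqP; split => [x Ux|x [p _ [pU /pU]]]//.
have /nbhs_ballP[e /= e0 xe] := open_nbhs_nbhs (conj oU Ux).
have [k /= ke] : exists k : nat, k.+1%:R^-1 < e / 2.
  have e20 : 0 < e / 2 by rewrite divr_gt0.
  have [k _ /(_ _ (leqnn _)) H] := near_infty_natSinv_lt (PosNum e20).
  by exists k.
have /choice[q qx] : forall i, exists q : rat,
    ratr q \in `]x ord0 i - k.+1%:R^-1, x ord0 i + k.+1%:R^-1[.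
  by move=> i; apply: rat_in_itvoo; rewrite ltrBlDr -addrA ltrDl addr_gt0.
have qx' i : `|ratr (q i) - x ord0 i| < k.+1%:R^-1.
  by have := qx i; rewrite in_itv/= ltr_distl.
exists (\row_i q i, k) => //; split => /=.
  move=> y /ball_rV[_ qy]; apply: xe; apply/ball_rV; split => // i.
  rewrite -(subrKA (ratr (q i))) (le_lt_trans (ler_normD _ _))//.
  rewrite [e]splitr ltrD// ?(lt_trans _ ke)// 1?distrC//.
  by have := qy i; rewrite /c !mxE distrC.
by apply/ball_rV; split => // i; rewrite /c !mxE.
Qed.

End open_sets.

Lemma lebesgue_rV_cube (R : realType) (n : nat) (a b : R) : a <= b ->
  lebesgue_rV n [set x : 'rV[R]_n | forall i, a <= x ord0 i <= b] =
  ((b - a) ^+ n)%:E.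
Proof.
move=> ab.
have mcube m : measurable [set x : 'rV[R]_m | forall i, a <= x ord0 i <= b].
  apply: (measurable_rV_forall (P := fun i t => a <= t <= b)) => i.
  rewrite (_ : [set t | _] = `[a, b]%classic); first exact: measurable_itv.
  by apply/seteqP; split => t /=; rewrite in_itv.
elim: n => [|n IHn].
  by rewrite expr0 /= diracE mem_set// => -[].
rewrite /= /rV_cons_measure /pushforward.
rewrite (_ : _ @^-1` _ =
  `[a, b]%classic `*` [set x : 'rV[R]_n | forall i, a <= x ord0 i <= b]).
  transitivity (lebesgue_measure (`[a, b]%classic : set R) * lebesgue_rV n
      [set x : 'rV[R]_n | forall i, (a <= x ord0 i <= b)%R])%E.
    by apply: product_measure1E; [exact: measurable_itv|exact: mcube].
  rewrite IHn lebesgue_measure_itv/= lte_fin.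
  case: ltgtP ab => // [ab _|-> _]; first by rewrite -EFinB -EFinM exprS.
  by rewrite subrr exprS mul0r mul0e.
apply/seteqP; split => -[t y] /=.
  rewrite in_itv/= => H; split.
    by have := H ord0; rewrite /rV_cons mxE; case: splitP => // j _; rewrite mxE.
  move=> i; have := H (lift ord0 i); rewrite /rV_cons mxE; case: splitP => j /=.
    by rewrite ord1.
  by rewrite /bump/= !add1n => -[] /val_inj ->.
rewrite in_itv/= => -[H1 H2] i; rewrite /rV_cons mxE; case: splitP => j _.
  by rewrite mxE.
exact: H2.
Qed.

(** * Translations and crossings *)

Section translations.
Context (R : realType) (n : nat).
Notation mu := (lebesgue_rV n : {sigma_finite_measure set 'rV[R]_n -> \bar R}).
Implicit Types S P Q : set 'rV[R]_n.

Lemma lebesgue_rV_translation (P : set 'rV[R]_n) (b : 'rV[R]_n) :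
  measurable P -> mu [set x | P (x + b)] = mu P.
Proof.
move=> mP; have := lebesgue_rV_homothety b (oner_neq0 R) mP.
rewrite normr1 expr1n invr1 mul1e => <-.
by congr (lebesgue_rV n _); apply/funext => x /=; rewrite scale1r.
Qed.

Lemma measurable_translation P (b : 'rV[R]_n) :
  measurable P -> measurable [set x | P (x + b)].
Proof.
move=> mP; have := @measurable_homothety R n 1 b measurableT P mP.
rewrite setTI; congr measurable.
by apply/funext => x /=; rewrite scale1r.
Qed.

Lemma measurable_addp_rV :
  measurable_fun setT (fun p : 'rV[R]_n * 'rV[R]_n => p.1 + p.2).
Proof.
apply: measurable_fun_rV => i; under eq_fun do rewrite mxE.
apply: measurable_funD.
  exact: (measurableT_comp (measurable_coord i) measurable_fst).
exact: (measurableT_comp (measurable_coord i) measurable_snd).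
Qed.

Lemma measurable_ray (b : 'rV[R]_n) :
  measurable_fun setT (fun p : 'rV[R]_n * measurableTypeR R => p.1 + p.2 *: b).
Proof.
apply: measurable_fun_rV => i; under eq_fun do rewrite !mxE.
apply: measurable_funD.
  exact: (measurableT_comp (measurable_coord i) measurable_fst).
apply: measurable_funM => //; exact: measurable_snd.
Qed.

(* On average over [tau] in the cube, a fraction [mu P / L ^+ n <= 1 / 4] of [S]
   is translated into [P]. *)
Lemma exists_translation S P (L : R) :
  measurable S -> measurable P -> (mu S < +oo)%E -> 0 < L ->
  (4%:E * mu P <= (L ^+ n)%:E)%E ->
  exists2 tau : 'rV[R]_n, (forall i, 0 <= tau ord0 i <= L) &
    (mu (S `&` [set x | P (x + tau)%R]) <= 2^-1%:E * mu S)%E.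
Proof.
move=> mS mP Soo Lgt0 PL; have L0 := ltW Lgt0; apply: contrapT => nex.
pose C := [set x : 'rV[R]_n | forall i, 0 <= x ord0 i <= L].
have mC : measurable C.
  apply: (measurable_rV_forall (P := fun i t => 0 <= t <= L)) => i.
  rewrite (_ : [set t | _] = `[0, L]%classic); first exact: measurable_itv.
  by apply/seteqP; split => t /=; rewrite in_itv.
have muC : mu C = (L ^+ n)%:E by rewrite /C lebesgue_rV_cube// subr0.
pose A := (C `*` S) `&` ((fun p : 'rV[R]_n * 'rV[R]_n => p.1 + p.2) @^-1` P).
have mA : measurable A.
  apply: measurableI; first exact: measurableX.
  by rewrite -[X in measurable X]setTI; exact: measurable_addp_rV.
have := @indic_fubini_tonelli _ _ _ _ _ mu mu A mA.
rewrite indic_fubini_tonelli_FE// indic_fubini_tonelli_GE// => E.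
(* The negated conclusion bounds every section over the cube from below; integration keeps only the
   weak inequality. *)
have le1 : (2^-1%:E * mu S * (L ^+ n)%:E <= \int[mu]_x (mu \o xsection A) x)%E.
  rewrite -muC -integral_cst// integral_mkcond; apply: ge0_le_integral => //.
  - by move=> x _; rewrite patchE; case: ifP => // _; rewrite mule_ge0.
  - apply: (iffLR (measurable_restrictT (cst _) mC)); exact: measurable_cst.
  - exact: measurable_fun_xsection.
  - move=> x _ /=; rewrite patchE; case: ifPn => [|_]; last exact: measure_ge0.
    rewrite inE => Cx.
    rewrite leNgt; apply/negP => lt; apply: nex; exists x => //.
    apply: le_trans (ltW lt); rewrite le_measure// ?inE//.
    + by apply: measurableI => //; exact: measurable_translation.
    + exact: measurable_xsection.
    + by move=> y [Sy Py]; rewrite /xsection/= inE /A/=; rewrite addrC.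
(* For fixed [y], the translations that carry [y] into [P] form a translate of [P]. *)
have le2 : (\int[mu]_x (mu \o ysection A) x <= mu S * mu P)%E.
  rewrite muleC -integral_cst// [leRHS]integral_mkcond.
  apply: ge0_le_integral => //.
  - exact: measurable_fun_ysection.
  - apply: (iffLR (measurable_restrictT (cst _) mS)); exact: measurable_cst.
  - move=> y _ /=; rewrite patchE; case: ifPn => [|/negP yS].
      rewrite inE => Sy; rewrite -(lebesgue_rV_translation y mP).
      rewrite le_measure ?inE//; first exact: measurable_ysection.
        exact: measurable_translation.
      by move=> x; rewrite /ysection/= inE /A/= => -[].
    rewrite (_ : ysection A y = set0) ?measure0// -subset0 => x.
    by rewrite /ysection/= inE => -[[_ /= Sy] _]; apply: yS; rewrite inE.
have := le_trans le1 (le_trans _ le2); rewrite E lexx => /(_ isT).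
have Sfin : mu S \is a fin_num by rewrite ge0_fin_numE.
have Pfin : mu P \is a fin_num.
  rewrite ge0_fin_numE// ltNge leye_eq; apply/negP => /eqP Py.
  by move: PL; rewrite Py mulr_infty gtr0_sg// mul1e leye_eq.
have S0 : 0 <= fine (mu S) by exact: fine_ge0.
move: PL nex; rewrite -(fineK Sfin) -(fineK Pfin) -!EFinM !lee_fin => PL nex le3.
(* Only for positive [mu S] can it be cancelled from [le3], which then contradicts [PL]; for a null
   set [S] the zero translation will do. *)
have [S00|Sn0] := eqVneq (fine (mu S)) 0.
  apply: nex; exists 0; first by move=> i; rewrite mxE lexx.
  rewrite S00 mulr0; apply: (@le_trans _ _ (mu S)).
    by rewrite le_measure ?inE//; apply: measurableI => //;
      exact: measurable_translation.
  by rewrite -[leLHS](fineK Sfin) S00.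
have Spos : 0 < fine (mu S) by rewrite lt_neqAle eq_sym Sn0.
have : 2^-1 * L ^+ n <= fine (mu P).
  by rewrite -(ler_pM2l Spos) mulrA [_ * 2^-1]mulrC.
have Ln : 0 < L ^+ n by rewrite exprn_gt0.
by lra.
Qed.

(* The left-hand side integrates, over the [x] that [tau] moves from [S] out of
   [P], a lower bound on the weighted time spent in the [Q K] on the way. *)
Lemma crossing_le (I : finType) (Q : I -> set 'rV[R]_n)
    (c : I -> R) (S P : set 'rV[R]_n) (tau : 'rV[R]_n) (h : R) :
  measurable S -> measurable P -> (forall K, measurable (Q K)) ->
  0 <= h -> (forall K, 0 <= c K) ->
  (forall x, S x -> ~ P (x + tau) -> (h%:E <= \sum_K (c K)%:E *
     lebesgue_measure [set t : R | (0 <= t <= 1)%R /\ Q K (x + t *: tau)%R])%E) ->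
  (h%:E * mu (S `\` [set x | P (x + tau)%R]) <=
   \sum_K (c K)%:E * mu (Q K))%E.
Proof.
move=> mS mP mQ h0 c0 H.
pose A K := ([set: 'rV[R]_n] `*` (`[0, 1]%classic : set (measurableTypeR R))) `&`
  ((fun p : 'rV[R]_n * measurableTypeR R => p.1 + p.2 *: tau) @^-1` Q K).
have mA K : measurable (A K).
  apply: measurableI; first by apply: measurableX => //; exact: measurable_itv.
  by rewrite -[X in measurable X]setTI; exact: measurable_ray.
have xsA K x : xsection (A K) x =
    [set t : R | (0 <= t <= 1)%R /\ Q K (x + t *: tau)%R].
  apply/seteqP; split => t; rewrite /xsection/= inE /A/= in_itv/=.
    by move=> [[_ ?] ?].
  by move=> [? ?].
(* At each time [t] in [[0, 1]] the section is a translate of [Q K], so its measure does not depend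
   on [t]. *)
have fubK K : (\int[mu]_x (lebesgue_measure \o xsection (A K)) x = mu (Q K))%E.
  have := @indic_fubini_tonelli _ _ _ _ _ mu (@lebesgue_measure R) _ (mA K).
  rewrite indic_fubini_tonelli_FE// indic_fubini_tonelli_GE// => ->.
  transitivity (\int[lebesgue_measure]_(t in
      (`[0%R, 1%R]%classic : set (measurableTypeR R))) mu (Q K))%E.
    rewrite [RHS]integral_mkcond; apply: eq_integral => t _ /=; rewrite patchE.
    case: ifPn => [|/negP tn].
      rewrite inE => t01; rewrite -(lebesgue_rV_translation (t *: tau) (mQ K)).
      congr (lebesgue_rV n _); apply/seteqP; split => x; rewrite /ysection/= inE /A/=.
        by move=> [].
      by move=> ?; split.
    rewrite (_ : ysection _ _ = set0) ?measure0// -subset0 => x.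
    by rewrite /ysection/= inE /A/= => -[[_ t01] _]; apply: tn; rewrite inE.
  rewrite integral_cst//=.
  by rewrite lebesgue_measure_itv/= lte_fin ltr01 sube0 mule1.
have mD : measurable (S `\` [set x | P (x + tau)%R]).
  by apply: measurableD => //; exact: measurable_translation.
have mx K : measurable_fun setT (lebesgue_measure \o xsection (A K)).
  exact: measurable_fun_xsection.
rewrite -integral_cst//.
apply: (@le_trans _ _ (\int[mu]_x (\sum_K (c K)%:E * lebesgue_measure (xsection (A K) x)))%E).
  rewrite integral_mkcond; apply: ge0_le_integral => //.
  - by move=> x _; rewrite patchE; case: ifP.
  - apply: (iffLR (measurable_restrictT (cst _) mD)); exact: measurable_cst.
  - apply: emeasurable_sum => K; apply: measurable_funeM; exact: mx.
  - move=> x _; rewrite patchE; case: ifPn => [|_]; last first.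
      by apply: sume_ge0 => K _; rewrite mule_ge0// lee_fin.
    rewrite inE => -[Sx Px]; apply: le_trans (H x Sx Px) _.
    by apply: lee_sum => K _; rewrite xsA.
rewrite ge0_integral_sum//; last 2 first.
- by move=> K; apply: measurable_funeM; exact: mx.
- by move=> K x _; rewrite mule_ge0// lee_fin.
apply: lee_sum => K _; rewrite ge0_integralZl//.
- by rewrite -fubK.
- exact: mx.
- by rewrite lee_fin.
Qed.

End translations.


(** * Simplices *)

Lemma continuous_bigsum (T : topologicalType) (R : numFieldType) (I : Type)
    (s : seq I) (F : I -> T -> R) : (forall i, continuous (F i)) ->
  continuous (fun x => \sum_(i <- s) F i x).
Proof.
move=> cF; elim: s => [|i s IHs].
  by under eq_fun do rewrite big_nil; exact: cst_continuous.
under eq_fun do rewrite big_cons.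
by move=> x; apply: (@continuousD _ _ _ (F i)); [exact: cF|exact: IHs].
Qed.

Section barycentric_coordinates.
Context (R : realType) (d n : nat).
Variables (p : 'I_n -> 'rV[R]_d) (K : {set 'I_n}).

Definition affine_map (g : 'rV[R]_d) (c : R) (x : 'rV[R]_d) : R :=
  (x *m g^T) ord0 ord0 + c.

Lemma affine_mapE g c x : affine_map g c x = \sum_a x ord0 a * g ord0 a + c.
Proof. by rewrite /affine_map mxE; under eq_bigr do rewrite mxE. Qed.

Lemma affine_map_comb g c (a b : R) x y : a + b = 1 ->
  affine_map g c (a *: x + b *: y) = a * affine_map g c x + b * affine_map g c y.
Proof.
move=> ab; rewrite /affine_map mulmxDl -!scalemxAl !mxE.
by rewrite -[c in LHS]mul1r -ab; ring.
Qed.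

Lemma affine_map_ray g c x (t : R) v :
  affine_map g c (x + t *: v) = affine_map g c x + t * (v *m g^T) ord0 ord0.
Proof.
by rewrite /affine_map mulmxDl -!scalemxAl !mxE; ring.
Qed.

Lemma affine_map_sum g c (I : finType) (A : {set I}) (l : I -> R)
    (x : I -> 'rV[R]_d) : \sum_(i in A) l i = 1 ->
  affine_map g c (\sum_(i in A) l i *: x i) =
  \sum_(i in A) l i * affine_map g c (x i).
Proof.
move=> l1; rewrite /affine_map mulmx_suml summxE.
under [RHS]eq_bigr do rewrite mulrDr.
rewrite big_split/= -mulr_suml l1 mul1r; congr (_ + _).
by apply: eq_bigr => i _; rewrite -scalemxAl mxE.
Qed.

Lemma continuous_affine_map g c : continuous (affine_map g c).
Proof.
rewrite (_ : affine_map g c = fun x => \sum_a x ord0 a * g ord0 a + c); last first.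
  by apply/funext => x; rewrite affine_mapE.
move=> x; apply: (@continuousD _ _ _ _ (cst c)); last exact: cst_continuous.
apply: continuous_bigsum => a {}x.
apply: (@continuousM _ _ _ (cst (g ord0 a))); last exact: cst_continuous.
exact: coord_continuous.
Qed.

Lemma measurable_affine_map g c :
  measurable_fun [set: 'rV[R]_d] (affine_map g c : _ -> measurableTypeR R).
Proof.
rewrite (_ : affine_map g c = fun x => \sum_a x ord0 a * g ord0 a + c); last first.
  by apply/funext => x; rewrite affine_mapE.
apply: measurable_funD => //; apply: measurable_sum => a.
apply: measurable_funM => //; exact: measurable_coord.
Qed.

Variables (g : 'I_n -> 'rV[R]_d) (c : 'I_n -> R).

Notation bary i := (affine_map (g i) (c i)).

(** The identities are required on the whole space and not only on the simplex, so that the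
    coordinates also describe the hyperplanes spanned by the facets. *)
Definition barycentric : Prop :=
  (forall x, \sum_(i in K) bary i x = 1) /\
  (forall x, \sum_(i in K) bary i x *: p i = x).

Hypotheses (aiK : affinely_independent p K) (gcK : barycentric).

Lemma bary_uniq (l : 'I_n -> R) x : \sum_(i in K) l i = 1 ->
  \sum_(i in K) l i *: p i = x -> forall i, i \in K -> l i = bary i x.
Proof.
move=> l1 lx i iK; apply/subr0_eq.
apply: (aiK (l := fun i => l i - bary i x)) => //.
  by rewrite sumrB l1 gcK.1 subrr.
by under eq_bigr do rewrite scalerBl; rewrite sumrB lx gcK.2 subrr.
Qed.

Lemma bary_vertex i j : i \in K -> j \in K -> bary i (p j) = (i == j)%:R.
Proof.
move=> iK jK; rewrite -(bary_uniq (l := fun i => (i == j)%:R)) //.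
  rewrite (bigD1 j)//= eqxx big1 ?addr0// => k /andP[_ /negbTE ->].
  by [].
rewrite (bigD1 j)//= eqxx scale1r big1 ?addr0// => k /andP[_ /negbTE ->].
by rewrite scale0r.
Qed.

Lemma conv_ofE : conv_of p K = [set x | forall i, i \in K -> 0 <= bary i x].
Proof.
apply/seteqP; split => x /=.
  by move=> [l [l0 l1 ->]] i iK; rewrite -(bary_uniq l1).
move=> x0; exists (fun i => if i \in K then bary i x else 0); split.
- by move=> i; case: ifPn => // iK; exact: x0.
- by rewrite -[RHS](gcK.1 x); apply: eq_bigr => i ->.
- by rewrite -[LHS](gcK.2 x); apply: eq_bigr => i ->.
Qed.

(** Together with [elements_meet] this controls the common points of two elements: the coordinate of
    every vertex that is not shared vanishes there. *)
Lemma conv_of_face (S : {set 'I_n}) x : S \subset K -> conv_of p S x ->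
  forall i, i \in K -> i \notin S -> bary i x = 0.
Proof.
move=> SK [l [l0 l1 ->]] i iK iS.
have := @bary_uniq (fun i => if i \in S then l i else 0).
move=> /(_ (\sum_(i in S) l i *: p i)); rewrite -!big_mkcondr/=.
have KS (T : nmodType) (F : 'I_n -> T) :
    \sum_(i in K | i \in S) F i = \sum_(i in S) F i.
  apply: eq_bigl => k; case: (boolP (k \in S)); rewrite ?andbF// andbT.
  by move=> /(fintype.subsetP SK) ->.
move=> <-//.
- by rewrite (negbTE iS).
- by rewrite KS.
- rewrite -[RHS]KS big_mkcondr/=; apply: eq_bigr => k _.
  by case: ifP => //; rewrite scale0r.
Qed.

Lemma conv_of_bary_le1 x i : conv_of p K x -> i \in K -> bary i x <= 1.
Proof.
rewrite conv_ofE => x0 iK; rewrite -(gcK.1 x) (bigD1 i)//= lerDl.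
by apply: sumr_ge0 => k /andP[kK _]; exact: x0.
Qed.

Lemma vertex_conv i : i \in K -> conv_of p K (p i).
Proof. by rewrite conv_ofE => iK j jK /=; rewrite bary_vertex. Qed.

End barycentric_coordinates.

(** In homogeneous coordinates the vertices are the rows of [M], and affine independence says that
    [M] is row free. With [d + 1] vertices [M] is square, and the columns of its inverse [B] hold
    the gradients and the constants. *)
Lemma barycentric_exists (R : realType) (d n : nat) (p : 'I_n -> 'rV[R]_d)
    (K : {set 'I_n}) : #|K| = d.+1 -> affinely_independent p K ->
  exists g c, barycentric p K g c.
Proof.
move=> cK aiK.
have [k0 k0K] : exists k0, k0 \in K by apply/card_gt0P; rewrite cK.
pose A : 'M[R]_(#|K|, d) := \matrix_(k < #|K|) p (enum_val k).
pose M : 'M[R]_(#|K|, d + 1) := row_mx A (const_mx 1).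
pose rk := enum_rank_in k0K.
have mulM (v : 'rV[R]_#|K|) : v *m M =
    row_mx (\sum_(i in K) v ord0 (rk i) *: p i) (\sum_(i in K) v ord0 (rk i))%:M.
  rewrite mul_mx_row; congr row_mx.
    rewrite mulmx_sum_row [RHS]big_enum_val; apply: eq_bigr => k _.
    by rewrite rowK /rk enum_valK_in.
  apply/rowP => j; rewrite ord1 !mxE eqxx mulr1n [RHS]big_enum_val.
  by apply: eq_bigr => k _; rewrite mxE mulr1 /rk enum_valK_in.
have frM : row_free M.
  rewrite -kermx_eq0; apply/rowV0P => v; rewrite sub_kermx mulM => /eqP.
  rewrite -[RHS]row_mx0 => /eq_row_mx[v1 v2].
  apply/rowP => k; rewrite mxE -[k](enum_valK_in k0K).
  apply: (aiK (fun i => v ord0 (rk i))) => //; last exact: enum_valP.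
  by move/matrixP: v2 => /(_ ord0 ord0); rewrite !mxE eqxx mulr1n.
have /row_fullP[B BM] : row_full M.
  by move: frM; rewrite /row_free /row_full => /eqP ->; rewrite cK addn1.
pose g i : 'rV[R]_d := \row_a B (lshift 1 a) (rk i).
pose c i : R := B (rshift d ord0) (rk i).
exists g, c.
have lE x i : (row_mx x 1%:M *m B) ord0 (rk i) = affine_map (g i) (c i) x.
  rewrite affine_mapE mxE big_split_ord/= big_ord_recl big_ord0 addr0; congr (_ + _).
    by apply: eq_bigr => a _; rewrite row_mxEl mxE.
  by rewrite row_mxEr mxE eqxx mul1r.
have key x : row_mx x 1%:M =
    row_mx (\sum_(i in K) affine_map (g i) (c i) x *: p i)
      (\sum_(i in K) affine_map (g i) (c i) x)%:M.
  rewrite -[LHS]mulmx1 -BM mulmxA mulM; congr row_mx; [|congr _%:M];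
    by apply: eq_bigr => i _; rewrite lE.
split => x; have [e1 e2] := eq_row_mx (key x); last by [].
by move/matrixP: e2 => /(_ ord0 ord0); rewrite !mxE eqxx !mulr1n.
Qed.

Lemma bernoulli_le (R : realDomainType) (n : nat) (t : R) : 0 <= t <= 1 ->
  1 - n%:R * t <= (1 - t) ^+ n.
Proof.
move=> /andP[t0 t1]; elim: n => [|n IHn]; first by rewrite mul0r subr0 expr0.
rewrite exprS; apply: (@le_trans _ _ ((1 - t) * (1 - n%:R * t))).
  rewrite -natr1; have : 0 <= n%:R * t * t by rewrite !mulr_ge0.
  by nra.
by rewrite ler_wpM2l// subr_ge0.
Qed.

Lemma lebesgue_rV_open_gt0 (R : realType) (d : nat) (U : set 'rV[R]_d) :
  open U -> U !=set0 -> (0 < lebesgue_rV d U)%E.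
Proof.
move=> oU [b Ub].
have /nbhs_ballP[e /= e0 bU] := open_nbhs_nbhs (conj oU Ub).
pose C := [set x : 'rV[R]_d | forall i, - (e / 2) <= x ord0 i <= e / 2].
have mC : measurable C.
  apply: (measurable_rV_forall (P := fun i t => - (e / 2) <= t <= e / 2)) => i.
  rewrite (_ : [set t | _] = `[- (e / 2), e / 2]%classic).
    exact: measurable_itv.
  by apply/seteqP; split => t /=; rewrite in_itv.
have muC : lebesgue_rV d C = ((e / 2 - - (e / 2)) ^+ d)%:E.
  by apply: lebesgue_rV_cube; lra.
apply: (@lt_le_trans _ _ (lebesgue_rV d [set x | C (x - b)%R])).
  rewrite lebesgue_rV_translation// muC lte_fin exprn_gt0//; lra.
rewrite le_measure ?inE//; first exact: measurable_translation.
  exact: measurable_open_rV.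
move=> x /= Cx; apply: bU; apply/ball_rV; split => // i.
rewrite distrC; have := Cx i; rewrite !mxE -ler_norml => /le_lt_trans; apply.
lra.
Qed.

Section simplex_measure.
Context (R : realType) (d n : nat).
Variables (p : 'I_n -> 'rV[R]_d) (K : {set 'I_n}).
Variables (g : 'I_n -> 'rV[R]_d) (c : 'I_n -> R).
Hypotheses (cK : #|K| = d.+1) (aiK : affinely_independent p K).
Hypothesis gcK : barycentric p K g c.

Notation bary i := (affine_map (g i) (c i)).
Notation mu := (lebesgue_rV d : {sigma_finite_measure set 'rV[R]_d -> \bar R}).
Let convE := conv_ofE aiK gcK.

Definition open_simplex : set 'rV[R]_d :=
  [set x | forall i, i \in K -> 0 < bary i x].

Lemma bary_setE (P : R -> Prop) :
  [set x : 'rV[R]_d | forall i, i \in K -> P (bary i x)] =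
  \bigcap_(i in [set i | i \in K]) (bary i @^-1` [set t | P t]).
Proof. by apply/seteqP; split => x /= H i iK; exact: H. Qed.

Lemma measurable_bary_set (P : R -> Prop) :
  measurable ([set t | P t] : set (measurableTypeR R)) ->
  measurable [set x : 'rV[R]_d | forall i, i \in K -> P (bary i x)].
Proof.
move=> mP; rewrite bary_setE; apply: fin_bigcap_measurable.
  exact: finite_finset.
by move=> i _; rewrite -[X in measurable X]setTI; exact: measurable_affine_map.
Qed.

Lemma measurable_conv_of : measurable (conv_of p K).
Proof.
rewrite convE; apply: (measurable_bary_set (P := fun t => 0 <= t)).
rewrite (_ : [set t | _] = `[0, +oo[%classic); first exact: measurable_itv.
by apply/seteqP; split => t /=; rewrite in_itv/= andbT.
Qed.

Lemma measurable_open_simplex : measurable open_simplex.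
Proof.
apply: (measurable_bary_set (P := fun t => 0 < t)).
rewrite (_ : [set t | _] = `]0, +oo[%classic); first exact: measurable_itv.
by apply/seteqP; split => t /=; rewrite in_itv/= andbT.
Qed.

Lemma closed_conv_of : closed (conv_of p K).
Proof.
rewrite convE (bary_setE (fun t => 0 <= t)); apply: closed_bigI => i _.
by apply: preimage_closed; [move=> x _; exact: continuous_affine_map|exact: closed_ge].
Qed.

Lemma open_open_simplex : open open_simplex.
Proof.
rewrite openE => x x0.
suff : \forall y \near x, forall i, i \in K -> 0 < bary i y by [].
apply: (@filter_forall _ _ (fun i y => i \in K -> 0 < bary i y) (nbhs x)) => i.
case: (boolP (i \in K)) => [iK|iK]; last first.
  by apply: filterS filterT => y _ iK'; case/negP: iK.
have H : nbhs x (bary i @^-1` [set t | 0 < t]).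
  apply: continuous_affine_map; apply: open_nbhs_nbhs.
  by split; [exact: open_gt|exact: x0].
by apply: filterS H => y /= ? _.
Qed.

Lemma open_simplex_conv : open_simplex `<=` conv_of p K.
Proof. by move=> x x0; rewrite convE => i iK; exact/ltW/x0. Qed.

Lemma open_simplex_interior : open_simplex `<=` interior (conv_of p K).
Proof.
rewrite -open_subsetE; [exact: open_simplex_conv|exact: open_open_simplex].
Qed.

Let b : 'rV[R]_d := \sum_(i in K) d.+1%:R^-1 *: p i.

Let bary_b i : i \in K -> bary i b = d.+1%:R^-1.
Proof.
move=> iK; rewrite -(bary_uniq aiK gcK (l := fun _ => d.+1%:R^-1))//.
by rewrite sumr_const cK -[_ *+ _]mulr_natr mulVf// pnatr_eq0.
Qed.

Lemma open_simplex_neq0 : open_simplex !=set0.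
Proof. by exists b => i iK; rewrite bary_b. Qed.

Lemma conv_of_fin : (mu (conv_of p K) < +oo)%E.
Proof.
pose B : R := \sum_i \sum_a `|p i ord0 a|.
have B0 : 0 <= B by apply: sumr_ge0 => i _; exact: sumr_ge0.
have mC : measurable [set x : 'rV[R]_d | forall i, - B <= x ord0 i <= B].
  apply: (measurable_rV_forall (P := fun i t => - B <= t <= B)) => i.
  rewrite (_ : [set t | _] = `[- B, B]%classic); first exact: measurable_itv.
  by apply/seteqP; split => t /=; rewrite in_itv.
apply: (@le_lt_trans _ _ (mu [set x : 'rV[R]_d | forall i, - B <= x ord0 i <= B])).
  rewrite le_measure ?inE//; first exact: measurable_conv_of.
  move=> x [l [l0 l1 ->]] a; rewrite -ler_norml summxE.
  rewrite (le_trans (ler_norm_sum _ _ _))// /B [leRHS](bigID (mem K))/=.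
  rewrite -[leLHS]addr0 lerD//; last first.
    by apply: sumr_ge0 => i _; exact: sumr_ge0.
  apply: ler_sum => i iK; rewrite mxE normrM ger0_norm//.
  rewrite [leRHS](bigD1 a)//= -[leLHS]addr0 lerD ?sumr_ge0//.
  rewrite ler_piMl// -l1 (bigD1 i)//= lerDl.
  by apply: sumr_ge0.
by rewrite lebesgue_rV_cube ?ltry//; lra.
Qed.

Let fin_conv : mu (conv_of p K) \is a fin_num.
Proof. by rewrite ge0_fin_numE// conv_of_fin. Qed.

Let fin_open : mu open_simplex \is a fin_num.
Proof.
rewrite ge0_fin_numE//; apply: le_lt_trans conv_of_fin.
rewrite le_measure ?inE//; [exact: measurable_open_simplex|
  exact: measurable_conv_of|exact: open_simplex_conv].
Qed.

(* The homothety of ratio [a < 1] centered at the barycenter maps the closed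
   simplex into the open one; let [a] tend to [1]. *)
Lemma conv_of_open_simplex : mu (conv_of p K) = mu open_simplex.
Proof.
apply/eqP; rewrite eq_le; apply/andP; split; last first.
  rewrite le_measure ?inE//; [exact: measurable_open_simplex|
    exact: measurable_conv_of|exact: open_simplex_conv].
rewrite -(fineK fin_conv) -(fineK fin_open) lee_fin.
set v := fine _; set w := fine _.
have v0 : 0 <= v by exact: fine_ge0.
have step t : 0 < t -> t < 1 -> v * (1 - d%:R * t) <= w.
  move=> t0 t1; have a0 : 1 - t != 0 by rewrite subr_eq0 eq_sym lt_eqF.
  have := lebesgue_rV_homothety (t *: b) a0 measurable_open_simplex.
  set D := (X in lebesgue_rV d X) => E.
  have mD : measurable D.
    rewrite -[D]setTI; apply: measurable_homothety => //.
    exact: measurable_open_simplex.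
  have : (mu (conv_of p K) <= mu D)%E.
    rewrite le_measure ?inE//; first exact: measurable_conv_of.
    move=> x; rewrite convE => x0 i iK.
    rewrite affine_map_comb ?subrK// bary_b// ltr_wpDl ?mulr_ge0 ?x0//.
      by rewrite subr_ge0 ltW.
    by rewrite mulr_gt0.
  rewrite [X in (_ <= X)%E]E -(fineK fin_conv) -(fineK fin_open) -EFinM lee_fin -/v -/w.
  rewrite gtr0_norm ?subr_gt0// => vw.
  have p0 : 0 < (1 - t) ^+ d by rewrite exprn_gt0// subr_gt0.
  apply: (@le_trans _ _ (v * (1 - t) ^+ d)).
    by rewrite ler_wpM2l// bernoulli_le// !ltW.
  by rewrite -ler_pdivlMr// mulrC.
rewrite leNgt; apply/negP => wv.
(* This makes [v * d * q] strictly less than [v - w], against [step]; the surplus in the denominator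
   keeps [q < 1]. *)
pose q := (v - w) / (v * d.+1%:R + (v - w)).
have d1 : 1 <= d.+1%:R :> R by rewrite ler1n.
have w0 : 0 <= w by exact: fine_ge0.
have vw0 : 0 < v - w by lra.
have vp : 0 < v by lra.
have den : 0 < v * d.+1%:R + (v - w) by nra.
have q0 : 0 < q by rewrite divr_gt0.
have q1 : q < 1 by rewrite ltr_pdivrMr// mul1r ltrDr mulr_gt0// ltr0n.
have qE : q * (v * d.+1%:R + (v - w)) = v - w by rewrite divfK// gt_eqF.
have := step q q0 q1; rewrite leNgt => /negP; apply.
have : q * (v * d%:R + v) + q * (v - w) = v - w.
  by rewrite -[RHS]qE -natr1; ring.
have : 0 < q * (v - w) by exact: mulr_gt0.
have : 0 < q * v by exact: mulr_gt0.
by nra.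
Qed.

Lemma conv_of_setD_open_simplex : mu (conv_of p K `\` open_simplex) = 0.
Proof.
rewrite measureD ?conv_of_fin//; last 2 first.
- exact: measurable_conv_of.
- exact: measurable_open_simplex.
rewrite (_ : _ `&` _ = open_simplex).
  by rewrite [X in (X - _)%E]conv_of_open_simplex subee.
by apply/setIidPr; exact: open_simplex_conv.
Qed.

Lemma volume_gt0 : 0 < volume p K.
Proof.
rewrite /volume fine_gt0// conv_of_fin andbT conv_of_open_simplex.
by apply: lebesgue_rV_open_gt0; [exact: open_open_simplex|exact: open_simplex_neq0].
Qed.

Lemma volumeE : mu (conv_of p K) = (volume p K)%:E.
Proof. by rewrite /volume fineK. Qed.

Lemma measurable_corner i (e : R) :
  measurable (conv_of p K `&` [set x | 1 - e <= bary i x]).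
Proof.
apply: measurableI; first exact: measurable_conv_of.
rewrite (_ : [set x | _] = bary i @^-1` `[1 - e, +oo[%classic).
  rewrite -[X in measurable X]setTI.
  by apply: measurable_affine_map => //; exact: measurable_itv.
by apply/seteqP; split => t /=; rewrite in_itv/= andbT.
Qed.

(** The homothety of ratio [e] centered at [p i] maps the simplex into this corner. *)
Lemma corner_volume i (e : R) : i \in K -> 0 < e -> e <= 1 ->
  ((e ^+ d * volume p K)%:E <=
   mu (conv_of p K `&` [set x | (1 - e <= bary i x)%R]))%E.
Proof.
move=> iK e0 e1; set D := conv_of p K `&` _.
have mD : measurable D by exact: measurable_corner.
have en0 : e != 0 by rewrite gt_eqF.
have := lebesgue_rV_homothety ((1 - e) *: p i) en0 mD.
set D' := (X in lebesgue_rV d X) => E.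
have mD' : measurable D' by rewrite -[D']setTI; exact: measurable_homothety.
have : (mu (conv_of p K) <= mu D')%E.
  rewrite le_measure ?inE//; first exact: measurable_conv_of.
  move=> x; rewrite convE => x0; rewrite /D' /D convE /=.
  have ee : e + (1 - e) = 1 by rewrite addrC subrK.
  split.
    move=> k kK; rewrite affine_map_comb// (bary_vertex aiK gcK)//.
    by rewrite addr_ge0// mulr_ge0 ?x0// ?subr_ge0// ltW.
  rewrite affine_map_comb// (bary_vertex aiK gcK)// eqxx mulr1 lerDr.
  by rewrite mulr_ge0 ?x0// ltW.
have fD : mu D \is a fin_num.
  rewrite ge0_fin_numE//; apply: le_lt_trans conv_of_fin.
  by rewrite le_measure ?inE//; [exact: measurable_conv_of|exact: subIsetl].
rewrite [X in (_ <= X)%E]E volumeE -(fineK fD) -EFinM !lee_fin gtr0_norm//.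
by rewrite [leRHS]mulrC ler_pdivlMr ?exprn_gt0// mulrC.
Qed.

(** Removing the null boundary makes the corners of distinct elements disjoint, so that their
    volumes can be added. *)
Lemma corner_open_volume i (e : R) : i \in K -> 0 < e -> e <= 1 ->
  ((e ^+ d * volume p K)%:E <= mu (open_simplex `&`
     (conv_of p K `&` [set x | (1 - e <= bary i x)%R])))%E.
Proof.
move=> iK e0 e1; apply: (le_trans (corner_volume iK e0 e1)).
set Q := _ `&` [set x | _].
have mQ : measurable Q by exact: measurable_corner.
have mO := measurable_open_simplex.
have mN : measurable (conv_of p K `\` open_simplex).
  by apply: measurableD => //; exact: measurable_conv_of.
have mOQ : measurable (open_simplex `&` Q) by exact: measurableI.
apply: (@le_trans _ _
    (mu ((open_simplex `&` Q) `|` (conv_of p K `\` open_simplex)))).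
  rewrite le_measure ?inE//; first exact: measurableU.
  move=> x Qx; have [xo|xo] := pselect (open_simplex x); first by left.
  by right; split => //; case: Qx.
apply: (le_trans (measureU2 _ _ _)) => //.
by rewrite [X in (_ + X)%E]conv_of_setD_open_simplex adde0.
Qed.

End simplex_measure.


(** * Linear algebra *)

Section condition_number_bound.
Context (R : realType) (n : nat).
Implicit Types (x y : 'cV[R]_n) (B : 'M[R]_n).

Definition qform B x y : R := (x^T *m B *m y) ord0 ord0.

Lemma norm2_sqr x : norm2 x ^+ 2 = \sum_i x i ord0 ^+ 2.
Proof. by rewrite /norm2 sqr_sqrtr// sumr_ge0// => i _; rewrite sqr_ge0. Qed.

Lemma norm2_ge0 x : 0 <= norm2 x. Proof. exact: sqrtr_ge0. Qed.

Lemma norm2_eq0 x : norm2 x = 0 -> x = 0.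
Proof.
move=> x0; have := norm2_sqr x; rewrite x0 expr0n/= => /esym/eqP.
rewrite psumr_eq0 => [/allP H|i _]; last by rewrite sqr_ge0.
apply/colP => i; rewrite mxE; have := H i (mem_index_enum _).
by rewrite sqrf_eq0 => /eqP.
Qed.

Lemma dot_norm2 x : (x^T *m x) ord0 ord0 = norm2 x ^+ 2.
Proof. by rewrite norm2_sqr mxE; apply: eq_bigr => i _; rewrite mxE expr2. Qed.

Lemma qformDZ B x y (t : R) : B^T = B ->
  qform B (x + t *: y) (x + t *: y) =
  qform B x x + 2 * t * qform B x y + t ^+ 2 * qform B y y.
Proof.
move=> Bs; have sym : qform B y x = qform B x y.
  have E : y^T *m B *m x = (x^T *m B *m y)^T.
    by rewrite !trmx_mul trmxK Bs mulmxA.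
  by rewrite /qform E mxE.
have E (M N : 'M[R]_1) : (M + N) ord0 ord0 = M ord0 ord0 + N ord0 ord0.
  by rewrite mxE.
have EZ a (M : 'M[R]_1) : (a *: M) ord0 ord0 = a * M ord0 ord0 by rewrite mxE.
have ET : (x + t *: y)^T = x^T + t *: y^T by apply/rowP => i; rewrite !mxE.
rewrite {1}/qform ET !mulmxDl !mulmxDr -!scalemxAl -!scalemxAr.
rewrite !(E, EZ) -/(qform B x x) -/(qform B x y) -/(qform B y x).
rewrite -/(qform B y y) sym; ring.
Qed.

Lemma qform_cauchy_schwarz B x y : B^T = B -> (forall z, 0 <= qform B z z) ->
  qform B x y ^+ 2 <= qform B x x * qform B y y.
Proof.
move=> Bs B0.
set a := qform B y y; set b := qform B x y; set e := qform B x x.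
have H t : 0 <= e + 2 * t * b + t ^+ 2 * a by rewrite -qformDZ.
have a0 : 0 <= a by exact: B0.
have e0 : 0 <= e by exact: B0.
have [a00|an0] := eqVneq a 0.
  have [->|bn0] := eqVneq b 0; first by rewrite expr0n mulr_ge0.
  (* With [a = 0] the form is affine in [t], and this [t] would give it the value [- 1]. *)
  have := H (- (e + 1) / (2 * b)).
  rewrite a00 mulr0 addr0.
  have -> : 2 * (- (e + 1) / (2 * b)) * b = - (e + 1) by field.
  lra.
have ap : 0 < a by rewrite lt_neqAle eq_sym an0.
have := H (- b / a).
have -> : e + 2 * (- b / a) * b + (- b / a) ^+ 2 * a = (e * a - b ^+ 2) / a.
  by field.
by rewrite pmulr_lge0 ?invr_gt0// subr_ge0.
Qed.

Lemma norm2_cauchy_schwarz x y : (x^T *m y) ord0 ord0 <= norm2 x * norm2 y.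
Proof.
have q1 z w : qform 1%:M z w = (z^T *m w) ord0 ord0 by rewrite /qform mulmx1.
have := @qform_cauchy_schwarz 1%:M x y (trmx1 _ _).
rewrite !q1 !dot_norm2 -exprMn => H.
apply: le_trans (ler_norm _) _.
rewrite -(@ler_pXn2r _ 2)// ?nnegrE ?normr_ge0 ?mulr_ge0 ?norm2_ge0//.
rewrite real_normK ?num_real//; apply: H => z.
by rewrite q1 dot_norm2 sqr_ge0.
Qed.

Lemma opnorm2_le B (c : R) : 0 <= c ->
  (forall x, norm2 (B *m x) <= c * norm2 x) -> 0 <= opnorm2 B <= c.
Proof.
move=> c0 H; rewrite /opnorm2; set A := [set _ | _ in _].
have ubA : ubound A c.
  move=> _ [x /= x1 <-]; apply: le_trans (H x) _.
  by rewrite -[leRHS]mulr1 ler_wpM2l.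
have norm20 : norm2 (0 : 'cV[R]_n) = 0.
  by rewrite /norm2 big1 ?sqrtr0// => i _; rewrite mxE expr0n.
have A0 : A 0.
  by exists 0; rewrite /= ?mulmx0 norm20.
have hA : has_sup A by split; [exists 0|exists c].
by rewrite (ub_le_sup hA.2 A0)/= ge_sup//; exists 0.
Qed.

(** No diagonalization: Cauchy-Schwarz for the form [B] between [y = B x] and [x] gives
    [|y| ^ 4 <= L |y| ^ 2 * L |x| ^ 2], and for [z] the preimage of [x] one has
    [m |z| ^ 2 <= z . x <= |z| |x|]. *)
Lemma cond2_le B (m L : R) : B^T = B -> 0 < m ->
  (forall x, m * norm2 x ^+ 2 <= qform B x x <= L * norm2 x ^+ 2) ->
  0 <= L -> (cond2 B <= (L / m)%:E)%E.
Proof.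
move=> Bs m0 H L0.
have Bu : B \in unitmx.
  rewrite -row_free_unit -kermx_eq0; apply/rowV0P => v.
  rewrite sub_kermx => /eqP vB.
  have /andP[] := H v^T; rewrite {1}/qform trmxK vB mul0mx mxE => {}H _.
  have : norm2 v^T = 0.
    apply/eqP; rewrite -sqrf_eq0 eq_le sqr_ge0 andbT.
    by rewrite -(pmulr_rle0 _ m0).
  by move=> /norm2_eq0 /(congr1 trmx); rewrite trmxK trmx0.
rewrite /cond2 Bu lee_fin.
have B0 z : 0 <= qform B z z.
  have /andP[+ _] := H z; apply: le_trans.
  by rewrite mulr_ge0// ?sqr_ge0// ltW.
have /andP[ub0 ub1] : 0 <= opnorm2 B <= L.
  apply: opnorm2_le => // x; set y := B *m x.
  have [->|y0] := eqVneq (norm2 y) 0; first by rewrite mulr_ge0// norm2_ge0.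
  have yp : 0 < norm2 y by rewrite lt_neqAle eq_sym y0 norm2_ge0.
  have := qform_cauchy_schwarz y x Bs B0.
  rewrite {1}/qform -mulmxA -/y dot_norm2 => cs.
  have : norm2 y ^+ 2 * norm2 y ^+ 2 <= norm2 y ^+ 2 * (L * norm2 x) ^+ 2.
    rewrite -[X in X <= _]expr2; apply: le_trans cs _.
    apply: (@le_trans _ _ ((L * norm2 y ^+ 2) * (L * norm2 x ^+ 2))).
      by rewrite ler_pM//; [have /andP[] := H y|have /andP[] := H x].
    by rewrite le_eqVlt; apply/orP; left; apply/eqP; ring.
  rewrite ler_pM2l ?exprn_gt0// ler_pXn2r// ?nnegrE ?norm2_ge0//.
  by rewrite mulr_ge0// norm2_ge0.
have /andP[ui0 ui1] : 0 <= opnorm2 (invmx B) <= m^-1.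
  apply: opnorm2_le => [|x]; first by rewrite invr_ge0 ltW.
  set z := invmx B *m x.
  have Bz : B *m z = x by rewrite mulmxA mulmxV// mul1mx.
  have [->|z0] := eqVneq (norm2 z) 0; first by rewrite mulr_ge0// ?norm2_ge0// invr_ge0 ltW.
  have zp : 0 < norm2 z by rewrite lt_neqAle eq_sym z0 norm2_ge0.
  have /andP[+ _] := H z; rewrite /qform -mulmxA Bz => h1.
  have := le_trans h1 (norm2_cauchy_schwarz z x).
  rewrite expr2 mulrCA ler_pM2l// => h2.
  by rewrite ler_pdivlMl.
by rewrite ler_pM.
Qed.

End condition_number_bound.

(** The determinant of [(1 - t) I + t A] is a polynomial in [t] with value 1 at 0. If it were
    nonpositive at 1 it would vanish somewhere on [[0, 1]], and a kernel vector there would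
    contradict positivity. *)
Lemma det_gt0 (R : realType) (n : nat) (A : 'M[R]_n) :
  (forall u : 'rV[R]_n, u != 0 -> 0 < (u *m A *m u^T) ord0 ord0) ->
  0 < \det A.
Proof.
move=> Apos.
pose P : 'M[{poly R}]_n := \matrix_(i, j)
  ((1 - 'X) * (i == j)%:R%:P + 'X * (A i j)%:P).
have PE t : (\det P).[t] = \det ((1 - t)%:M + t *: A).
  rewrite -[LHS]/(horner_eval t (\det P)) -det_map_mx; congr (\det _).
  apply/matrixP => i j; rewrite !mxE /= /horner_eval !hornerE.
  by case: eqP => _; rewrite ?mulr1 ?mulr0.
have P1 : (\det P).[1] = \det A.
  by rewrite PE subrr scale1r -scalemx1 scale0r add0r.
have P0 : (\det P).[0] = 1 by rewrite PE subr0 scale0r addr0 det1.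
rewrite ltNge; apply/negP => dA.
have ivt : (- \det P).[0] <= 0 <= (- \det P).[1].
  by rewrite !hornerN P0 P1 oppr_le0 ler01 oppr_ge0.
have [t /andP[t0 t1]] := poly_ivt ler01 ivt.
rewrite /root hornerN oppr_eq0 PE => /det0P[v v0 vM].
have : 0 < (v *m ((1 - t)%:M + t *: A) *m v^T) ord0 ord0.
  rewrite mulmxDr mulmxDl mul_mx_scalar -!scalemxAr -!scalemxAl.
  have vv : 0 < (v *m v^T) ord0 ord0.
    rewrite lt_neqAle eq_sym; apply/andP; split.
      apply: contraNneq v0; rewrite mxE => /eqP.
      rewrite psumr_eq0 => [/allP H|i _]; last by rewrite mxE -expr2 sqr_ge0.
      apply/eqP/rowP => i; have := H i (mem_index_enum _).
      by rewrite !mxE -expr2 sqrf_eq0 => /eqP.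
    by rewrite mxE sumr_ge0// => i _; rewrite mxE -expr2 sqr_ge0.
  have vA := Apos v v0.
  have E (M N : 'M[R]_1) : (M + N) ord0 ord0 = M ord0 ord0 + N ord0 ord0.
    by rewrite mxE.
  have EZ a (M : 'M[R]_1) : (a *: M) ord0 ord0 = a * M ord0 ord0 by rewrite mxE.
  rewrite E !EZ.
  move: t0; rewrite le_eqVlt => /orP[/eqP <-|t0].
    by rewrite mul0r addr0 subr0 mul1r.
  by rewrite ltr_wpDl ?mulr_gt0 ?mulr_ge0 ?subr_ge0// ltW.
by rewrite vM mul0mx mxE ltxx.
Qed.

(** * Heights of a simplex and gradients of barycentric coordinates *)

Section simplex_heights.
Context (R : realType) (d n : nat).
Variables (p : 'I_n -> 'rV[R]_d) (K : {set 'I_n}).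
Variables (g : 'I_n -> 'rV[R]_d) (c : 'I_n -> R) (D : 'M[R]_d).
Hypotheses (d1 : (1 <= d)%N) (cK : #|K| = d.+1).
Hypotheses (aiK : affinely_independent p K) (gcK : barycentric p K g c).
Hypothesis Dsym : D^T = D.
Hypothesis Dpos : forall u : 'rV[R]_d, u != 0 -> 0 < (u *m D *m u^T) ord0 ord0.

Let q i : R := (g i *m D *m (g i)^T) ord0 ord0.

Let Du : D \in unitmx.
Proof. by rewrite unitmxE unitfE gt_eqF// det_gt0. Qed.

Let affine_mapB i x y : affine_map (g i) (c i) x - affine_map (g i) (c i) y =
  ((x - y) *m (g i)^T) ord0 ord0.
Proof. by rewrite /affine_map mulmxBl !mxE; ring. Qed.

Let g_neq0 i : i \in K -> g i != 0.
Proof.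
move=> iK; have [j /setD1P[ji jK]] : exists j, j \in K :\ i.
  by apply/card_gt0P; rewrite -ltnS; move: cK; rewrite (cardsD1 i) iK add1n => ->.
apply/eqP => gi0; have := affine_mapB i (p i) (p j).
rewrite !(bary_vertex aiK gcK)// eqxx eq_sym (negbTE ji).
by rewrite gi0 trmx0 mulmx0 mxE subr0 => /eqP; rewrite oner_eq0.
Qed.

Let q_gt0 i : i \in K -> 0 < q i.
Proof. by move=> iK; exact/Dpos/g_neq0. Qed.

Let bary_aff i y : i \in K -> aff_of p (K :\ i) y ->
  affine_map (g i) (c i) y = 0.
Proof.
move=> iK [l [l1 ->]]; rewrite affine_map_sum// big1// => k /setD1P[ki kK].
by rewrite (bary_vertex aiK gcK)// eq_sym (negbTE ki) mulr0.
Qed.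

Let aff_bary i y : i \in K -> affine_map (g i) (c i) y = 0 ->
  aff_of p (K :\ i) y.
Proof.
move=> iK y0; exists (fun k => affine_map (g k) (c k) y); split.
  by rewrite -[RHS](gcK.1 y) [RHS](bigD1 i)//= y0 add0r; apply: eq_bigl => k;
    rewrite !inE andbC.
rewrite -[LHS](gcK.2 y) [LHS](bigD1 i)//= y0 scale0r add0r; apply: eq_bigl => k.
by rewrite !inE andbC.
Qed.

Let dist i y := Num.sqrt (((p i - y) *m invmx D *m (p i - y)^T) ord0 ord0).

(** Cauchy-Schwarz for [invmx D] between [p i - y] and [g i *m D]: their product is the increment of
    the coordinate [i] from the facet to the vertex, which is 1. *)
Let dist_ge i y : i \in K -> aff_of p (K :\ i) y -> Num.sqrt (q i)^-1 <= dist i y.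
Proof.
move=> iK yi; rewrite /dist; set w := p i - y; set s := (_ *m _) ord0 ord0.
have isym : (invmx D)^T = invmx D by rewrite trmx_inv Dsym.
have ipos z : 0 <= qform (invmx D) z z.
  have [->|z0] := eqVneq z 0; first by rewrite /qform mulmx0 mxE.
  rewrite /qform (_ : z^T *m invmx D *m z =
      (z^T *m invmx D) *m D *m (z^T *m invmx D)^T).
    apply/ltW/Dpos; apply: contraNneq z0 => /(congr1 (mulmx^~ D)).
    by rewrite mulmxKV// mul0mx => /(congr1 trmx); rewrite trmxK trmx0 => ->.
  by rewrite mulmxKV// trmx_mul trmxK isym mulmxA.
have := qform_cauchy_schwarz (w^T) (D *m (g i)^T) isym ipos.
have -> : qform (invmx D) w^T (D *m (g i)^T) = 1.
  rewrite /qform trmxK mulmxA mulmxKV// -affine_mapB.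
  by rewrite (bary_vertex aiK gcK)// eqxx bary_aff// subr0.
have -> : qform (invmx D) w^T w^T = s by rewrite /qform trmxK.
have -> : qform (invmx D) (D *m (g i)^T) (D *m (g i)^T) = q i.
  by rewrite /qform trmx_mul trmxK Dsym mulmxA mulmxK.
have qi := q_gt0 iK.
rewrite expr1n => sq; rewrite ler_sqrt; last first.
  by rewrite -(pmulr_lge0 _ qi) (le_trans ler01).
by rewrite -[_^-1]mul1r ler_pdivrMr.
Qed.

(** The orthogonal projection of [p i] onto the opposite facet in the metric [invmx D], the case of
    equality in [dist_ge]. *)
Let foot i := p i - (q i)^-1 *: (g i *m D).

Let foot_aff i : i \in K -> aff_of p (K :\ i) (foot i).
Proof.
move=> iK; have qi := q_gt0 iK; apply: aff_bary => //.
have /eqP := affine_mapB i (p i) (foot i).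
rewrite (bary_vertex aiK gcK)// eqxx /foot subKr -scalemxAl mxE -/(q i).
by rewrite mulVf ?(gt_eqF qi)// subr_eq addrC -subr_eq subrr => /eqP.
Qed.

Let dist_foot i : i \in K -> dist i (foot i) = Num.sqrt (q i)^-1.
Proof.
move=> iK; have qi := q_gt0 iK.
rewrite /dist /foot subKr -!scalemxAl mulmxK//.
rewrite linearZ/= -scalemxAr scalerA mxE trmx_mul Dsym mulmxA -/(q i).
by congr Num.sqrt; field; rewrite gt_eqF.
Qed.

Lemma heightE i : i \in K ->
  height p (invmx D) K i = Num.sqrt ((g i *m D *m (g i)^T) ord0 ord0)^-1.
Proof.
move=> iK; apply/eqP; rewrite eq_le /height; apply/andP; split.
  apply: ge_inf.
    by exists 0 => _ [y _ <-]; exact: sqrtr_ge0.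
  exists (foot i); first exact: foot_aff.
  exact: dist_foot.
apply: lb_le_inf.
  by exists (dist i (foot i)); exists (foot i) => //; exact: foot_aff.
by move=> _ [y yi <-]; exact: dist_ge.
Qed.

(** Replacing each [q i] by the sum of all of them gives one positive lower bound for every
    height. *)
Lemma min_height_gt0 : 0 < min_height p (invmx D) K.
Proof.
have [k0 k0K] : exists k0, k0 \in K by apply/card_gt0P; rewrite cK.
have S0 : 0 < \sum_(k in K) q k.
  rewrite (bigD1 k0)//= ltr_pwDl ?q_gt0// sumr_ge0// => k /andP[kK _].
  by rewrite ltW// q_gt0.
apply: (@lt_le_trans _ _ (Num.sqrt (\sum_(k in K) q k)^-1)).
  by rewrite sqrtr_gt0 invr_gt0.
apply: lb_le_inf; first by exists (height p (invmx D) K k0); exists k0.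
move=> _ [i iK <-]; rewrite heightE//; have qi := q_gt0 iK; have qi0 := ltW qi.
rewrite ler_sqrt ?invr_ge0//.
rewrite lef_pV2 ?posrE ?q_gt0// (bigD1 i)//= lerDl sumr_ge0// => k /andP[kK _].
by rewrite ltW// q_gt0.
Qed.

Lemma grad_le_min_height i : i \in K ->
  (g i *m D *m (g i)^T) ord0 ord0 <= min_height p (invmx D) K ^- 2.
Proof.
move=> iK; have a0 := min_height_gt0; have qi := q_gt0 iK.
have ai : min_height p (invmx D) K <= Num.sqrt (q i)^-1.
  rewrite -heightE//; apply: ge_inf; last by exists i.
  exists 0 => _ [k kK <-]; rewrite heightE//; exact: sqrtr_ge0.
rewrite -/(q i) -[X in _ <= X]mul1r ler_pdivlMr ?exprn_gt0// -ler_pdivlMl//.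
rewrite mulr1 -[X in _ <= X]sqr_sqrtr ?invr_ge0 ?(ltW qi)//.
by rewrite ler_pXn2r// nnegrE ?sqrtr_ge0// ltW.
Qed.

End simplex_heights.


(** * Extension by zero of finite element functions *)

Section mesh_functions.
Context (R : realType) (d : nat) (Omega : set 'rV[R]_d) (m : mesh R d).
Hypothesis Omega_reg : interior (closure Omega) = Omega.
Hypothesis Hm : conforming_mesh Omega m.
Notation n := (nvi m + nvb m)%N.
Notation p := (@vertex R d m).
Variables (g : {set 'I_n} -> 'I_n -> 'rV[R]_d) (c : {set 'I_n} -> 'I_n -> R).
Hypothesis gcE : forall K, K \in elements m -> barycentric p K (g K) (c K).
Variable phi : 'I_(nvi m) -> 'rV[R]_d -> R.
Hypothesis Hphi : forall j, nodal_basis Omega j (phi j).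

Notation bary K i := (affine_map (g K i) (c K i)).
Notation v j := (lshift (nvb m) j).

Let aiE K : K \in elements m -> affinely_independent p K.
Proof. by move=> KE; have [] := element_simplex Hm KE. Qed.

Lemma domain_open : open Omega.
Proof. by rewrite -Omega_reg; exact: open_interior. Qed.

Lemma elt_closure K : K \in elements m -> elt K `<=` closure Omega.
Proof. by move=> KE x xK; rewrite (elements_cover Hm); exists K. Qed.

Lemma closure_elt x : closure Omega x -> exists2 K, K \in elements m & elt K x.
Proof. by rewrite (elements_cover Hm) => -[K KE xK]; exists K. Qed.

Lemma nodal_bary K j x : K \in elements m -> elt K x ->
  phi j x = (v j \in K)%:R * bary K (v j) x.
Proof.
move=> KE xK; have [g0 [c0 phiE]] := nodal_affine (Hphi j) KE.
have xE := (gcE KE).2 x; have s1 := (gcE KE).1 x.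
rewrite phiE// -[LHS]/(affine_map g0 c0 x) -[in LHS]xE affine_map_sum//.
have phip i : i \in K -> affine_map g0 c0 (p i) = (i == v j)%:R.
  move=> iK; rewrite /affine_map -phiE ?(nodal_values (Hphi j))//.
  exact: (vertex_conv (aiE KE) (gcE KE)).
under eq_bigr => i iK do rewrite phip//.
have [vK|vK] := boolP (v j \in K).
  rewrite (bigD1 (v j))//= eqxx mulr1 mul1r big1 ?addr0// => i /andP[_ /negbTE ->].
  by rewrite mulr0.
rewrite mul0r big1// => i iK; case: eqP => [iv|]; last by rewrite mulr0.
by move: vK; rewrite -iv iK.
Qed.

(** There are no hanging nodes: a vertex lying in [L] would lie on a face of its own element that
    omits it, where its own coordinate is 0 instead of 1. *)
Let vertex_patch j L : L \in elements m -> v j \notin L -> ~ elt L (p (v j)).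
Proof.
move=> LE vL vL'; have [K KE vK] := vertex_used Hm (v j).
have : (elt K `&` elt L) (p (v j)).
  by split => //; exact: (vertex_conv (aiE KE) (gcE KE)).
rewrite /elt (elements_meet Hm KE LE) => /(conv_of_face (aiE KE) (gcE KE)).
move=> /(_ (subsetIl _ _) _ vK); rewrite inE vK/= vL => /(_ isT).
by rewrite (bary_vertex (aiE KE) (gcE KE))// eqxx => /eqP; rewrite oner_eq0.
Qed.

(* The homothety of ratio [e] centered at the vertex [v] maps a neighborhood of
   [x] close to [v], where every element contains [v]; being positive at [x],
   [phi j] exceeds [1 - e] on the image, so that pulling back its points keeps
   them in their elements. Hence [x] is interior to the union of the elements. *)
Lemma nodal_support j x : closure Omega x -> phi j x != 0 -> Omega x.
Proof.
move=> cx phix; have [K KE xK] := closure_elt cx.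
have := nodal_bary j KE xK; have [vK|vK] := boolP (v j \in K); last first.
  by rewrite mul0r => E; rewrite E eqxx in phix.
rewrite mul1r => phixE.
have convK := conv_ofE (aiE KE) (gcE KE).
have phix0 : 0 < phi j x.
  rewrite lt_neqAle eq_sym phix phixE.
  by move: xK; rewrite /elt convK => /(_ _ vK).
set pv := p (v j).
have : \forall y \near pv, Omega y /\
    forall L, L \in elements m -> elt L y -> v j \in L.
  apply: filterI.
    apply: open_nbhs_nbhs; split; first exact: domain_open.
    exact: (vertex_interior Hm j).
  apply: (@filter_forall _ _
    (fun L y => L \in elements m -> elt L y -> v j \in L) (nbhs pv)) => L.
  have [LE|LE] := boolP (L \in elements m); last first.
    by apply: filterS filterT => y _ LE'; case/negP: LE.
  have [vL|vL] := boolP (v j \in L); first by apply: filterS filterT.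
  have : nbhs pv (~` elt L).
    apply: open_nbhs_nbhs; split; last exact: vertex_patch.
    exact/closed_openC/(closed_conv_of (aiE LE) (gcE LE)).
  by apply: filterS => y yL _ /yL.
move=> /nbhs_ballP[r /= r0 rU].
pose B := \sum_i `|x ord0 i - pv ord0 i|.
have B0 : 0 <= B by exact: sumr_ge0.
have Br : 0 < B + r by rewrite ltr_wpDl.
(* As [B] bounds the distance from [x] to the vertex, this ratio brings [h x] into the ball of
   radius [r]; adding [r] in the denominator keeps it meaningful when [B = 0]. *)
pose e := r / (B + r) / 2.
have e0 : 0 < e by rewrite !divr_gt0.
have e1 : e < 1.
  rewrite ltr_pdivrMr// mul1r (le_lt_trans (_ : _ <= 1)) ?ltr1n//.
  by rewrite ler_pdivrMr// mul1r lerDr.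
have eB : e * B < r.
  rewrite /e mulrAC ltr_pdivrMr// mulrAC ltr_pdivrMr// -mulrA ltr_pM2l//.
  by lra.
pose h (z : 'rV[R]_d) := (1 - e) *: pv + e *: z.
have ee : (1 - e) + e = 1 by rewrite subrK.
have pvy : ball pv r (h x).
  apply/ball_rV; split => // i; rewrite /h !mxE.
  rewrite (_ : _ - _ = e * (pv ord0 i - x ord0 i)); last by ring.
  rewrite normrM (gtr0_norm e0) distrC (le_lt_trans _ eB)// ler_pM2l//.
  by rewrite /B (bigD1 i)//= lerDl sumr_ge0.
have hK : elt K (h x).
  move: xK; rewrite /elt convK => x0 i iK; rewrite affine_map_comb//.
  rewrite (bary_vertex (aiE KE) (gcE KE))// addr_ge0// mulr_ge0 ?x0// ?(ltW e0)//.
  by rewrite subr_ge0 ltW.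
have phihx : 1 - e < phi j (h x).
  rewrite (nodal_bary j KE hK) vK mul1r affine_map_comb//.
  by rewrite (bary_vertex (aiE KE) (gcE KE))// eqxx mulr1 -phixE ltrDl mulr_gt0.
have Ohx : Omega (h x) by have [] := rU _ pvy.
have nO : nbhs (h x) Omega by apply: open_nbhs_nbhs; split => //; exact: domain_open.
have nW : \forall z \near h x, [/\ ball pv r z, Omega z & 1 - e < phi j z].
  have n1 : nbhs (h x) (ball pv r).
    by apply: open_nbhs_nbhs; split => //; exact: ball_open.
  have n2 : \forall z \near h x, closure Omega z -> 1 - e < phi j z.
    have := nodal_continuous (Hphi j).
    move=> /subspace_continuousP /(_ _ (subset_closure Ohx)).
    move=> /(_ [set t | 1 - e < t]); apply.
    by apply: open_nbhs_nbhs; split; [exact: open_gt|exact: phihx].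
  near=> z; split; [near: z; exact: n1|near: z; exact: nO|].
  by (have : closure Omega z by apply: subset_closure; near: z; exact: nO); near: z.
have hc : continuous h.
  move=> z; apply: (@continuousD _ _ _ (cst ((1 - e) *: pv))).
    exact: cst_continuous.
  exact: scaler_continuous.
rewrite -Omega_reg.
have : nbhs x (h @^-1` [set z | [/\ ball pv r z, Omega z & 1 - e < phi j z]]).
  exact: hc.
apply: filterS => z [/rU[_ zU] Oz phiz].
have [L LE zL] := closure_elt (subset_closure Oz).
have vL := zU L LE zL.
apply: (elt_closure LE); move: (zL); rewrite /elt.
rewrite (conv_ofE (aiE LE) (gcE LE)) => z0 i iL.
have := z0 i iL; rewrite affine_map_comb// (bary_vertex (aiE LE) (gcE LE))//.
have [-> _|iv] := eqVneq i (v j); last by rewrite mulr0 add0r pmulr_rge0.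
move: phiz; rewrite (nodal_bary j LE zL) vL mul1r affine_map_comb//.
rewrite (bary_vertex (aiE LE) (gcE LE))// eqxx mulr1 ltrDl.
by rewrite pmulr_rgt0// => /ltW.
Unshelve. all: by end_near. Qed.

(** Outside the closure of [Omega] the values of [phi j] are unconstrained, hence the test. *)
Definition zero_ext (u : 'I_(nvi m) -> R) (x : 'rV[R]_d) : R :=
  if x \in closure Omega then \sum_j u j * phi j x else 0.

Lemma zero_ext_elt (u : 'I_(nvi m) -> R) K x : K \in elements m -> elt K x ->
  zero_ext u x = affine_map (\sum_j (u j * (v j \in K)%:R) *: g K (v j))
    (\sum_j (u j * (v j \in K)%:R) * c K (v j)) x.
Proof.
move=> KE xK; rewrite /zero_ext mem_set; last exact: (elt_closure KE).
rewrite /affine_map linear_sum/= mulmx_sumr summxE -big_split/=.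
apply: eq_bigr => j _; rewrite (nodal_bary j KE xK) linearZ/= -scalemxAr mxE.
by rewrite /affine_map; ring.
Qed.

(** The critical points are those of the closure outside [Omega]: there every [phi j] vanishes by
    [nodal_support], so the values from both sides tend to 0. *)
Lemma zero_ext_continuous u : continuous (zero_ext u).
Proof.
move=> x; set uh := fun z => \sum_j u j * phi j z.
have nuh : closure Omega x -> forall e, 0 < e ->
    \forall z \near x, closure Omega z -> `|uh x - uh z| < e.
  move=> cx e e0.
  have cuh : uh @ within (closure Omega) (nbhs x) --> uh x.
    rewrite /uh; elim: (index_enum _) => [|j s IHs].
      by under eq_fun do rewrite big_nil; rewrite big_nil; exact: cvg_cst.
    under eq_fun do rewrite big_cons; rewrite big_cons.
    apply: cvgD; last exact: IHs.
    apply: cvgM; first exact: cvg_cst.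
    by have /subspace_continuousP := nodal_continuous (Hphi j); apply.
  by move/cvgrPdist_lt : cuh => /(_ e e0).
apply: (iffRL (@cvgrPdist_lt _ _ _ (nbhs x) (nbhs_filter x) _ _)) => e e0.
have [cx|cx] := pselect (closure Omega x); last first.
  have : nbhs x (~` closure Omega).
    by apply: open_nbhs_nbhs; split => //; exact/closed_openC/closed_closure.
  apply: (@filterS _ (nbhs x)) => z cz; rewrite /zero_ext memNset// memNset//.
  by rewrite subrr normr0.
have [Ox|Ox] := pselect (Omega x).
  have nO : nbhs x Omega by apply: open_nbhs_nbhs; split => //; exact: domain_open.
  apply: filterS2 nO (nuh cx e e0) => z /subset_closure cz /(_ cz).
  by rewrite /zero_ext mem_set// mem_set.
have uhx : uh x = 0.
  apply: big1 => j _; have [->|/(nodal_support cx)//] := eqVneq (phi j x) 0.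
  by rewrite mulr0.
apply: filterS (nuh cx e e0) => z zuh.
rewrite /zero_ext (mem_set cx); case: ifPn => [|_].
  by rewrite inE => /zuh.
by rewrite -/(uh x) uhx subrr normr0.
Qed.

Lemma zero_ext_support u x : zero_ext u x != 0 -> Omega x.
Proof.
rewrite /zero_ext; case: ifPn => [|_]; last by rewrite eqxx.
rewrite inE => cx; apply: contraNP => Ox; apply/eqP/big1 => j _.
by have [->|/(nodal_support cx)//] := eqVneq (phi j x) 0; rewrite mulr0.
Qed.

End mesh_functions.


(** * Level sets of piecewise affine functions *)

(** Expand the nonnegative sum of [(Q * a K - A) ^+ 2 * q K], where [Q] is the sum of the weights
    and [A] the weighted sum; this avoids square roots of the weights. *)
Lemma weighted_cauchy_schwarz (R : realDomainType) (I : finType) (q a : I -> R) :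
  (forall K, 0 <= q K) ->
  (\sum_K a K * q K) ^+ 2 <= (\sum_K q K) * (\sum_K a K ^+ 2 * q K).
Proof.
move=> q0; set A := \sum_K a K * q K; set Q := \sum_K q K.
have [Q0|Q0] := eqVneq Q 0.
  have q00 K : q K = 0.
    have : \sum_K q K == 0 by rewrite -/Q Q0.
    rewrite psumr_eq0// => /allP H.
    by apply/eqP/H; rewrite mem_index_enum.
  rewrite /A big1 => [|K _]; last by rewrite q00 mulr0.
  by rewrite Q0 mul0r expr0n.
have Qp : 0 < Q by rewrite lt_neqAle eq_sym Q0 sumr_ge0.
have : 0 <= \sum_K (Q * a K - A) ^+ 2 * q K.
  by apply: sumr_ge0 => K _; rewrite mulr_ge0// sqr_ge0.
have -> : \sum_K (Q * a K - A) ^+ 2 * q K =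
    Q * (Q * (\sum_K a K ^+ 2 * q K) - A ^+ 2).
  transitivity (Q ^+ 2 * (\sum_K a K ^+ 2 * q K) - 2 * Q * A * A + A ^+ 2 * Q).
    have E K : (Q * a K - A) ^+ 2 * q K =
        Q ^+ 2 * (a K ^+ 2 * q K) - 2 * Q * A * (a K * q K) + A ^+ 2 * q K by ring.
    by under eq_bigr do rewrite E; rewrite big_split sumrB -!mulr_sumr.
  by ring.
by rewrite pmulr_rge0// subr_ge0.
Qed.

Section finite_covers.
Context d (T : measurableType d) (R : realType).
Variable mu : {measure set T -> \bar R}.
Variables (I : finType) (B : I -> set T).
Hypothesis mB : forall i, measurable (B i).

Lemma fsbig_finType (F : I -> \bar R) :
  (\sum_(i \in [set: I]) F i = \sum_i F i)%R.
Proof.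
have := @fsbig_seq _ _ _ _ (index_enum I) F (index_enum_uniq I).
rewrite (_ : [set` index_enum I] = [set: I]) => [-> //|].
by apply/seteqP; split => // i _ /=; exact: mem_index_enum.
Qed.

Lemma measure_le_sum (A : set T) : measurable A -> A `<=` \bigcup_i B i ->
  (mu A <= \sum_i mu (B i))%E.
Proof.
move=> mA AB; rewrite -(fsbig_finType (fun i => mu (B i))).
by apply: content_sub_fsum => //; exact: finite_finset.
Qed.

Lemma measure_bigcup_fin : trivIset setT B ->
  mu (\bigcup_i B i) = (\sum_i mu (B i))%E.
Proof.
move=> tB; rewrite -(fsbig_finType (fun i => mu (B i))).
by apply: measure_fin_bigcup => //; exact: finite_finset.
Qed.

End finite_covers.

Section piecewise_affine_functions.
Context (R : realType) (d : nat) (I : finType).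
Notation mu := (lebesgue_rV d : {sigma_finite_measure set 'rV[R]_d -> \bar R}).
Notation lambda := (@lebesgue_measure R).
Variables (W : 'rV[R]_d -> R) (El El0 : I -> set 'rV[R]_d).
Variables (gam : I -> 'rV[R]_d) (bet : I -> R).
Hypothesis W_continuous : continuous W.
Hypothesis W_cover : forall x, W x != 0 -> exists K, El K x.
Hypothesis W_affine : forall K x, El K x -> W x = affine_map (gam K) (bet K) x.
Hypothesis mEl : forall K, measurable (El K).
Hypothesis El_fin : forall K, (mu (El K) < +oo)%E.
Hypothesis mEl0 : forall K, measurable (El0 K).
Hypothesis El0_trivIset : trivIset setT El0.
Hypothesis El_El0 : forall K, mu (El K `\` El0 K) = 0.

Let slab s s' K := El K `&` [set x | s < W x < s'].

Let dot (u w : 'rV[R]_d) : R := (u *m w^T) ord0 ord0.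

Let measurable_affine_slab K s s' :
  measurable [set x | s < affine_map (gam K) (bet K) x < s'].
Proof.
rewrite (_ : [set x | _] = affine_map (gam K) (bet K) @^-1` `]s, s'[%classic).
  rewrite -[X in measurable X]setTI.
  by apply: measurable_affine_map => //; exact: measurable_itv.
by apply/seteqP; split => t /=; rewrite in_itv.
Qed.

Let measurable_slab s s' K : measurable (slab s s' K).
Proof.
rewrite (_ : slab s s' K = El K `&` [set x | s < affine_map (gam K) (bet K) x < s']).
  exact: measurableI.
by apply/seteqP; split => x [xK /= h]; split => //=; move: h;
  rewrite (W_affine xK).
Qed.

Lemma open_superlevel t : open [set x | t < W x].
Proof.
apply: (@open_comp _ _ W [set y | t < y]); last exact: open_gt.
by move=> x _; exact: W_continuous.
Qed.

Let measurable_superlevel t : measurable [set x | t < W x].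
Proof. by apply: measurable_open_rV; exact: open_superlevel. Qed.

Let crossing_times x tau s s' K :=
  [set t : R | (0 <= t <= 1)%R /\ slab s s' K (x + t *: tau)%R].

Let measurable_crossing_times x tau s s' K :
  measurable (crossing_times x tau s s' K : set (measurableTypeR R)).
Proof.
rewrite (_ : crossing_times x tau s s' K = `[0, 1]%classic `&`
    ((fun t : measurableTypeR R => x + t *: tau) @^-1` slab s s' K)).
  apply: measurableI; first exact: measurable_itv.
  rewrite -[X in measurable X]setTI.
  have mf : measurable_fun [set: measurableTypeR R]
      (fun t : measurableTypeR R => x + t *: tau).
    apply: measurable_fun_rV => i; under eq_fun do rewrite !mxE.
    by apply: measurable_funD => //; exact: measurable_funM.
  exact: mf.
by apply/seteqP; split => t /=; rewrite in_itv.
Qed.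

(* By the intermediate value theorem the images of the [crossing_times] under
   the affine restrictions of [W] cover [(s, s')]. *)
Let crossing_time x tau s s' : 0 <= s -> s < s' ->
  s' <= W x -> W (x + tau) <= s ->
  ((s' - s)%:E <= \sum_K `|dot tau (gam K)|%:E *
     lambda (crossing_times x tau s s' K))%E.
Proof.
move=> s0 ss' s'W Ws.
pose w t := W (x + t *: tau).
have wc : continuous w.
  have rc : continuous (fun t : R^o => x + t *: tau : 'rV[R]_d).
    move=> t; apply: (@continuousD _ _ _ (cst x) (fun t : R => t *: tau)).
      exact: cst_continuous.
    exact: scalel_continuous.
  move=> t; apply: continuous_comp; [exact: rc|exact: W_continuous].
pose a K := dot tau (gam K).
pose b K := affine_map (gam K) (bet K) x.
(* The image of the crossing times under the affine restriction. Where the segment runs along a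
   level set of that restriction the image is at most one value, a null set. *)
pose B K : set R := if a K == 0 then [set b K]
  else (fun y => (a K)^-1 * y + (- (b K / a K))) @^-1` crossing_times x tau s s' K.
have mB K : measurable (B K : set (measurableTypeR R)).
  rewrite /B; case: ifP => _; first exact: measurable_set1.
  rewrite -[X in measurable X]setTI.
  have mf : measurable_fun [set: measurableTypeR R]
      (fun y : measurableTypeR R => (a K)^-1 * y + (- (b K / a K)) : measurableTypeR R).
    by apply: measurable_funD => //; exact: measurable_funM.
  by apply: mf => //; exact: measurable_crossing_times.
have BE K : lambda (B K) = (`|a K|%:E * lambda (crossing_times x tau s s' K))%E.
  rewrite /B; case: ifPn => [/eqP ->|aK0].
    by rewrite lebesgue_measure_set1 normr0 mul0e.
  have ai : (a K)^-1 != 0 by rewrite invr_eq0.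
  have := lebesgue_measure_affine (- (b K / a K)) ai
    (measurable_crossing_times x tau s s' K).
  by rewrite normfV invrK.
have -> : (s' - s)%:E = lambda `]s, s'[%classic.
  by rewrite lebesgue_measure_itv/= lte_fin ss' EFinB.
rewrite -(eq_bigr _ (fun K _ => BE K)).
apply: measure_le_sum; [exact: mB|exact: measurable_itv|].
move=> y /=; rewrite in_itv/= => /andP[sy ys'].
have w0 : w 0 = W x by rewrite /w scale0r addr0.
have w1 : w 1 = W (x + tau) by rewrite /w scale1r.
have [t] : exists2 t, t \in `[0, 1] & w t = y.
  apply: IVT => //; first by move=> t; exact/continuous_subspaceT.
  rewrite w0 w1 ge_min le_max.
  by rewrite (le_trans Ws (ltW sy)) (le_trans (ltW ys') s'W) orbT.
rewrite in_itv/= => t01 wty.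
have [K xK] : exists K, El K (x + t *: tau).
  by apply: W_cover; rewrite -/(w t) wty gt_eqF// (le_lt_trans s0).
have yE : y = b K + t * a K.
  by rewrite -wty /w (W_affine xK) affine_map_ray.
exists K => //; rewrite /B; case: ifPn => [/eqP aK0|aK0].
  by rewrite /= yE aK0 mulr0 addr0.
have tE : (a K)^-1 * y + - (b K / a K) = t by rewrite yE; field.
rewrite /preimage/= tE; split => //; split => //=.
by rewrite -/(w t) wty sy.
Qed.

Let slab_vol s s' K := fine (mu (slab s s' K)).

Let slab_fin s s' K : mu (slab s s' K) \is a fin_num.
Proof.
rewrite ge0_fin_numE//; apply: le_lt_trans (El_fin K).
by rewrite le_measure ?inE//; exact: subIsetl.
Qed.

(** The pieces [El] may overlap; passing to the disjoint [El0] costs only null sets. *)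
Let sum_slab_vol s s' : (mu [set x | (s < W x)%R] < +oo)%E ->
  \sum_K slab_vol s s' K <= fine (mu [set x | s < W x]).
Proof.
move=> fs; rewrite -lee_fin fineK ?ge0_fin_numE// -sumEFin.
under eq_bigr do rewrite fineK//.
have slab0 K : mu (slab s s' K) = mu (slab s s' K `&` El0 K).
  have mS0 : measurable (slab s s' K `&` El0 K) by exact: measurableI.
  have mSD : measurable (slab s s' K `\` El0 K) by exact: measurableD.
  rewrite -[in LHS](setUIDK (slab s s' K) (El0 K)) measureU//; last first.
    by apply/seteqP; split => // y [[_ y0] [_]]; case.
  rewrite [X in (_ + X)%E](_ : _ = 0) ?adde0//.
  apply/eqP; rewrite eq_le measure_ge0 andbT -(El_El0 K) le_measure ?inE//.
    exact: measurableD.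
  by move=> x [[xK _] x0]; split.
under eq_bigr do rewrite slab0.
rewrite -measure_bigcup_fin.
- rewrite le_measure ?inE//.
    apply: fin_bigcup_measurable; first exact: finite_finset.
    by move=> K _; exact: measurableI.
  by move=> x [K _ [[_ /= /andP[]]]].
- by move=> K; exact: measurableI.
- apply/trivIsetP => K L _ _ KL; apply/seteqP; split => // x [[_ xK] [_ xL]].
  move/trivIsetP : El0_trivIset => /(_ K L Logic.I Logic.I KL) /seteqP[+ _].
  by apply; split.
Qed.


Let cauchy_schwarz_dot (u w : 'rV[R]_d) : dot u w ^+ 2 <= dot u u * dot w w.
Proof.
have H := @qform_cauchy_schwarz R d 1%:M u^T w^T (trmx1 _ _).
move: H; rewrite /qform !mulmx1 !trmxK; apply => z.
by rewrite mulmx1 dot_norm2 sqr_ge0.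
Qed.

(** The integral of the squared gradient of [W] over the slab between the levels [s] and [s']. *)
Let energy s s' := \sum_K dot (gam K) (gam K) * slab_vol s s' K.

(** Every point that [tau] moves from above [s'] to below [s] crosses the slab. These points fill
    half of the upper set, whence the factor 4 after squaring; [d * L ^+ 2] bounds the squared
    length of [tau], and Cauchy-Schwarz is used once on vectors and once on the sum over the
    pieces. *)
Lemma level_decrease s s' (L : R) : 0 <= s -> s < s' -> 0 < L ->
  (mu [set x | (s < W x)%R] < +oo)%E ->
  4 * fine (mu [set x | s < W x]) <= L ^+ d ->
  ((s' - s) * fine (mu [set x | s' < W x])) ^+ 2 <=
  4 * d%:R * L ^+ 2 * fine (mu [set x | s < W x]) * energy s s'.
Proof.
move=> s0 ss' L0 fs PL.
set P := [set x | s < W x]; set S := [set x | s' < W x].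
have SP : S `<=` P by move=> x /=; exact: lt_trans.
have fP : mu P \is a fin_num by rewrite ge0_fin_numE.
have fS : mu S \is a fin_num.
  by rewrite ge0_fin_numE//; apply: le_lt_trans fs; rewrite le_measure ?inE//;
    exact: measurable_superlevel.
have hS : (mu S < +oo)%E by rewrite -ge0_fin_numE.
have hP : (4%:E * mu P <= (L ^+ d)%:E)%E by rewrite -(fineK fP) -EFinM lee_fin.
have [tau tauL Stau] := exists_translation (measurable_superlevel s')
  (measurable_superlevel s) hS L0 hP.
have mP := measurable_superlevel s; have mS := measurable_superlevel s'.
have mt : measurable [set x | P (x + tau)] by exact: measurable_translation.
have H := @crossing_le R d I (slab s s') (fun K => `|dot tau (gam K)|) S P tau
  (s' - s) (measurable_superlevel _) (measurable_superlevel _)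
  (measurable_slab s s').
have {}H : ((s' - s)%:E * mu (S `\` [set x | P (x + tau)%R]) <=
    \sum_K `|dot tau (gam K)|%:E * mu (slab s s' K))%E.
  apply: H => //; first by rewrite subr_ge0 ltW.
  move=> x Sx Px; apply: crossing_time => //; first exact: ltW.
  by rewrite leNgt; apply/negP.
have half : 2^-1 * fine (mu S) <= fine (mu (S `\` [set x | P (x + tau)])).
  have E : mu S = (mu (S `&` [set x | P (x + tau)%R]) +
      mu (S `\` [set x | P (x + tau)%R]))%E.
    rewrite -measureU//.
    - by rewrite setUIDK.
    - exact: measurableI.
    - exact: measurableD.
    - by apply/seteqP; split => // y [[_ y0] [_]]; case.
  have f1 : mu (S `&` [set x | P (x + tau)%R]) \is a fin_num.
    rewrite ge0_fin_numE//; apply: (@le_lt_trans _ _ (mu S)); last by rewrite -ge0_fin_numE.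
    by rewrite le_measure ?inE//; exact: measurableI.
  have f2 : mu (S `\` [set x | P (x + tau)%R]) \is a fin_num.
    rewrite ge0_fin_numE//; apply: (@le_lt_trans _ _ (mu S)); last by rewrite -ge0_fin_numE.
    by rewrite le_measure ?inE//; exact: measurableD.
  have /(congr1 fine) := E; rewrite fineD//.
  move: Stau; rewrite -(fineK f1) -(fineK fS) -EFinM lee_fin /=; lra.
have {}H : (s' - s) * (2^-1 * fine (mu S)) <=
    \sum_K `|dot tau (gam K)| * slab_vol s s' K.
  have f2 : mu (S `\` [set x | P (x + tau)%R]) \is a fin_num.
    rewrite ge0_fin_numE//; apply: (@le_lt_trans _ _ (mu S)); last by rewrite -ge0_fin_numE.
    by rewrite le_measure ?inE//; exact: measurableD.
  apply: (@le_trans _ _ ((s' - s) * fine (mu (S `\` [set x | P (x + tau)])))).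
    by rewrite ler_wpM2l// subr_ge0 ltW.
  rewrite -lee_fin EFinM fineK// (le_trans H)// -sumEFin.
  by apply: lee_sum => K _; rewrite EFinM /slab_vol fineK.
have q0 K : 0 <= slab_vol s s' K by exact: fine_ge0.
have tau2 : dot tau tau <= d%:R * L ^+ 2.
  rewrite /dot mxE (@le_trans _ _ (\sum_(i < d) L ^+ 2))//.
    apply: ler_sum => i _; rewrite mxE -expr2.
    by have /andP[t0 tL] := tauL i; rewrite ler_pXn2r// nnegrE// ltW.
  by rewrite sumr_const card_ord -[_ *+ d]mulr_natl.
have cs : (\sum_K `|dot tau (gam K)| * slab_vol s s' K) ^+ 2 <=
    fine (mu P) * (d%:R * L ^+ 2 * energy s s').
  have := @weighted_cauchy_schwarz R I (slab_vol s s') (fun K => `|dot tau (gam K)|) q0.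
  move=> /le_trans; apply; apply: ler_pM.
  - exact: sumr_ge0.
  - by apply: sumr_ge0 => K _; rewrite mulr_ge0// sqr_ge0.
  - exact: sum_slab_vol.
  rewrite /energy mulr_sumr; apply: ler_sum => K _; rewrite mulrA ler_wpM2r//.
  rewrite real_normK ?num_real// (le_trans (cauchy_schwarz_dot _ _))//.
  by rewrite ler_wpM2r// /dot -[gam K in X in X *m _]trmxK dot_norm2 sqr_ge0.
have le2 : ((s' - s) * (2^-1 * fine (mu S))) ^+ 2 <=
    fine (mu P) * (d%:R * L ^+ 2 * energy s s').
  apply: le_trans cs; rewrite ler_pXn2r// nnegrE.
    by rewrite !mulr_ge0// ?subr_ge0 ?(ltW ss')// fine_ge0.
  by apply: sumr_ge0 => K _; rewrite mulr_ge0.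
have -> : ((s' - s) * fine (mu S)) ^+ 2 = 4 * ((s' - s) * (2^-1 * fine (mu S))) ^+ 2.
  by field.
rewrite -!mulrA ler_pM2l//; apply: le_trans le2 _.
by rewrite le_eqVlt; apply/orP; left; apply/eqP; ring.
Qed.

Let energy_mono s1 s1' s2 s2' : s2 <= s1 -> s1' <= s2' ->
  energy s1 s1' <= energy s2 s2'.
Proof.
move=> h h'; apply: ler_sum => K _; rewrite ler_wpM2l//.
  by rewrite /dot -[gam K in X in X *m _]trmxK dot_norm2 sqr_ge0.
rewrite /slab_vol fine_le// le_measure ?inE//.
by move=> x [xK /= /andP[a1 a2]]; split => //=; rewrite (le_lt_trans h)// (lt_le_trans a2).
Qed.

(* [t i] is the level above which [W] has volume [V / (8 ^+ d) ^+ i]. *)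
Lemma level_sequence (V L : R) : 0 < V -> (mu [set x | (0 < W x)%R] <= V%:E)%E ->
  0 < L -> 4 * V <= L ^+ d -> (exists B, forall x, W x <= B) ->
  exists t e : nat -> R,
  [/\ t 0%N = 0, {homo t : i j / (i <= j)%N >-> i <= j}, (forall i, 0 <= e i) &
  [/\ (forall k, \sum_(i < k) e i <=
         \sum_K (gam K *m (gam K)^T) ord0 ord0 * fine (mu (El K))),
      (forall i, (t i.+1 - t i) ^+ 2 <=
         4 * d%:R * L ^+ 2 * 64 ^+ d / V * ((8 ^+ d) ^+ i / 64 ^+ i) * e i) &
      (forall i s, t i < s ->
         fine (mu [set x | s < W x]) <= V / (8 ^+ d) ^+ i)]].
Proof.
move=> V0 muV L0 LV [B WB].
pose M s := fine (mu [set x | s < W x]).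
have mW s := measurable_superlevel s.
have foo s : 0 <= s -> (mu [set x | (s < W x)%R] < +oo)%E.
  move=> s0; apply: (@le_lt_trans _ _ V%:E); last by rewrite ltry.
  by apply: le_trans muV; rewrite le_measure ?inE// => x /=; exact: le_lt_trans.
have ffin s : 0 <= s -> mu [set x | s < W x] \is a fin_num.
  by move=> s0; rewrite ge0_fin_numE// foo.
have Mle s s' : 0 <= s -> s <= s' -> M s' <= M s.
  move=> s0 ss'; apply: fine_le; rewrite ?ffin//; first exact: le_trans ss'.
  by rewrite le_measure ?inE// => x /=; exact: le_lt_trans.
have MV : M 0 <= V by rewrite -lee_fin fineK ?ffin.
pose Mi i := V / (8 ^+ d) ^+ i.
have p8 k : 0 < 8 ^+ k :> R by rewrite exprn_gt0.
have p64 k : 0 < 64 ^+ k :> R by rewrite exprn_gt0.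
have p8d k : 0 < (8 ^+ d) ^+ k :> R by rewrite exprn_gt0.
have Mi0 i : 0 < Mi i by rewrite divr_gt0.
have MiS i : Mi i.+1 = Mi i / 8 ^+ d.
  by rewrite /Mi exprSr invfM mulrA.
have Mi_le i : Mi i.+1 <= Mi i.
  by rewrite MiS ler_pdivrMr// ler_peMr ?(ltW (Mi0 i))// exprn_ege1// ler1n.
(* Zero is put in by hand, so that the supremum is over a nonempty set and [t i] is nonnegative. *)
pose A i := [set s : R | 0 <= s /\ (s = 0 \/ Mi i < M s)].
have A0 i : A i 0 by split => //; left.
have ubA i : has_ubound (A i).
  exists (Num.max 0 B) => s [s0 [->|Ms]]; first by rewrite le_max lexx.
  rewrite le_max; apply/orP; right; rewrite leNgt; apply/negP => Bs.
  move: Ms; rewrite /M (_ : [set x | _] = set0) ?measure0.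
    by rewrite ltNge/= (ltW (Mi0 i)).
  by rewrite -subset0 => x /=; rewrite ltNge (le_trans (WB x) (ltW Bs)).
pose t i := sup (A i).
have t0 i : 0 <= t i by exact: ub_le_sup.
have tlow i s : t i < s -> M s <= Mi i.
  move=> ts; rewrite leNgt; apply/negP => Ms; move: ts; rewrite ltNge => /negP; apply.
  have [s0|s0] := leP 0 s; first by apply: ub_le_sup => //; split => //; right.
  by rewrite (le_trans (ltW s0)).
have thigh i s : 0 <= s -> s < t i -> Mi i < M s.
  move=> s0 st; have hA : has_sup (A i) by split; [exists 0|exact: ubA].
  have ts : 0 < t i - s by rewrite subr_gt0.
  have [r [r0 [r00|Mr]] sr] := sup_adherent ts hA.
  - by move: sr; rewrite subKr r00 ltNge s0.
  - move: sr; rewrite subKr => sr; apply: (lt_le_trans Mr).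
    exact: Mle (ltW sr).
have tS i : t i <= t i.+1.
  apply: ge_sup; first by exists 0.
  move=> s [s0 [->|Ms]]; first exact: t0.
  by apply: ub_le_sup => //; split => //; right; exact: le_lt_trans Ms.
have tmono : {homo t : i j / (i <= j)%N >-> i <= j}.
  by apply: homo_leq => //; exact: le_trans.
have t00 : t 0%N = 0.
  apply/eqP; rewrite eq_le t0 andbT; apply: ge_sup; first by exists 0.
  move=> s [s0 [->//|Ms]]; move: Ms; rewrite ltNge /Mi expr0 divr1.
  by rewrite (le_trans _ MV)// Mle.
pose e i := energy (t i) (t i.+1).
have dot0 K : 0 <= dot (gam K) (gam K).
  by rewrite /dot -[gam K in X in X *m _]trmxK dot_norm2 sqr_ge0.
have e0 i : 0 <= e i.
  by apply: sumr_ge0 => K _; rewrite mulr_ge0// fine_ge0.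
exists t, e; split => //; split => // [k|i].
  rewrite /e /energy exchange_big/=; apply: ler_sum => K _.
  rewrite -mulr_sumr ler_wpM2l// -lee_fin fineK; last by rewrite ge0_fin_numE.
  rewrite -sumEFin; under eq_bigr do rewrite /slab_vol fineK//.
  rewrite -measure_bigcup_fin//; last first.
    apply/trivIsetP => i j _ _; wlog ij : i j / (i < j)%N.
      move=> W0 ij; have := ij; rewrite neq_ltn => /orP[ltij|ltji].
        exact: W0.
      by rewrite setIC; apply: W0 => //; rewrite eq_sym.
    move=> _; apply/seteqP; split => // x [[_ /= /andP[_ x1]] [_ /= /andP[x2 _]]].
    have := lt_trans x2 x1; rewrite ltNge => /negP; apply.
    exact: tmono.
  rewrite le_measure ?inE//; last by move=> x [i _ []].
  by apply: fin_bigcup_measurable => //; exact: finite_finset.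
set C := 4 * d%:R * L ^+ 2 * 64 ^+ d / V * ((8 ^+ d) ^+ i / 64 ^+ i).
have C0 : 0 <= C by rewrite !mulr_ge0// ?invr_ge0 ?exprn_ge0// ltW.
(* The bounds [tlow] and [thigh] are available only strictly between the two levels. Dividing the
   side [L] by [8 ^+ i] divides the volume of the cube by [(8 ^+ d) ^+ i], in step with [Mi]. *)
have step s s' : t i < s -> s < s' -> s' < t i.+1 -> (s' - s) ^+ 2 <= C * e i.
  move=> ts ss' st'.
  have s0 : 0 <= s by rewrite (le_trans (t0 i))// ltW.
  have s'0 : 0 <= s' by rewrite (le_trans s0)// ltW.
  have h1 := tlow i s ts; have h2 := thigh i.+1 s' s'0 st'.
  have Li : 0 < L / 8 ^+ i by rewrite divr_gt0.
  have hL : 4 * M s <= (L / 8 ^+ i) ^+ d.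
    rewrite expr_div_n -exprM mulnC exprM.
    apply: (@le_trans _ _ (4 * Mi i)); first by rewrite ler_pM2l.
    by rewrite /Mi mulrA ler_pM2r ?invr_gt0.
  have := level_decrease s0 ss' Li (foo s s0) hL.
  rewrite -/(M s) -/(M s') => H.
  have es : energy s s' <= e i by apply: energy_mono; exact: ltW.
  have en0 : 0 <= energy s s' by apply: sumr_ge0 => K _; rewrite mulr_ge0// fine_ge0.
  have H2 : ((s' - s) * Mi i.+1) ^+ 2 <=
      4 * d%:R * (L / 8 ^+ i) ^+ 2 * Mi i * e i.
    apply: (@le_trans _ _ (((s' - s) * M s') ^+ 2)).
      have sp : 0 <= s' - s by rewrite subr_ge0 ltW.
      have M1 : 0 <= (s' - s) * Mi i.+1 by rewrite mulr_ge0// ltW// Mi0.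
      have M2 : 0 <= (s' - s) * M s' by rewrite mulr_ge0// fine_ge0.
      by rewrite ler_pXn2r ?nnegrE// ler_wpM2l// ltW.
    have c0 : 0 <= 4 * d%:R * (L / 8 ^+ i) ^+ 2 by rewrite !mulr_ge0// ?invr_ge0 ltW.
    apply: (le_trans H); apply: ler_pM => //; first by rewrite mulr_ge0// fine_ge0.
    by rewrite ler_wpM2l.
  have Mp : 0 < Mi i.+1 ^+ 2 by rewrite exprn_gt0.
  rewrite -(ler_pM2r Mp) -exprMn; apply: (le_trans H2).
  rewrite MiS /C le_eqVlt; apply/orP; left; apply/eqP.
  have -> : 64 ^+ d = (8 ^+ d) ^+ 2 :> R by rewrite -exprM mulnC exprM; congr (_ ^+ _); ring.
  have -> : 64 ^+ i = (8 ^+ i) ^+ 2 :> R by rewrite -exprM mulnC exprM; congr (_ ^+ _); ring.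
  rewrite /Mi; field.
  by rewrite !gt_eqF.
have [tt|tt] := eqVneq (t i) (t i.+1).
  by rewrite -tt subrr expr0n mulr_ge0.
have tlt : t i < t i.+1 by rewrite lt_neqAle tt tS.
have Ce : 0 <= C * e i by rewrite mulr_ge0.
rewrite -[leRHS]sqr_sqrtr// ler_pXn2r ?nnegrE ?sqrtr_ge0 ?subr_ge0//.
rewrite leNgt; apply/negP => lt.
(* Moving both levels inwards by a quarter of the excess leaves a gap still larger than the square
   root, against [step]. *)
pose r := (t i.+1 - t i - Num.sqrt (C * e i)) / 4.
have r0 : 0 < r by rewrite divr_gt0// subr_gt0.
have sq0 : 0 <= Num.sqrt (C * e i) by exact: sqrtr_ge0.
have rE : 4 * r = t i.+1 - t i - Num.sqrt (C * e i) by rewrite /r; field.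
have h1 : t i < t i + r by rewrite ltrDl.
have h2 : t i + r < t i.+1 - r by lra.
have h3 : t i.+1 - r < t i.+1 by lra.
have := step _ _ h1 h2 h3; rewrite -[leRHS]sqr_sqrtr// ler_pXn2r ?nnegrE//; lra.
Qed.

End piecewise_affine_functions.

(** * Summation over the levels *)

Lemma sum_exp_half_le2 (R : realFieldType) (k : nat) :
  \sum_(i < k) (2 ^+ i)^-1 <= 2 :> R.
Proof.
suff -> : \sum_(i < k) (2 ^+ i)^-1 = 2 - 2 / 2 ^+ k :> R.
  by rewrite gerBl divr_ge0// exprn_ge0.
elim: k => [|k IHk]; first by rewrite big_ord0 expr0 divr1 subrr.
rewrite big_ord_recr/= IHk exprS; field.
by rewrite expf_neq0.
Qed.

Section level_sums.
Context (R : realType) (d : nat) (I : finType).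
Variables (E F : {set I}) (vol y : I -> R) (t e : nat -> R).
Variables (V C0 En kap vmin : R).
Hypotheses (FE : F \subset E).
Hypothesis vol_gt0 : forall K, K \in E -> 0 < vol K.
Hypotheses (VE : V = \sum_(K in E) vol K) (V_gt0 : 0 < V).
Hypothesis y_ge0 : forall K, 0 <= y K.
Hypotheses (t0 : t 0%N = 0) (t_mono : {homo t : i j / (i <= j)%N >-> i <= j}).
Hypotheses (e_ge0 : forall i, 0 <= e i) (sum_e : forall k, \sum_(i < k) e i <= En).
Hypotheses (kap_gt0 : 0 < kap) (kap_le1 : kap <= 1) (C0_ge0 : 0 <= C0).
Hypothesis t_step : forall i,
  (t i.+1 - t i) ^+ 2 <= C0 * ((8 ^+ d) ^+ i / 64 ^+ i) * e i.

(** In the application [y K] is half the modulus of the extremal vertex value of [K], and the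
    function is at least [y K] on a fraction [kap] of [K]; hence the volume bound [Fi_vol]. *)
Let Fi i := [set K in F | t i < y K].

Hypothesis Fi_vol : forall i,
  kap * \sum_(K in Fi i) vol K <= V / (8 ^+ d) ^+ i.

Let N : R := #|E|%:R.

Let p8 k : 0 < 8 ^+ k :> R. Proof. by rewrite exprn_gt0. Qed.
Let p64 k : 0 < 64 ^+ k :> R. Proof. by rewrite exprn_gt0. Qed.
Let p8d k : 0 < (8 ^+ d) ^+ k :> R. Proof. by rewrite exprn_gt0. Qed.

Let En_ge0 : 0 <= En. Proof. by have := sum_e 0; rewrite big_ord0. Qed.

Let t_ge0 i : 0 <= t i. Proof. by rewrite -t0; exact: t_mono. Qed.

Let E_gt0 : (0 < #|E|)%N.
Proof.
rewrite lt0n; apply/negP => /eqP /cards0_eq E0.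
by move: V_gt0; rewrite VE E0 big_set0 ltxx.
Qed.

Let N_gt0 : 0 < N. Proof. by rewrite ltr0n. Qed.

(** The volume bound at level [k] drops below [kap * vol K] for each of the finitely many elements
    once [(8 ^+ d) ^+ k] exceeds [X]. *)
Let last_level : (1 <= d)%N ->
  exists k, forall K, K \in F -> y K <= t k.
Proof.
move=> d1; pose X := \sum_(K in E) V / (kap * vol K).
pose k := (Num.truncn X).+1; exists k => K KF; have KE := fintype.subsetP FE K KF.
have Xk : X < (8 ^+ d) ^+ k.
  apply: (@lt_le_trans _ _ k%:R); first exact: truncnS_gt.
  rewrite (@le_trans _ _ (2 ^+ k))//.
    by rewrite -natrX ler_nat ltnW// ltn_expl.
  rewrite ler_pXn2r ?nnegrE ?exprn_ge0// (@le_trans _ _ (8 ^+ 1))//.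
    by rewrite expr1 ler_nat.
  by rewrite ler_weXn2l// ler1n.
rewrite leNgt; apply/negP => tk.
have Kk : K \in Fi k by rewrite inE KF.
have := Fi_vol k; rewrite leNgt => /negP; apply.
have vK := vol_gt0 KE.
apply: (@lt_le_trans _ _ (kap * vol K)).
  rewrite ltr_pdivrMr// mulrC -ltr_pdivrMr ?mulr_gt0//.
  apply: le_lt_trans Xk; rewrite /X (bigD1 K)//= lerDl sumr_ge0// => L /andP[LE _].
  by rewrite divr_ge0 ?mulr_ge0 ?(ltW V_gt0) ?(ltW kap_gt0) ?(ltW (vol_gt0 LE)).
rewrite ler_pM2l// (bigD1 K)//= lerDl sumr_ge0// => L /andP[LF _].
by rewrite ltW// vol_gt0// (fintype.subsetP FE)//; move: LF; rewrite inE => /andP[].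
Qed.

Let level_of k K : y K <= t k -> 0 < y K ->
  exists2 l, (l < k)%N & t l < y K <= t l.+1.
Proof.
elim: k => [|k IHk] yk y0; first by move: yk; rewrite t0 leNgt y0.
have [yk'|yk'] := leP (y K) (t k).
  by have [l lk tl] := IHk yk' y0; exists l => //; exact: ltnW.
by exists k => //; rewrite yk' yk.
Qed.

(** Cauchy-Schwarz on the telescoping sum for [t k]. The weights are left free: they are geometric
    in dimension 1 and constant in dimension 2. *)
Let t_sqr k (q : nat -> R) : (forall i, 0 < q i) ->
  t k ^+ 2 <= (\sum_(i < k) q i) *
    (\sum_(i < k) C0 * ((8 ^+ d) ^+ i / 64 ^+ i) * e i / q i).
Proof.
move=> q0.
have -> : t k = \sum_(i < k) (t i.+1 - t i) / q i * q i.
  elim: k => [|k IHk]; first by rewrite big_ord0 t0.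
  rewrite big_ord_recr/= -IHk; field; by rewrite gt_eqF.
apply: (le_trans (weighted_cauchy_schwarz _ _)) => [i|]; first exact: ltW.
rewrite ler_wpM2l//; first by apply: sumr_ge0 => i _; exact: ltW.
apply: ler_sum => i _; have qi : q i != 0 by rewrite gt_eqF.
have -> : ((t i.+1 - t i) / q i) ^+ 2 * q i = (t i.+1 - t i) ^+ 2 / q i by field.
by rewrite ler_wpM2r// invr_ge0 ltW.
Qed.

(** The squared increments carry a factor [8 ^- i], so all levels are bounded by the energy, as in
    the embedding into bounded functions, and each element contributes at most the same amount. *)
Lemma level_sum_dim1 : d = 1%N -> \sum_(K in F) y K ^+ 2 <= 2 * C0 * N * En.
Proof.
move=> d1; have [k yk] := last_level (eq_leq (esym d1)).
have tk : t k ^+ 2 <= 2 * C0 * En.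
  have h i : 0 < (2 ^+ i)^-1 :> R by rewrite invr_gt0 exprn_gt0.
  apply: (le_trans (t_sqr k h)).
  apply: (@le_trans _ _ (2 * (\sum_(i < k) C0 * e i))).
    apply: ler_pM.
    - by apply: sumr_ge0 => i _; exact: ltW.
    - apply: sumr_ge0 => i _.
      by rewrite !mulr_ge0// ?invr_ge0 ?ltW// exprn_gt0// exprn_gt0.
    - exact: sum_exp_half_le2.
    apply: ler_sum => i _; rewrite invrK d1 expr1.
    have -> : C0 * (8 ^+ i / 64 ^+ i) * e i * 2 ^+ i = C0 * e i * (1 / 4 ^+ i).
      have -> : 64 ^+ i = 8 ^+ i * (2 ^+ i * 4 ^+ i) :> R.
        by rewrite -!exprMn; congr (_ ^+ _); ring.
      by field; rewrite !expf_neq0.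
    by rewrite ler_piMr ?mulr_ge0// ler_pdivrMr ?exprn_gt0// mul1r exprn_ege1// ler1n.
  by rewrite -mulr_sumr -mulrA ler_pM2l// ler_wpM2l.
apply: (@le_trans _ _ (\sum_(K in E) 2 * C0 * En)); last first.
  by rewrite sumr_const -[_ *+ _]mulr_natr -/N le_eqVlt; apply/orP; left; apply/eqP; ring.
rewrite [leRHS](bigID (mem F))/= -[leLHS]addr0; apply: lerD; last first.
  by apply: sumr_ge0 => K _; rewrite !mulr_ge0.
have -> : \sum_(K in E | K \in F) 2 * C0 * En = \sum_(K in F) 2 * C0 * En.
  by apply: eq_bigl => K; case: (boolP (K \in F)) => KF; rewrite ?andbF// (fintype.subsetP FE).
apply: ler_sum => K KF; apply: le_trans tk.
by rewrite ler_pXn2r ?nnegrE// yk.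
Qed.

Let card_Fi_le i : #|Fi i|%:R <= N.
Proof.
rewrite ler_nat subset_leq_card//; apply: (fintype.subset_trans _ FE).
by apply/fintype.subsetP => K; rewrite inE => /andP[].
Qed.

(** The slab factor is 1, so [t l ^+ 2] grows at most linearly in [l]. The levels up to about [ln X]
    are counted by [N] each, which is the origin of the logarithm; beyond them the volume bound
    makes the counts decay geometrically. *)
Lemma level_sum_dim2 : d = 2%N -> 0 < vmin ->
  (forall K, K \in E -> vmin <= vol K) ->
  \sum_(K in F) y K ^+ 2 <=
  C0 * (3 + ln kap^-1) * N * (1 + ln (V / N / vmin)) * En.
Proof.
move=> d2 vmin0 volmin; have [|k yk] := last_level; first by rewrite d2.
have tl l : t l ^+ 2 <= l%:R * (C0 * En).
  apply: (le_trans (t_sqr l (q := fun=> 1) (fun=> ltr01))).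
  rewrite sumr_const card_ord ler_wpM2l//.
  under eq_bigr => i _.
    have -> : (8 ^+ d) ^+ i / 64 ^+ i = 1 :> R.
      by rewrite d2 (_ : 8 ^+ 2 = 64 :> R) ?mulfV ?expf_neq0//; ring.
    rewrite mulr1 divr1; over.
  by rewrite -mulr_sumr ler_wpM2l.
(* If [y K] lies between [t l] and [t l.+1], then its square costs at most [l + 1] units, and [K]
   belongs to the [l + 1] sets [Fi 0], ..., [Fi l]. *)
have step1 : \sum_(K in F) y K ^+ 2 <= C0 * En * \sum_(i < k) #|Fi i|%:R.
  have -> : \sum_(i < k) #|Fi i|%:R = \sum_(K in F) \sum_(i < k) (t i < y K)%R%:R :> R.
    rewrite exchange_big/=; apply: eq_bigr => i _.
    rewrite -sum1_card natr_sum /Fi big_set/= big_mkcondr/=.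
    by apply: eq_bigr => K _; case: ifP.
  rewrite mulr_sumr; apply: ler_sum => K KF.
  have [y0|y0] := eqVneq (y K) 0.
    by rewrite y0 expr0n mulr_ge0 ?mulr_ge0// sumr_ge0.
  have yp : 0 < y K by rewrite lt_neqAle eq_sym y0 y_ge0.
  have [l lk /andP[tl1 tl2]] := level_of (yk K KF) yp.
  apply: (@le_trans _ _ (t l.+1 ^+ 2)); first by rewrite ler_pXn2r ?nnegrE.
  apply: (le_trans (tl _)); rewrite mulrC ler_wpM2l ?mulr_ge0//.
  rewrite -natr_sum ler_nat.
  have -> : (l.+1 = \sum_(i < l.+1) 1)%N by rewrite sum1_card card_ord.
  rewrite (big_ord_widen _ (fun=> 1%N) lk) [leqRHS](bigID (fun i : 'I_k => (i < l.+1)%N))/=.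
  rewrite -[leqLHS]addn0 leq_add//; apply: leq_sum => i il.
  by rewrite (le_lt_trans _ tl1)// t_mono.
apply: (le_trans step1).
(* Elements have volume at least [vmin], so [Fi_vol] bounds the count at level [i] by
   [N * X / 64 ^+ i]. *)
pose X := V / N / vmin / kap.
have NV : N * vmin <= V.
  rewrite VE /N mulr_natl -sumr_const; exact: ler_sum.
have K1 : 1 <= V / N / vmin.
  by rewrite ler_pdivlMr// mul1r ler_pdivlMr// mulrC.
have k1 : 1 <= kap^-1 by rewrite invf_ge1.
have X1 : 1 <= X by rewrite /X mulr_ege1.
have lnX : ln X = ln (V / N / vmin) + ln kap^-1.
  by rewrite /X lnM ?posrE ?invr_gt0// (lt_le_trans ltr01).
have lnk : 0 <= ln kap^-1 by exact: ln_ge0.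
have lnKb : 0 <= ln (V / N / vmin) by exact: ln_ge0.
pose l := (Num.truncn (ln X)).+1.
have lX : X <= 64 ^+ l.
  (* [ln 64] is 6 times [ln 2], and [ln 2 >= 1 / 2] is [ln (1 + x) <= x] at [x = - 1 / 2]. *)
  have ln64 : 1 <= ln 64 :> R.
    have -> : 64 = (2 : R) ^+ 6 by ring.
    rewrite lnXn//.
    have : ln (1 + - 2^-1) <= - 2^-1 :> R by apply: le_ln1Dx; lra.
    rewrite (_ : 1 + - 2^-1 = 2^-1 :> R); last by field.
    rewrite lnV ?posrE//; lra.
  rewrite -ler_ln ?posrE ?(lt_le_trans ltr01 X1)// lnXn// -[leRHS]mulr_natl.
  apply: (@le_trans _ _ l%:R); first exact/ltW/truncnS_gt.
  by rewrite ler_peMr.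
have Fdecay i : #|Fi (l + i)|%:R <= N * (2 ^+ i)^-1.
  have h := Fi_vol (l + i).
  have h1 : kap * (vmin * #|Fi (l + i)|%:R) <= V / (8 ^+ d) ^+ (l + i).
    apply: le_trans h; rewrite ler_pM2l// mulr_natr -sumr_const.
    apply: ler_sum => K; rewrite inE => /andP[KF _]; exact/volmin/(fintype.subsetP FE).
  have h2 : #|Fi (l + i)|%:R <= N * (X / 64 ^+ (l + i)).
    move: h1; rewrite mulrA -ler_pdivlMl ?mulr_gt0// => /le_trans; apply.
    rewrite d2 (_ : 8 ^+ 2 = 64 :> R); last by ring.
    rewrite le_eqVlt; apply/orP; left; apply/eqP; rewrite /X; field.
    by rewrite !gt_eqF.
  apply: (le_trans h2); rewrite ler_pM2l// exprD invfM mulrA.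
  apply: (@le_trans _ _ (1 * (64 ^+ i)^-1)).
    by rewrite ler_wpM2r ?invr_ge0 ?(ltW (p64 _))// ler_pdivrMr// mul1r.
  rewrite mul1r lef_pV2 ?posrE ?exprn_gt0//.
  by apply: lerXn2r; rewrite ?nnegrE// ler_nat.
have step2 : \sum_(i < k) #|Fi i|%:R <= N * (l%:R + 2).
  apply: (@le_trans _ _ (\sum_(i < l + k) #|Fi i|%:R)).
    rewrite (big_ord_widen _ (fun i => #|Fi i|%:R) (leq_addl l k)).
    by rewrite [leRHS](bigID (fun i : 'I_(l + k) => (i < k)%N))/= lerDl sumr_ge0.
  rewrite big_split_ord/= mulrDr lerD//.
    rewrite mulr_natr -[X in _ *+ X](card_ord l) -sumr_const.
    by apply: ler_sum => i _; exact: card_Fi_le.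
  apply: (@le_trans _ _ (\sum_(i < k) N * (2 ^+ i)^-1)).
    by apply: ler_sum => i _; exact: Fdecay.
  by rewrite -mulr_sumr ler_pM2l// sum_exp_half_le2.
have l_le : l%:R + 2 <= (3 + ln kap^-1) * (1 + ln (V / N / vmin)).
  have : (Num.truncn (ln X))%:R <= ln X.
    by rewrite truncn_le lnX addr_ge0.
  rewrite /l -natr1 lnX; nra.
apply: (@le_trans _ _ (C0 * En * (N * ((3 + ln kap^-1) * (1 + ln (V / N / vmin)))))).
  rewrite ler_wpM2l ?mulr_ge0//; apply: (le_trans step2).
  by rewrite ler_pM2l.
by rewrite le_eqVlt; apply/orP; left; apply/eqP; ring.
Qed.

(** The reciprocal of the slab factor in [t_step], equal to [8 ^ (- (d - 2) i)] for [d >= 2]. *)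
Let rho i : R := 64 ^+ i / (8 ^+ d) ^+ i.

Let rho_ge0 i : 0 <= rho i. Proof. by rewrite divr_ge0 ?ltW. Qed.

Let rhoS i : rho i.+1 = rho i * (64 / 8 ^+ d).
Proof. by rewrite /rho !exprSr; field; rewrite !gt_eqF. Qed.

(** A discrete Hardy inequality: the weighted squares of the levels are controlled by those of their
    increments. Splitting [t i.+1] costs a factor 2 and the weight gains [1 / 8], so each term is a
    quarter of the previous one plus a share of the energy. *)
Let sum_t_rho k : (3 <= d)%N ->
  \sum_(i < k) t i.+1 ^+ 2 * rho i.+1 <= C0 * En.
Proof.
move=> d3; have r8 : 64 / 8 ^+ d <= 8^-1 :> R.
  rewrite ler_pdivrMr// ler_pdivlMl//.
  rewrite (_ : 8 * 64 = 8 ^+ 3 :> R); last by ring.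
  by rewrite ler_weXn2l// ler1n.
have r0 : 0 <= 64 / 8 ^+ d :> R by rewrite divr_ge0 ?ltW.
pose X i := t i ^+ 2 * rho i.
have X0 i : 0 <= X i by rewrite mulr_ge0// sqr_ge0.
have XS i : X i.+1 <= X i / 4 + C0 * e i / 4.
  have Ce : 0 <= C0 * e i by rewrite mulr_ge0.
  have step : (t i.+1 - t i) ^+ 2 * rho i <= C0 * e i.
    apply: (@le_trans _ _ (C0 * ((8 ^+ d) ^+ i / 64 ^+ i) * e i * rho i)).
      by rewrite ler_wpM2r.
    rewrite le_eqVlt; apply/orP; left; apply/eqP; rewrite /rho; field.
    by rewrite !gt_eqF.
  have sq : t i.+1 ^+ 2 <= 2 * t i ^+ 2 + 2 * (t i.+1 - t i) ^+ 2.
    rewrite -subr_ge0; have -> : 2 * t i ^+ 2 + 2 * (t i.+1 - t i) ^+ 2 - t i.+1 ^+ 2 =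
      (t i.+1 - 2 * t i) ^+ 2 by ring.
    exact: sqr_ge0.
  have h : t i.+1 ^+ 2 * rho i <= 2 * X i + 2 * (C0 * e i).
    apply: (@le_trans _ _ ((2 * t i ^+ 2 + 2 * (t i.+1 - t i) ^+ 2) * rho i)).
      by rewrite ler_wpM2r.
    by rewrite mulrDl; apply: lerD; rewrite -mulrA// ler_pM2l.
  rewrite -[X i.+1]/(t i.+1 ^+ 2 * rho i.+1) rhoS mulrA.
  apply: (@le_trans _ _ ((2 * X i + 2 * (C0 * e i)) * 8^-1)).
    by apply: ler_pM => //; rewrite mulr_ge0// sqr_ge0.
  by rewrite le_eqVlt; apply/orP; left; apply/eqP; field.
(* The extra [X k / 3] closes the induction: [4 / 3] of the next term is at most [X k / 3] plus a
   third of [C0 * e k]. *)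
have ind : \sum_(i < k) X i.+1 + X k / 3 <= C0 / 3 * \sum_(i < k) e i.
  elim: k => [|k IHk].
    by rewrite !big_ord0 /X t0 expr0n mul0r mul0r addr0 mulr0.
  rewrite !big_ord_recr/=; have := XS k; lra.
have h1 : C0 * \sum_(i < k) e i <= C0 * En by rewrite ler_wpM2l.
have h2 : 0 <= C0 * En by rewrite mulr_ge0.
rewrite -[leLHS]/(\sum_(i < k) X i.+1); have := X0 k; lra.
Qed.

(** The counts decay like [rho i], exactly the weight needed to apply [sum_t_rho]. *)
Lemma level_sum_dim3 : (3 <= d)%N ->
  \sum_(K in F) y K ^+ 2 <= C0 * (kap^-1 + 1) * 8 ^+ d * N *
    (N^-1 * \sum_(K in E) (V / N / vol K) `^ ((d%:R - 2) / 2)) `^ (2 / d%:R) * En.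
Proof.
move=> d3; have [|k yk] := last_level; first by rewrite (leq_trans _ d3).
set al : R := (d%:R - 2) / 2.
set S := N^-1 * _; set Psi := S `^ _.
have d0 : 0 < d%:R :> R by rewrite ltr0n (leq_trans _ d3).
have dr : 3 <= d%:R :> R by rewrite ler_nat.
have al0 : 0 <= al by rewrite /al; lra.
have KN : 0 < V / N by rewrite divr_gt0.
have S0 : 0 < S.
  rewrite mulr_gt0 ?invr_gt0//; have /card_gt0P[K0 K0E] := E_gt0.
  rewrite (bigD1 K0)//= ltr_pwDl ?powR_gt0 ?divr_gt0 ?vol_gt0//.
  by apply: sumr_ge0 => K _; exact: powR_ge0.
have Psi0 : 0 < Psi by exact: powR_gt0.
have PsiS : Psi `^ (1 + al) = S.
  rewrite /Psi -powRrM (_ : 2 / d%:R * (1 + al) = 1); first by rewrite powRr1// ltW.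
  by rewrite /al; field; rewrite gt_eqF.
have count i : #|Fi i|%:R <= (kap^-1 + 1) * (rho i * N * Psi).
  pose lam := V / N / (64 ^+ i * Psi).
  have lam0 : 0 < lam by apply: divr_gt0 => //; apply: mulr_gt0 => //; exact: p64.
  have FiE K : K \in Fi i -> K \in E.
    by rewrite inE => /andP[KF _]; exact: (fintype.subsetP FE).
  have one K : K \in Fi i -> 1 <= vol K / lam + (lam / vol K) `^ al.
    move=> /FiE KE; have vK := vol_gt0 KE.
    have [lv|vl] := leP lam (vol K).
      rewrite -[leLHS]addr0 lerD ?powR_ge0//.
      by rewrite ler_pdivlMr// mul1r.
    rewrite -[leLHS]add0r; apply: lerD; first by rewrite divr_ge0// ltW.
    have h : 1 <= lam / vol K by rewrite ler_pdivlMr// mul1r ltW.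
    rewrite (@le_trans _ _ (1 `^ al))//; first by rewrite powR1.
    by apply: ge0_ler_powR => //; rewrite nnegrE (le_trans ler01).
  rewrite -sum1_card natr_sum; apply: (le_trans (ler_sum _ one)).
  rewrite big_split/= mulrDl mul1r; apply: lerD.
    rewrite -mulr_suml; have := Fi_vol i; rewrite -ler_pdivlMl// => h.
    apply: (@le_trans _ _ (kap^-1 * (V / (8 ^+ d) ^+ i) / lam)).
      by rewrite ler_wpM2r// invr_ge0 ltW.
    rewrite le_eqVlt; apply/orP; left; apply/eqP; rewrite /lam /rho; field.
    by rewrite !gt_eqF.
  have lamE K : K \in E -> (lam / vol K) `^ al =
      (V / N / vol K) `^ al * (rho i * Psi / Psi `^ (1 + al)).
    move=> KE; have vK := vol_gt0 KE.
    have -> : lam / vol K = (V / N / vol K) * (64 ^+ i * Psi)^-1.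
      by rewrite /lam mulrAC.
    rewrite powRM ?divr_ge0 ?invr_ge0 ?mulr_ge0 ?(ltW V_gt0) ?(ltW N_gt0)
      ?(ltW vK) ?(ltW (p64 i)) ?(ltW Psi0)//.
    congr (_ * _).
    have bE : (64 ^+ i * Psi) `^ al = (8 ^+ i) ^+ (d - 2) * Psi `^ al.
      rewrite powRM ?(ltW (p64 i)) ?(ltW Psi0)//; congr (_ * _).
      have -> : 64 ^+ i = (8 ^+ i) ^+ 2 :> R.
        by rewrite -exprM mulnC exprM; congr (_ ^+ _); ring.
      rewrite -powR_mulrn ?(ltW (p8 i))// -powRrM.
      rewrite (_ : 2 * al = (d - 2)%:R); first by rewrite powR_mulrn ?(ltW (p8 i)).
      by rewrite /al natrB ?(ltnW d3)//; field.
    have -> : (64 ^+ i * Psi)^-1 `^ al = ((64 ^+ i * Psi) `^ al)^-1.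
      rewrite -powR_inv1 ?mulr_ge0 ?(ltW (p64 i)) ?(ltW Psi0)//.
      by rewrite -powRrM mulN1r powRN.
    rewrite bE powRD ?(gt_eqF Psi0) ?implybT// powRr1 ?(ltW Psi0)// /rho.
    have -> : (8 ^+ d) ^+ i = 64 ^+ i * (8 ^+ i) ^+ (d - 2) :> R.
      have -> : 64 ^+ i = (8 ^+ i) ^+ 2 :> R.
        by rewrite -exprM mulnC exprM; congr (_ ^+ _); ring.
      by rewrite -exprD subnKC ?(ltnW d3)// -!exprM mulnC.
    field.
    by rewrite !gt_eqF// ?powR_gt0// exprn_gt0.
  have S1 : \sum_(K in E) (V / N / vol K) `^ al = N * S.
    by rewrite /S mulVKf// gt_eqF.
  apply: (@le_trans _ _ (\sum_(K in E) (lam / vol K) `^ al)).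
    rewrite [leRHS](bigID (mem (Fi i)))/= -[leLHS]addr0 lerD//; last first.
      by apply: sumr_ge0 => K _; exact: powR_ge0.
    rewrite le_eqVlt; apply/orP; left; apply/eqP; apply: eq_bigl => K.
    by case: (boolP (K \in Fi i)) => KF; rewrite ?andbF// FiE.
  rewrite (eq_bigr _ lamE) -mulr_suml S1 PsiS le_eqVlt; apply/orP; left; apply/eqP.
  by field; rewrite gt_eqF.
pose c0 := (kap^-1 + 1) * N * Psi.
have kp : 0 <= kap^-1 + 1 by rewrite addr_ge0// invr_ge0 ltW.
have c00 : 0 <= c0 by rewrite !mulr_ge0// ltW.
(* The single level [l] with [t l < y K <= t l.+1] already pays for [K]. *)
have step1 : \sum_(K in F) y K ^+ 2 <= \sum_(i < k) t i.+1 ^+ 2 * #|Fi i|%:R.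
  have -> : \sum_(i < k) t i.+1 ^+ 2 * #|Fi i|%:R =
      \sum_(K in F) \sum_(i < k) t i.+1 ^+ 2 * (t i < y K)%R%:R :> R.
    rewrite exchange_big/=; apply: eq_bigr => i _.
    rewrite -mulr_sumr; congr (_ * _).
    rewrite -sum1_card natr_sum /Fi big_set/= big_mkcondr/=.
    by apply: eq_bigr => K _; case: ifP.
  apply: ler_sum => K KF.
  have [y0|y0] := eqVneq (y K) 0.
    by rewrite y0 expr0n/= sumr_ge0// => i _; rewrite mulr_ge0// sqr_ge0.
  have yp : 0 < y K by rewrite lt_neqAle eq_sym y0 y_ge0.
  have [l lk /andP[tl1 tl2]] := level_of (yk K KF) yp.
  rewrite (bigD1 (Ordinal lk))//= tl1 mulr1 -[leLHS]addr0 lerD//.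
    by rewrite ler_pXn2r ?nnegrE.
  by apply: sumr_ge0 => i _; rewrite mulr_ge0// sqr_ge0.
apply: (le_trans step1).
have E8 i : rho i = 8 ^+ d / 64 * rho i.+1.
  by rewrite rhoS; field; rewrite gt_eqF.
apply: (@le_trans _ _ (c0 * (8 ^+ d / 64) * \sum_(i < k) t i.+1 ^+ 2 * rho i.+1)).
  rewrite mulr_sumr; apply: ler_sum => i _.
  apply: (@le_trans _ _ (t i.+1 ^+ 2 * ((kap^-1 + 1) * (rho i * N * Psi)))).
    by rewrite ler_wpM2l// sqr_ge0.
  by rewrite E8 /c0 le_eqVlt; apply/orP; left; apply/eqP; ring.
have d8 : 0 <= 8 ^+ d / 64 :> R by rewrite divr_ge0// ltW.
apply: (@le_trans _ _ (c0 * (8 ^+ d / 64) * (C0 * En))).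
  by apply: ler_wpM2l; [exact: mulr_ge0|exact: sum_t_rho].
rewrite -/al -/S -/Psi.
have -> : C0 * (kap^-1 + 1) * 8 ^+ d * N * Psi * En = c0 * (8 ^+ d) * (C0 * En).
  by rewrite /c0; ring.
rewrite ler_wpM2r ?mulr_ge0// ler_wpM2l// ler_pdivrMr//.
by apply: ler_peMr; [exact: ltW|rewrite ler1n].
Qed.

End level_sums.


(** * The discrete Sobolev inequality *)

Lemma Psi_dim1 (R : realType) (d : nat) (Omega : set 'rV[R]_d) (m : mesh R d) :
  d = 1%N -> Psi Omega m = 1.
Proof. by move=> d1; subst d. Qed.

Lemma Psi_dim2 (R : realType) (d : nat) (Omega : set 'rV[R]_d) (m : mesh R d) :
  d = 2%N -> Psi Omega m = 1 + ln (avg_vol Omega m / min_vol m).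
Proof. by move=> d2; subst d. Qed.

Lemma Psi_dim3 (R : realType) (d : nat) (Omega : set 'rV[R]_d) (m : mesh R d) :
  (3 <= d)%N -> Psi Omega m = ((nelt m)^-1 * \sum_(K in elements m)
    (avg_vol Omega m / vol K) `^ ((d%:R - 2) / 2)) `^ (2 / d%:R).
Proof. by case: d Omega m => [//|[//|[//|d]]] Omega m. Qed.

Section mesh_inequalities.
Context (R : realType) (d : nat) (Omega : set 'rV[R]_d) (m : mesh R d).
Hypothesis Omega_reg : interior (closure Omega) = Omega.
Hypothesis Omega_neq0 : Omega !=set0.
Hypothesis Hm : conforming_mesh Omega m.
Notation n := (nvi m + nvb m)%N.
Notation p := (@vertex R d m).
Variables (g : {set 'I_n} -> 'I_n -> 'rV[R]_d) (c : {set 'I_n} -> 'I_n -> R).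
Hypothesis gcE : forall K, K \in elements m -> barycentric p K (g K) (c K).
Variable phi : 'I_(nvi m) -> 'rV[R]_d -> R.
Hypothesis Hphi : forall j, nodal_basis Omega j (phi j).

Notation bary K i := (affine_map (g K i) (c K i)).
Notation v j := (lshift (nvb m) j).
Notation mu := (lebesgue_rV d : {sigma_finite_measure set 'rV[R]_d -> \bar R}).

Let aiE K : K \in elements m -> affinely_independent p K.
Proof. by move=> KE; have [] := element_simplex Hm KE. Qed.

Let cardE K : K \in elements m -> #|K| = d.+1.
Proof. by move=> KE; have [] := element_simplex Hm KE. Qed.

Definition inner_elt (K : {set 'I_n}) := open_simplex K (g K) (c K).

(** Since [K] and [L] have equally many vertices, [K] has one that is not in [L]; its coordinate
    vanishes on the common face but is positive inside [K]. *)
Lemma inner_elt_trivIset (K L : {set 'I_n}) : K \in elements m -> L \in elements m ->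
  K != L -> inner_elt K `&` inner_elt L = set0.
Proof.
move=> KE LE KL; apply/seteqP; split => // x [xK xL].
have [i iK iL] : exists2 i, i \in K & i \notin L.
  apply/fintype.subsetPn; apply: contra KL => KL.
  by rewrite eqEcard KL (cardE KE) (cardE LE) leqnn.
have : (elt K `&` elt L) x.
  by split; [exact: (open_simplex_conv (aiE KE) (gcE KE))|
    exact: (open_simplex_conv (aiE LE) (gcE LE))].
rewrite /elt (elements_meet Hm KE LE) => /(conv_of_face (aiE KE) (gcE KE)).
move=> /(_ (subsetIl _ _) i iK); rewrite inE iK/= iL => /(_ isT) x0.
by have := xK i iK; rewrite x0 ltxx.
Qed.

(** Empty off the mesh, so that the results on families over a whole finite type apply with all sets
    of vertices as indices. *)
Definition elt_or0 K : set 'rV[R]_d := if K \in elements m then elt K else set0.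

Definition inner_elt_or0 K : set 'rV[R]_d :=
  if K \in elements m then inner_elt K else set0.

Lemma measurable_elt_or0 K : measurable (elt_or0 K).
Proof.
rewrite /elt_or0; case: ifPn => KE; last exact: measurable0.
exact: (measurable_conv_of (aiE KE) (gcE KE)).
Qed.

Lemma measurable_inner_elt_or0 K : measurable (inner_elt_or0 K).
Proof.
rewrite /inner_elt_or0; case: ifPn => KE; last exact: measurable0.
exact: measurable_open_simplex.
Qed.

Lemma inner_elt_or0_trivIset : trivIset setT inner_elt_or0.
Proof.
apply/trivIsetP => K L _ _ KL; rewrite /inner_elt_or0.
case: ifPn => KE; last by rewrite set0I.
case: ifPn => LE; last by rewrite setI0.
exact: inner_elt_trivIset.
Qed.

Lemma elt_or0_null K : mu (elt_or0 K `\` inner_elt_or0 K) = 0.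
Proof.
rewrite /inner_elt_or0 /elt_or0; case: ifPn => KE; last first.
  by rewrite set0D measure0.
exact: (conv_of_setD_open_simplex (cardE KE) (aiE KE) (gcE KE)).
Qed.

Lemma elt_or0_measure K :
  mu (elt_or0 K) = (if K \in elements m then vol K else 0)%:E.
Proof.
rewrite /elt_or0; case: ifPn => KE; last by rewrite measure0.
exact: (volumeE (aiE KE) (gcE KE)).
Qed.

Lemma inner_elt_or0_measure K : mu (inner_elt_or0 K) = mu (elt_or0 K).
Proof.
rewrite /inner_elt_or0 /elt_or0; case: ifPn => KE //.
exact/esym/(conv_of_open_simplex (cardE KE) (aiE KE) (gcE KE)).
Qed.

Lemma vol_gt0 K : K \in elements m -> 0 < vol K.
Proof. by move=> KE; exact: (volume_gt0 (cardE KE) (aiE KE) (gcE KE)). Qed.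

Lemma inner_elt_domain K : K \in elements m -> inner_elt K `<=` Omega.
Proof.
move=> KE; rewrite -[X in _ `<=` X]Omega_reg => x xK.
apply: (interiorS (elt_closure Hm KE)).
exact: (open_simplex_interior (aiE KE) (gcE KE)).
Qed.

(** [Omega] is covered by the closed elements and contains the disjoint open ones, which have the
    same volumes. *)
Lemma domain_measure : mu Omega = (\sum_(K in elements m) vol K)%:E.
Proof.
have mO : measurable Omega by apply: measurable_open_rV; exact: domain_open.
have sumE (F : {set 'I_n} -> set 'rV[R]_d) : (forall K, mu (F K) = mu (elt_or0 K)) ->
    (\sum_K mu (F K) = (\sum_(K in elements m) vol K)%:E)%E.
  move=> FE; rewrite -sumEFin [RHS]big_mkcond/=; apply: eq_bigr => K _.
  by rewrite FE elt_or0_measure; case: ifP.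
apply/eqP; rewrite eq_le; apply/andP; split.
  rewrite -(sumE elt_or0)//; apply: measure_le_sum => //.
    exact: measurable_elt_or0.
  move=> x /subset_closure /(closure_elt Hm)[K KE xK].
  by exists K => //; rewrite /elt_or0 KE.
rewrite -(sumE inner_elt_or0); last exact: inner_elt_or0_measure.
rewrite -measure_bigcup_fin; last 2 first.
- exact: measurable_inner_elt_or0.
- exact: inner_elt_or0_trivIset.
rewrite le_measure ?inE//.
  apply: fin_bigcup_measurable; first exact: finite_finset.
  by move=> K _; exact: measurable_inner_elt_or0.
move=> x [K _]; rewrite /inner_elt_or0; case: ifPn => // KE.
exact: inner_elt_domain.
Qed.

Lemma domain_volE : domain_vol Omega = \sum_(K in elements m) vol K.
Proof. by rewrite /domain_vol [X in fine X]domain_measure. Qed.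

Lemma elements_gt0 : (0 < #|elements m|)%N.
Proof.
have [x Ox] := Omega_neq0.
have [K KE _] := closure_elt Hm (subset_closure Ox).
by apply/card_gt0P; exists K.
Qed.

Lemma domain_vol_gt0 : 0 < domain_vol Omega.
Proof.
rewrite domain_volE; have /card_gt0P[K KE] := elements_gt0.
rewrite (bigD1 K)//= ltr_pwDl ?vol_gt0// sumr_ge0// => L /andP[LE _].
by rewrite ltW// vol_gt0.
Qed.

Lemma min_vol_gt0 : 0 < min_vol m.
Proof.
have /card_gt0P[K0 K0E] := elements_gt0.
pose b := \big[Num.min/vol K0]_(K in elements m) vol K.
apply: (@lt_le_trans _ _ b).
  by apply: lt_bigmin => [|K]; exact: vol_gt0.
apply: lb_le_inf; first by exists (vol K0); exists K0.
by move=> _ [K KE <-]; exact: bigmin_le_cond.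
Qed.

Lemma min_vol_le K : K \in elements m -> min_vol m <= vol K.
Proof.
move=> KE; apply: ge_inf; last by exists K.
by exists 0 => _ [L LE <-]; exact/ltW/vol_gt0.
Qed.

(** The extension of [u] by zero to the boundary vertices. *)
Definition nodal_val (u : 'I_(nvi m) -> R) (i : 'I_n) : R :=
  \sum_j u j * (i == v j)%:R.

Lemma nodal_val_lshift u j : nodal_val u (v j) = u j.
Proof.
rewrite /nodal_val (bigD1 j)//= eqxx mulr1 big1 ?addr0// => k kj.
by rewrite (inj_eq (@lshift_inj _ _)) eq_sym (negbTE kj) mulr0.
Qed.

Lemma nodal_val_sum u (K : {set 'I_n}) (f : 'I_n -> R) :
  \sum_(i in K) nodal_val u i * f i = \sum_j u j * (v j \in K)%:R * f (v j).
Proof.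
under eq_bigr do rewrite /nodal_val mulr_suml.
rewrite exchange_big/=; apply: eq_bigr => j _.
have [vK|vK] := boolP (v j \in K).
  rewrite (bigD1 (v j))//= eqxx big1 ?addr0// => i /andP[_ /negbTE ->].
  by rewrite mulr0 mul0r.
rewrite mulr0 mul0r big1// => i iK; case: eqP => [iv|]; last by rewrite mulr0 mul0r.
by move: vK; rewrite -iv iK.
Qed.

Definition elt_grad (u : 'I_(nvi m) -> R) (K : {set 'I_n}) : 'rV[R]_d :=
  \sum_j (u j * (v j \in K)%:R) *: g K (v j).

Lemma zero_ext_bary u K x : K \in elements m -> elt K x ->
  zero_ext Omega phi u x = \sum_(i in K) nodal_val u i * bary K i x.
Proof.
move=> KE xK; rewrite nodal_val_sum (zero_ext_elt Hm gcE Hphi u KE xK).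
rewrite /affine_map linear_sum/= mulmx_sumr summxE -big_split/=.
by apply: eq_bigr => j _; rewrite linearZ/= -scalemxAr mxE; ring.
Qed.

Definition dirichlet_energy (u : 'I_(nvi m) -> R) : R :=
  \sum_(K in elements m) (elt_grad u K *m (elt_grad u K)^T) ord0 ord0 * vol K.

(* On the corner of [K] where the barycentric coordinate of the extremal vertex
   is at least [3 / 4], the function is at least half its value there. *)
Lemma corner_value u K k x : K \in elements m -> elt K x -> k \in K ->
  (forall i, i \in K -> `|nodal_val u i| <= `|nodal_val u k|) ->
  1 - 4^-1 <= bary K k x -> 0 <= nodal_val u k ->
  nodal_val u k / 2 <= zero_ext Omega phi u x.
Proof.
move=> KE xK kK kmax b34 u0; rewrite (zero_ext_bary u KE xK) (bigD1 k)//=.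
move: kmax; rewrite (ger0_norm u0) => kmax.
have x0 : forall i, i \in K -> 0 <= bary K i x.
  by move: xK; rewrite /elt (conv_ofE (aiE KE) (gcE KE)).
(* With [b] the coordinate of [k], the value is at least [b - (1 - b)] times that at [k], and
   [2 * b - 1 >= 1 / 2] when [b >= 3 / 4]. *)
have s1 : bary K k x + \sum_(i in K | i != k) bary K i x = 1.
  by rewrite -((gcE KE).1 x) [in RHS](bigD1 k).
have low : - nodal_val u k * \sum_(i in K | i != k) bary K i x <=
    \sum_(i in K | i != k) nodal_val u i * bary K i x.
  rewrite mulr_sumr; apply: ler_sum => i /andP[iK _].
  rewrite ler_wpM2r ?x0//; have := kmax i iK; rewrite ler_norml => /andP[+ _].
  by [].
nra.
Qed.

Let kap : R := 4^-1 ^+ d.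

(** The constant of [level_sequence] for [V] the volume of the domain and [L = 1 + 4 * V], a side
    that satisfies [4 * V <= L ^+ d] in every dimension [d >= 1] without taking roots. *)
Definition energy_const : R :=
  4 * d%:R * (1 + 4 * domain_vol Omega) ^+ 2 * 64 ^+ d / domain_vol Omega.

(** One summand for each of the cases [d = 1], [d = 2] and [d >= 3], so that the same constant
    serves all of them. *)
Definition sum_const : R :=
  energy_const * (2 + (3 + ln kap^-1) + (kap^-1 + 1) * 8 ^+ d).

Lemma nonneg_part_bound (u : 'I_(nvi m) -> R) (k : {set 'I_n} -> 'I_n) :
  (1 <= d)%N ->
  (forall K, K \in elements m -> k K \in K /\
     forall i, i \in K -> `|nodal_val u i| <= `|nodal_val u (k K)|) ->
  \sum_(K in [set K in elements m | 0 <= nodal_val u (k K)])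
     (`|nodal_val u (k K)| / 2) ^+ 2 <=
  sum_const * nelt m * Psi Omega m * dirichlet_energy u.
Proof.
move=> d1 kP; set F := [set K in elements m | _].
set y := fun K => `|nodal_val u (k K)| / 2.
set V := domain_vol Omega; have V0 : 0 < V := domain_vol_gt0.
pose W := zero_ext Omega phi u.
pose bet (K : {set 'I_n}) := \sum_j (u j * (v j \in K)%:R) * c K (v j).
have Waff K x : elt_or0 K x -> W x = affine_map (elt_grad u K) (bet K) x.
  rewrite /elt_or0; case: ifPn => // KE xK.
  exact: (zero_ext_elt Hm gcE Hphi).
have Wc : continuous W by exact: (zero_ext_continuous Omega_reg Hm gcE Hphi).
have Wsup x : W x != 0 -> Omega x by exact: (zero_ext_support Omega_reg Hm gcE Hphi).
have Wcover x : W x != 0 -> exists K, elt_or0 K x.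
  move=> /Wsup /subset_closure /(closure_elt Hm)[K KE xK].
  by exists K; rewrite /elt_or0 KE.
have fin K : (mu (elt_or0 K) < +oo)%E by rewrite elt_or0_measure ltry.
have muV : (mu [set x | (0 < W x)%R] <= V%:E)%E.
  have -> : V%:E = mu Omega by rewrite domain_measure -domain_volE.
  rewrite le_measure ?inE//.
  - by apply: measurable_open_rV; exact: (open_superlevel Wc).
  - by apply: measurable_open_rV; exact: domain_open.
  - by move=> x /= W0; apply: Wsup; rewrite gt_eqF.
have L0 : 0 < 1 + 4 * V by lra.
have LV : 4 * V <= (1 + 4 * V) ^+ d.
  apply: (@le_trans _ _ (1 + 4 * V)); first lra.
  by rewrite -[leLHS]expr1 ler_weXn2l//; lra.
have Wb : exists B, forall x, W x <= B.
  exists (\sum_i `|nodal_val u i|) => x.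
  have [W0|W0] := eqVneq (W x) 0; first by rewrite W0 sumr_ge0.
  have [K KE xK] := closure_elt Hm (subset_closure (Wsup x W0)).
  rewrite /W (zero_ext_bary u KE xK) (le_trans (ler_norm _))//.
  rewrite (le_trans (ler_norm_sum _ _ _))// [leRHS](bigID (mem K))/=.
  rewrite -[leLHS]addr0 lerD//; last exact: sumr_ge0.
  apply: ler_sum => i iK; rewrite normrM ler_piMr//.
  rewrite ger0_norm ?(conv_of_bary_le1 (aiE KE) (gcE KE) xK)//.
  by move: xK; rewrite /elt (conv_ofE (aiE KE) (gcE KE)); apply.
have [t [e [t0 tmono e0 [sume tstep tlow]]]] :=
  level_sequence Wc Wcover Waff measurable_elt_or0 fin measurable_inner_elt_or0
    inner_elt_or0_trivIset elt_or0_null V0 muV L0 LV Wb.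
have EnE : \sum_K (elt_grad u K *m (elt_grad u K)^T) ord0 ord0 * fine (mu (elt_or0 K)) =
    dirichlet_energy u.
  rewrite /dirichlet_energy [RHS]big_mkcond/=; apply: eq_bigr => K _.
  by rewrite elt_or0_measure /=; case: ifP => // _; rewrite mulr0.
rewrite EnE in sume.
have kap0 : 0 < kap by rewrite exprn_gt0// invr_gt0.
have kap1 : kap <= 1 by rewrite exprn_ile1// ?invr_ge0// invf_le1// ler1n.
have FE : F \subset elements m by apply/fintype.subsetP => K; rewrite inE => /andP[].
have y0 K : 0 <= y K by rewrite divr_ge0.
have C00 : 0 <= energy_const.
  by rewrite !mulr_ge0 ?invr_ge0 ?exprn_ge0// ?(ltW V0) ?(ltW L0).
have Fvol i : kap * \sum_(K in [set K in F | t i < y K]) vol K <= V / (8 ^+ d) ^+ i.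
  set Fi := [set K in F | _].
  (* A level [s] strictly between [t i] and every [y K] is needed: [tlow] holds only above [t i],
     and on the corners the function is at least [y K > s]. The default value covers an empty
     [Fi]. *)
  pose mn := \big[Num.min/t i + 1]_(K in Fi) y K.
  have tmn : t i < mn.
    by apply: lt_bigmin => [|K]; [rewrite ltrDl|rewrite inE => /andP[]].
  pose s := (t i + mn) / 2.
  have ts : t i < s by rewrite /s; lra.
  have smn : s < mn by rewrite /s; lra.
  have ti0 : 0 <= t i by rewrite -t0 tmono.
  apply: le_trans (tlow i s ts).
  pose D K := if K \in Fi then inner_elt K `&`
    (elt K `&` [set x | 1 - 4^-1 <= bary K (k K) x]) else set0.
  have FiE K : K \in Fi -> [/\ K \in elements m, 0 <= nodal_val u (k K) & s < y K].
    move=> KFi; have := KFi; rewrite inE => /andP[]; rewrite inE => /andP[KE u0] _.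
    split => //; apply: lt_le_trans smn _; exact: bigmin_le_cond.
  have mD K : measurable (D K).
    rewrite /D; case: ifPn => [/FiE[KE _ _]|_]; last exact: measurable0.
    apply: measurableI; first exact: measurable_open_simplex.
    exact: (measurable_corner (aiE KE) (gcE KE)).
  have Dmeas K : K \in Fi -> ((kap * vol K)%:E <= mu (D K))%E.
    move=> KFi; have [KE _ _] := FiE K KFi; have [kK _] := kP K KE.
    have e41 : 4^-1 <= 1 :> R by rewrite invf_le1// ler1n.
    have e40 : 0 < 4^-1 :> R by rewrite invr_gt0.
    rewrite /D KFi.
    exact: (corner_open_volume (cardE KE) (aiE KE) (gcE KE) kK e40 e41).
  have triv : trivIset setT D.
    apply/trivIsetP => K K' _ _ KK'; rewrite /D.
    case: ifPn => [/FiE[KE _ _]|_]; last by rewrite set0I.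
    case: ifPn => [/FiE[K'E _ _]|_]; last by rewrite setI0.
    apply/seteqP; split => // x [[xK _] [xK' _]].
    by have /seteqP[+ _] := inner_elt_trivIset KE K'E KK'; apply; split.
  have s0 : 0 <= s by lra.
  have mWs : measurable [set x | s < W x].
    by apply: measurable_open_rV; exact: (open_superlevel Wc).
  have fWs : mu [set x | s < W x] \is a fin_num.
    rewrite ge0_fin_numE//; apply: (@le_lt_trans _ _ V%:E); last by rewrite ltry.
    apply: le_trans muV; rewrite le_measure ?inE//.
      by apply: measurable_open_rV; exact: (open_superlevel Wc).
    by move=> x /=; exact: le_lt_trans.
  rewrite -lee_fin fineK//; apply: (@le_trans _ _ (mu (\bigcup_K D K))); last first.
    rewrite le_measure ?inE//.
      by apply: fin_bigcup_measurable => //; exact: finite_finset.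
    move=> x [K _]; rewrite /D; case: ifPn => // KFi [_ [xK xb]] /=.
    have [KE u0 sy] := FiE K KFi; have [kK kmax] := kP K KE.
    apply: (lt_le_trans sy); rewrite /y ger0_norm//.
    exact: corner_value xb u0.
  rewrite measure_bigcup_fin// mulr_sumr -sumEFin big_mkcond/=.
  by apply: lee_sum => K _; case: ifPn => // KFi; exact: Dmeas.
have lnk : 0 <= ln kap^-1 by rewrite ln_ge0// invf_ge1.
have kp : 0 <= kap^-1 by rewrite invr_ge0 ltW.
have Nge : 0 <= nelt m by exact: ler0n.
have En0 : 0 <= dirichlet_energy u by have := sume 0; rewrite big_ord0.
have p88 : 0 <= 8 ^+ d :> R by rewrite exprn_ge0.
have VE : V = \sum_(K in elements m) vol K by rewrite /V domain_volE.
have a1 : 0 <= (kap^-1 + 1) * 8 ^+ d by rewrite mulr_ge0// addr_ge0.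
have wrap (a ps : R) : 0 <= ps -> a <= 2 + (3 + ln kap^-1) + (kap^-1 + 1) * 8 ^+ d ->
    energy_const * a * nelt m * ps * dirichlet_energy u <=
    sum_const * nelt m * ps * dirichlet_energy u.
  by move=> ps0 a2; do 3 (apply: ler_wpM2r => //); exact: ler_wpM2l.
have [d1'|[d2|d3]] : d = 1%N \/ d = 2%N \/ (3 <= d)%N.
  case: (ltngtP d 2) => [h|h|h]; [left|by right; right|by right; left].
  by apply/eqP; rewrite eqn_leq d1 -ltnS h.
- have H := level_sum_dim1 FE vol_gt0 V0 y0 t0 tmono e0 sume kap0 C00 tstep Fvol d1'.
  apply: (le_trans H); apply: (le_trans _ (wrap 2 _ _ _)).
  + rewrite (Psi_dim1 _ _ d1').
    by rewrite mulr1 le_eqVlt; apply/orP; left; apply/eqP; rewrite /nelt; ring.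
  + by rewrite (Psi_dim1 _ _ d1').
  + lra.
- have H := level_sum_dim2 FE vol_gt0 VE V0 y0 t0 tmono sume kap0 kap1 C00 tstep Fvol
    d2 min_vol_gt0 min_vol_le.
  apply: (le_trans H); apply: (le_trans _ (wrap (3 + ln kap^-1) _ _ _)).
  + by rewrite (Psi_dim2 _ _ d2).
  + rewrite (Psi_dim2 _ _ d2) addr_ge0// ln_ge0// /avg_vol.
    rewrite ler_pdivlMr ?min_vol_gt0// mul1r ler_pdivlMr ?ltr0n ?elements_gt0//.
    rewrite -/V VE /nelt mulr_natr -sumr_const; apply: ler_sum => K KE.
    exact: min_vol_le.
  + lra.
- have H := level_sum_dim3 FE vol_gt0 VE V0 y0 t0 tmono e0 sume kap0 C00 tstep Fvol d3.
  apply: (le_trans H); apply: (le_trans _ (wrap ((kap^-1 + 1) * 8 ^+ d) _ _ _)).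
  + by rewrite (Psi_dim3 _ _ d3) /avg_vol -/V /nelt !mulrA.
  + by rewrite (Psi_dim3 _ _ d3) powR_ge0.
  + lra.
Qed.

End mesh_inequalities.


(** * Mass and stiffness matrices *)

Section finite_sums_of_integrals.
Context d (T : measurableType d) (R : realType).
Variable mu : {measure set T -> \bar R}.

Lemma integrable_of_bound (A : set T) (f : T -> R) (B : R) :
  measurable A -> (mu A < +oo)%E -> measurable_fun A f ->
  (forall x, A x -> `|f x| <= B) -> mu.-integrable A (EFin \o f).
Proof.
move=> mA Aoo mf fB; apply: measurable_bounded_integrable => //.
exists B; split; first exact: num_real.
by move=> M BM x Ax /=; rewrite (le_trans (fB x Ax))// ltW.
Qed.

Lemma Rintegral_sum (A : set T) (I : finType) (P : pred I) (f : I -> T -> R) :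
  measurable A -> (forall i, mu.-integrable A (EFin \o f i)) ->
  \int[mu]_(x in A) (\sum_(i | P i) f i x) = \sum_(i | P i) \int[mu]_(x in A) f i x.
Proof.
move=> mA intf; rewrite /Rintegral.
under eq_integral do rewrite -sumEFin.
rewrite (integral_sum mA (f := fun i x => (f i x)%:E))//.
transitivity (fine (\sum_(i | P i) fine (\int[mu]_(x in A) (f i x)%:E))%:E); last by [].
rewrite -sumEFin; congr fine; apply: eq_bigr => i _; rewrite fineK//.
exact: (integrable_fin_num mA (intf i)).
Qed.

Lemma Rintegral_lincomb (A : set T) (I : finType) (a : I -> R) (f : I -> T -> R) :
  measurable A -> (forall i, mu.-integrable A (EFin \o f i)) ->
  \int[mu]_(x in A) (\sum_i a i * f i x) = \sum_i a i * \int[mu]_(x in A) f i x.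
Proof.
move=> mA intf; rewrite (@Rintegral_sum A I predT (fun i x => a i * f i x))//.
  by apply: eq_bigr => i _; rewrite RintegralZl.
move=> i; have := integrableZl mA (a i) (intf i); congr integrable.
Qed.

Lemma eq_Rintegral_off_null (D N : set T) (f g : T -> R) :
  measurable N -> mu N = 0 -> (forall x, D x -> ~ N x -> f x = g x) ->
  \int[mu]_(x in D) f x = \int[mu]_(x in D) g x.
Proof.
move=> mN N0 fg; rewrite /Rintegral.
by rewrite (eq_integral_off_null mN N0 (g := fun x => (g x)%:E))// => x Dx Nx; rewrite fg.
Qed.

Lemma eq_Rintegral_domain (D D' N : set T) (f : T -> R) :
  measurable N -> mu N = 0 -> D `<=` D' -> D' `\` D `<=` N ->
  \int[mu]_(x in D) f x = \int[mu]_(x in D') f x.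
Proof.
move=> mN N0 DD' D'N; rewrite Rintegral_mkcond [RHS]Rintegral_mkcond.
apply: (eq_Rintegral_off_null mN N0) => x _ Nx; rewrite !patchE.
have [xD|xD] := boolP (x \in D).
  by rewrite mem_set//; apply: DD'; rewrite inE in xD.
case: ifPn => //; rewrite inE => xD'; case: Nx; apply: D'N; split => //.
by move=> xD''; rewrite mem_set in xD.
Qed.

End finite_sums_of_integrals.

(** * A Borel representative of the diffusion matrix *)

Section diffusion_representative.
Context (R : realType) (d : nat) (Omega : set 'rV[R]_d).
Notation mu := (lebesgue_rV d : {sigma_finite_measure set 'rV[R]_d -> \bar R}).

Record regular_diffusion (dmin dmax : R) (D : 'rV[R]_d -> 'M[R]_d) : Prop := {
  reg_sym : forall x, (D x)^T = D x;
  reg_lower : forall x, loewner_le dmin%:M (D x);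
  reg_upper : forall x, loewner_le (D x) dmax%:M;
  reg_measurable : forall a b,
    measurable_fun setT (fun x => D x a b : measurableTypeR R)
}.

Lemma scalar_qformE (a : R) (u : 'rV[R]_d) :
  (u *m a%:M *m u^T) ord0 ord0 = a * (u *m u^T) ord0 ord0.
Proof. by rewrite mul_mx_scalar -scalemxAl mxE. Qed.

(** Outside [Omega] and on the exceptional null set the matrix is replaced by [dmin%:M], which obeys
    the same bounds because a point of the nonempty [Omega] compares [dmin] with [dmax]. *)
Lemma regular_diffusion_exists (dmin dmax : R) (D : 'rV[R]_d -> 'M[R]_d) :
  open Omega -> Omega !=set0 -> diffusion_matrix Omega dmin dmax D ->
  exists Dh N, [/\ regular_diffusion dmin dmax Dh, measurable N, mu N = 0 &
    forall x, Omega x -> ~ N x -> D x = Dh x].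
Proof.
move=> oO [x0 Ox0] [Dsym Dbnd Dmeas].
have mO : measurable Omega by exact: measurable_open_rV.
have /choice[gN gNP] : forall ab : 'I_d * 'I_d, exists gN : ('rV[R]_d -> R) * set 'rV[R]_d,
    [/\ measurable_fun Omega (gN.1 : _ -> measurableTypeR R), measurable gN.2, mu gN.2 = 0 &
      forall x, Omega x -> ~ gN.2 x -> D x ab.1 ab.2 = gN.1 x].
  move=> [a b]; have [g mg [N [mN N0 NP]]] := Dmeas a b.
  exists (g, N); split => // x Ox Nx /=; apply: contrapT => ne; apply: Nx.
  by apply: NP => /=; apply: contra_not ne => /(_ Ox).
pose N := \bigcup_ab (gN ab).2.
have mN : measurable N.
  apply: fin_bigcup_measurable; first exact: finite_finset.
  by move=> ab _; have [] := gNP ab.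
have N0 : mu N = 0.
  apply/eqP; rewrite eq_le measure_ge0 andbT.
  apply: (le_trans (@measure_le_sum _ _ _ mu _ (fun ab => (gN ab).2) _ N mN _)) => //.
    by move=> ab; have [] := gNP ab.
  by rewrite big1// => ab _; have [] := gNP ab.
pose A := Omega `\` N.
have mA : measurable A by exact: measurableD.
pose Dh x := if x \in A then D x else dmin%:M.
have DhA x : x \in A -> Omega x by rewrite inE => -[].
have minmax (u : 'rV[R]_d) :
    dmin * (u *m u^T) ord0 ord0 <= dmax * (u *m u^T) ord0 ord0.
  have [l1 l2] := Dbnd x0 Ox0; have := le_trans (l1 u) (l2 u).
  by rewrite !scalar_qformE.
exists Dh, N; split => //; last first.
  by move=> x Ox Nx; rewrite /Dh mem_set.
split.
- by move=> x; rewrite /Dh; case: ifPn => [/DhA/Dsym|_] //; rewrite tr_scalar_mx.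
- move=> x; rewrite /Dh; case: ifPn => [/DhA/Dbnd[l1 l2]|_ u]; [exact: l1|exact: lexx].
- move=> x; rewrite /Dh; case: ifPn => [/DhA/Dbnd[l1 l2]|_ u]; first exact: l2.
  by rewrite !scalar_qformE.
- move=> a b; have [mg _ _ gE] := gNP (a, b).
  rewrite (_ : (fun x => Dh x a b) = (fun x => ((gN (a, b)).1 \_ A) x +
      (cst ((dmin%:M : 'M[R]_d) a b) \_ (~` A)) x)); last first.
    apply/funext => x; rewrite /Dh !patchE; case: ifPn => xA.
      rewrite memNset ?addr0; last by move=> /=; rewrite inE in xA.
      rewrite -gE//; move: xA; rewrite inE => -[Ox Nx] //.
      by apply: contra_not Nx => ?; exists (a, b).
    by rewrite mem_set ?add0r// => xA'; rewrite mem_set in xA.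
  apply: measurable_funD.
    apply: (iffLR (measurable_restrictT _ mA)).
    by apply: measurable_funS mg => // x [].
  by apply: (iffLR (measurable_restrictT (cst _) (measurableC mA))); exact: measurable_cst.
Qed.

(** Polarization: the form is tested on two coordinate vectors and on their sum. The bound makes the
    entries integrable over elements. *)
Lemma regular_diffusion_bounded dmin dmax D x a b : 0 < dmin ->
  regular_diffusion dmin dmax D -> `|D x a b| <= 2 * dmax.
Proof.
move=> dmin0 rD.
pose q (u w : 'rV[R]_d) := (u *m D x *m w^T) ord0 ord0.
pose e i : 'rV[R]_d := delta_mx ord0 i.
have qe i j : q (e i) (e j) = D x i j.
  by rewrite /q /e trmx_delta -rowE -colE !mxE.
have ee i j : (e i *m (e j)^T) ord0 ord0 = (i == j)%:R.
  by rewrite /e trmx_delta -rowE !mxE /= andbT eq_sym.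
have E (M M' : 'M[R]_1) : (M + M') ord0 ord0 = M ord0 ord0 + M' ord0 ord0.
  by rewrite mxE.
have tD : (e a + e b)^T = (e a)^T + (e b)^T by apply/matrixP => i j; rewrite !mxE.
have q0 u : 0 <= q u u.
  apply: le_trans (reg_lower rD x u); rewrite scalar_qformE.
  rewrite mulr_ge0 ?(ltW dmin0)// mxE sumr_ge0// => i _.
  by rewrite mxE -expr2 sqr_ge0.
have qle u : q u u <= dmax * (u *m u^T) ord0 ord0.
  by have := reg_upper rD x u; rewrite scalar_qformE.
have sym : D x b a = D x a b by rewrite -[in LHS](reg_sym rD x) mxE.
have qab : q (e a + e b) (e a + e b) = D x a a + D x b b + 2 * D x a b.
  have qDl u1 u2 w : q (u1 + u2) w = q u1 w + q u2 w by rewrite /q !mulmxDl E.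
  have qDr w : q w (e a + e b) = q w (e a) + q w (e b) by rewrite /q tD mulmxDr E.
  by rewrite qDl !qDr !qe sym; ring.
have ab : ((e a + e b) *m (e a + e b)^T) ord0 ord0 = 2 + 2 * (a == b)%:R.
  by rewrite tD mulmxDl !mulmxDr !E !ee !eqxx [b == a]eq_sym /=; ring.
have qa := qle (e a); have qb := qle (e b); have qq := qle (e a + e b).
have pa := q0 (e a); have pb := q0 (e b); have pq := q0 (e a + e b).
move: qa qb qq pa pb pq; rewrite !qe !ee !eqxx qab ab !mulr1 => qa qb qq pa pb pq.
rewrite ler_norml; apply/andP; split; first lra.
by move: qq; case: (a == b) => /= qq; lra.
Qed.

End diffusion_representative.

(** Each cross term is at most the mean of the two diagonal ones. In use [A] is the vertex set of an
    element, so the factor is [d + 1]. *)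
Lemma qform_sum_le (R : realType) (d : nat) (D : 'M[R]_d) (I : finType)
    (A : {set I}) (a : I -> R) (w : I -> 'rV[R]_d) :
  D^T = D -> (forall u : 'rV[R]_d, 0 <= (u *m D *m u^T) ord0 ord0) ->
  ((\sum_(i in A) a i *: w i) *m D *m (\sum_(i in A) a i *: w i)^T) ord0 ord0 <=
  #|A|%:R * \sum_(i in A) a i ^+ 2 * (w i *m D *m (w i)^T) ord0 ord0.
Proof.
move=> Ds Dp; pose b (u v : 'rV[R]_d) := (u *m D *m v^T) ord0 ord0.
have EZ t (M : 'M[R]_1) : (t *: M) ord0 ord0 = t * M ord0 ord0 by rewrite mxE.
have bs u v : b u v = b v u.
  have -> : b u v = ((u *m D *m v^T)^T) ord0 ord0 by rewrite mxE.
  by rewrite !trmx_mul trmxK Ds mulmxA.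
have ble u v : b u v <= (b u u + b v v) / 2.
  have := Dp (u - v); rewrite -[X in 0 <= X]/(b (u - v) (u - v)).
  have -> : b (u - v) (u - v) = b u u + b v v - 2 * b u v.
    have EB (M M' : 'M[R]_1) : (M - M') ord0 ord0 = M ord0 ord0 - M' ord0 ord0.
      by rewrite !mxE.
    have bBl x y z : b (x - y) z = b x z - b y z by rewrite /b !mulmxBl EB.
    by rewrite bBl [b u _]bs [b v (u - v)]bs !bBl [b v u]bs; ring.
  lra.
have sumE (u : I -> 'rV[R]_d) (v : 'rV[R]_d) :
    b (\sum_(i in A) u i) v = \sum_(i in A) b (u i) v.
  by rewrite /b !mulmx_suml summxE.
have sumEr (u : I -> 'rV[R]_d) (v : 'rV[R]_d) :
    b v (\sum_(i in A) u i) = \sum_(i in A) b v (u i).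
  by rewrite bs sumE; apply: eq_bigr => i _; rewrite bs.
rewrite -[leLHS]/(b _ _) sumE.
under eq_bigr do rewrite sumEr.
apply: (@le_trans _ _ (\sum_(i in A) \sum_(j in A)
    (b (a i *: w i) (a i *: w i) + b (a j *: w j) (a j *: w j)) / 2)).
  by apply: ler_sum => i _; apply: ler_sum => j _; exact: ble.
have bE i : b (a i *: w i) (a i *: w i) = a i ^+ 2 * (w i *m D *m (w i)^T) ord0 ord0.
  have tZ : (a i *: w i)^T = a i *: (w i)^T by apply/matrixP => j k; rewrite !mxE.
  by rewrite /b tZ -!scalemxAl -scalemxAr !EZ; ring.
pose f i := b (a i *: w i) (a i *: w i).
have -> : \sum_(i in A) \sum_(j in A) (f i + f j) / 2 = #|A|%:R * \sum_(i in A) f i.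
  transitivity (\sum_(i in A) (#|A|%:R * f i + \sum_(j in A) f j) / 2).
    apply: eq_bigr => i _; rewrite -mulr_suml big_split/= sumr_const.
    by rewrite -[_ *+ _]mulr_natl.
  by rewrite -mulr_suml big_split/= -mulr_sumr sumr_const -[_ *+ _]mulr_natl; field.
by rewrite (eq_bigr _ (fun i _ => bE i)).
Qed.

Lemma derive_affine_map (R : realType) (d : nat) (g : 'rV[R]_d) (c : R)
    (x v : 'rV[R]_d) : 'D_v (affine_map g c) x = (v *m g^T) ord0 ord0.
Proof.
rewrite /derive; apply: lim_near_cst => //.
near=> h.
have h0 : h != 0 by near: h; exact: nbhs_dnbhs_neq.
rewrite /= [h *: v + x]addrC affine_map_ray addrAC subrr add0r.
by rewrite -[LHS]/(h^-1 * (h * _)) mulKf.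
Unshelve. all: by end_near. Qed.

Section matrix_entries.
Context (R : realType) (d : nat) (Omega : set 'rV[R]_d) (m : mesh R d).
Hypothesis Omega_reg : interior (closure Omega) = Omega.
Hypothesis Omega_neq0 : Omega !=set0.
Hypothesis Hm : conforming_mesh Omega m.
Notation n := (nvi m + nvb m)%N.
Notation p := (@vertex R d m).
Variables (g : {set 'I_n} -> 'I_n -> 'rV[R]_d) (c : {set 'I_n} -> 'I_n -> R).
Hypothesis gcE : forall K, K \in elements m -> barycentric p K (g K) (c K).
Variable phi : 'I_(nvi m) -> 'rV[R]_d -> R.
Hypothesis Hphi : forall j, nodal_basis Omega j (phi j).

Notation bary K i := (affine_map (g K i) (c K i)).
Notation v j := (lshift (nvb m) j).
Notation mu := (lebesgue_rV d : {sigma_finite_measure set 'rV[R]_d -> \bar R}).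
Notation inner_elt := (@inner_elt R d m g c).
Notation inner_elt_or0 := (@inner_elt_or0 R d m g c).

Let aiE K : K \in elements m -> affinely_independent p K.
Proof. by move=> KE; have [] := element_simplex Hm KE. Qed.

Let cardE K : K \in elements m -> #|K| = d.+1.
Proof. by move=> KE; have [] := element_simplex Hm KE. Qed.

Let mI (K : {set 'I_n}) : measurable (inner_elt K).
Proof. exact: measurable_open_simplex. Qed.

Let I_elt K : K \in elements m -> inner_elt K `<=` elt K.
Proof. by move=> KE; exact: (open_simplex_conv (aiE KE) (gcE KE)). Qed.

Let muI K : K \in elements m -> mu (inner_elt K) = (vol K)%:E.
Proof.
move=> KE; rewrite -(volumeE (aiE KE) (gcE KE)).
exact/esym/(conv_of_open_simplex (cardE KE) (aiE KE) (gcE KE)).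
Qed.

Let Ifin K : K \in elements m -> (mu (inner_elt K) < +oo)%E.
Proof. by move=> /muI ->; rewrite ltry. Qed.

(** Only the expressions [Fh K] have to be integrable: [F] is compared with them off a null set, so
    its values on element boundaries and on [N] are immaterial. *)
Lemma integral_domain_sum (F : 'rV[R]_d -> R) (Fh : {set 'I_n} -> 'rV[R]_d -> R)
    (N : set 'rV[R]_d) : measurable N -> mu N = 0 ->
  (forall K x, K \in elements m -> inner_elt K x -> ~ N x -> F x = Fh K x) ->
  (forall K, K \in elements m -> mu.-integrable (inner_elt K) (EFin \o Fh K)) ->
  \int[mu]_(x in Omega) F x =
  \sum_(K in elements m) \int[mu]_(x in inner_elt K) Fh K x.
Proof.
move=> mN N0 FE intF.
pose f K x := (Fh K \_ (inner_elt_or0 K)) x.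
have mI0 K : measurable (inner_elt_or0 K) by exact: measurable_inner_elt_or0.
have intf K : mu.-integrable setT (EFin \o f K).
  have -> : EFin \o f K = (EFin \o Fh K) \_ (inner_elt_or0 K).
    by apply/funext => x; rewrite /f /= !patchE; case: ifP.
  apply: (iffLR (integrable_mkcond _ (mI0 K))).
  rewrite /inner_elt_or0; case: ifPn => KE; first exact: intF.
  exact: integrable_set0.
have sumE : \sum_(K in elements m) \int[mu]_(x in inner_elt K) Fh K x =
    \sum_K \int[mu]_x f K x.
  rewrite [LHS]big_mkcond/=; apply: eq_bigr => K _.
  rewrite /f -Rintegral_mkcond /inner_elt_or0.
  by case: ifPn => // KE; rewrite Rintegral_set0.
rewrite sumE -(@Rintegral_sum _ _ _ mu setT _ predT f measurableT intf) Rintegral_mkcond.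
pose N' := N `|` \bigcup_K (elt_or0 K `\` inner_elt_or0 K).
have mD K : measurable (elt_or0 K `\` inner_elt_or0 K).
  by apply: measurableD => //; exact: (measurable_elt_or0 Hm gcE).
have mB : measurable (\bigcup_K (elt_or0 K `\` inner_elt_or0 K)).
  apply: fin_bigcup_measurable; first exact: finite_finset.
  by move=> K _; exact: mD.
have mN' : measurable N' by exact: measurableU.
have N'0 : mu N' = 0.
  apply/eqP; rewrite eq_le measure_ge0 andbT.
  apply: (le_trans (measureU2 _ _ _)) => //.
  rewrite [X in (X + _)%E]N0 add0e.
  apply: (le_trans (@measure_le_sum _ _ _ mu _
    (fun K => elt_or0 K `\` inner_elt_or0 K) mD _ mB _)) => //.
  by rewrite big1// => K _; exact: (elt_or0_null Hm gcE).
apply: (eq_Rintegral_off_null mN' N'0) => x _ Nx.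
rewrite patchE; case: ifPn => [|xO].
  rewrite inE => Ox; have [K KE xK] := closure_elt Hm (subset_closure Ox).
  have xI : inner_elt K x.
    apply: contrapT => xI; apply: Nx; right; exists K => //.
    by rewrite /elt_or0 /inner_elt_or0 KE.
  have xN : ~ N x by move=> ?; apply: Nx; left.
  rewrite (bigD1 K)//= /f patchE mem_set; last by rewrite /inner_elt_or0 KE.
  rewrite big1 ?addr0; first exact: FE.
  move=> L LK; rewrite patchE; case: ifPn => //; rewrite inE /inner_elt_or0.
  case: ifPn => // LE xL.
  have /seteqP[+ _] := inner_elt_trivIset Hm gcE LE KE LK.
  by move=> /(_ x (conj xL xI)).
rewrite big1// => K _; rewrite /f patchE; case: ifPn => //.
rewrite inE /inner_elt_or0; case: ifPn => // KE /(inner_elt_domain Omega_reg Hm gcE KE) Ox.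
by rewrite mem_set in xO.
Qed.

Let in_elt (j : 'I_(nvi m)) (K : {set 'I_n}) : R := (v j \in K)%:R.

Let hat (K : {set 'I_n}) (j : 'I_(nvi m)) (x : 'rV[R]_d) : R := in_elt j K * bary K (v j) x.

Let hatE K j x : K \in elements m -> inner_elt K x -> phi j x = hat K j x.
Proof. by move=> KE /(I_elt KE) xK; exact: (nodal_bary Hm gcE Hphi). Qed.

Let measurable_hat K j : measurable_fun setT (hat K j : _ -> measurableTypeR R).
Proof. by apply: measurable_funM => //; exact: measurable_affine_map. Qed.

Let hat_le1 K j x : K \in elements m -> inner_elt K x -> `|hat K j x| <= 1.
Proof.
move=> KE xK; rewrite /hat /in_elt; case: (boolP (v j \in K)) => vK; last first.
  by rewrite mul0r normr0.
rewrite mul1r ger0_norm ?(ltW (xK _ vK))//.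
exact: (conv_of_bary_le1 (aiE KE) (gcE KE) (I_elt KE xK)).
Qed.

Let integrable_hat2 K k j : K \in elements m ->
  mu.-integrable (inner_elt K) (EFin \o (fun x => hat K k x * hat K j x)).
Proof.
move=> KE; apply: (integrable_of_bound (B := 1)) => //; first exact: Ifin.
  by apply: measurable_funTS; apply: measurable_funM; exact: measurable_hat.
by move=> x xK; rewrite normrM mulr_ile1// hat_le1.
Qed.

Lemma mass_entry k j : mass_matrix Omega phi k j =
  \sum_(K in elements m) \int[mu]_(x in inner_elt K) (hat K k x * hat K j x).
Proof.
rewrite mxE; apply: (integral_domain_sum (N := set0)) => //.
- by move=> K x KE xK _; rewrite !(hatE _ KE xK).
- by move=> K KE; exact: integrable_hat2.
Qed.

Lemma mass_qform (u : 'cV[R]_(nvi m)) :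
  qform (mass_matrix Omega phi) u u =
  \sum_(K in elements m) \int[mu]_(x in inner_elt K)
    (zero_ext Omega phi (fun j => u j ord0) x) ^+ 2.
Proof.
have -> : qform (mass_matrix Omega phi) u u =
    \sum_k \sum_j u k ord0 * u j ord0 * mass_matrix Omega phi k j.
  rewrite /qform mxE; under eq_bigr do rewrite mxE mulr_suml.
  rewrite exchange_big/=; apply: eq_bigr => k _; apply: eq_bigr => j _.
  by rewrite mxE; ring.
under eq_bigr do under eq_bigr do rewrite mass_entry mulr_sumr.
under eq_bigr do rewrite exchange_big/=.
rewrite exchange_big/=; apply: eq_bigr => K KE.
transitivity (\int[mu]_(x in inner_elt K)
    (\sum_(kj : 'I_(nvi m) * 'I_(nvi m)) (u kj.1 ord0 * u kj.2 ord0) *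
      (hat K kj.1 x * hat K kj.2 x))).
  rewrite (Rintegral_lincomb (fun kj : 'I_(nvi m) * 'I_(nvi m) => u kj.1 ord0 * u kj.2 ord0)
    (f := fun kj x => hat K kj.1 x * hat K kj.2 x))//.
    by rewrite pair_big/=.
  by move=> kj; exact: integrable_hat2.
apply: eq_Rintegral => x; rewrite inE => xK.
rewrite -(pair_big xpredT xpredT (fun k j => u k ord0 * u j ord0 * (hat K k x * hat K j x)))/=.
rewrite (zero_ext_bary Hm gcE Hphi _ KE (I_elt KE xK)) nodal_val_sum expr2 big_distrlr/=.
by apply: eq_bigr => k _; apply: eq_bigr => j _; rewrite /hat /in_elt; ring.
Qed.

Lemma grad_nodal K j x : K \in elements m -> inner_elt K x ->
  grad (phi j) x = in_elt j K *: g K (v j).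
Proof.
move=> KE xK; apply/rowP => a; rewrite !mxE.
have -> : 'D_(delta_mx ord0 a) (phi j) x =
    'D_(delta_mx ord0 a) (affine_map (in_elt j K *: g K (v j)) (in_elt j K * c K (v j))) x.
  apply: near_eq_derive.
  have : nbhs x (inner_elt K).
    by apply: open_nbhs_nbhs; split => //; exact: open_open_simplex.
  apply: filterS => y yK; rewrite (hatE j KE yK) /hat /affine_map linearZ/=.
  by rewrite -scalemxAr [X in _ = X + _]mxE mulrDr.
by rewrite derive_affine_map linearZ/= -scalemxAr mxE -rowE !mxE.
Qed.

Variables (DD : 'rV[R]_d -> 'M[R]_d) (dmin dmax : R).
Hypotheses (dmin_gt0 : 0 < dmin).
Variables (Dh : 'rV[R]_d -> 'M[R]_d) (N : set 'rV[R]_d).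
Hypotheses (rD : regular_diffusion dmin dmax Dh) (mN : measurable N).
Hypotheses (N0 : mu N = 0) (DhE : forall x, Omega x -> ~ N x -> DD x = Dh x).

Let integrable_Dh K a b : K \in elements m ->
  mu.-integrable (inner_elt K) (EFin \o (fun x => Dh x a b)).
Proof.
move=> KE; apply: (integrable_of_bound (B := 2 * dmax)) => //; first exact: Ifin.
  by apply: measurable_funTS; exact: (reg_measurable rD).
by move=> x _; exact: (regular_diffusion_bounded x a b dmin_gt0 rD).
Qed.

(** The interior of the element contains the open simplex and differs from it by a null set, which
    suffices here. *)
Lemma avg_onE K a b : K \in elements m ->
  vol K * avg_on DD K a b = \int[mu]_(x in inner_elt K) Dh x a b.
Proof.
move=> KE; rewrite mxE mulVKf ?gt_eqF ?(vol_gt0 Hm gcE)//.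
transitivity (\int[mu]_(x in inner_elt K) DD x a b).
  apply/esym/(eq_Rintegral_domain (N := elt K `\` inner_elt K)).
  - by apply: measurableD => //; exact: (measurable_conv_of (aiE KE) (gcE KE)).
  - exact: (conv_of_setD_open_simplex (cardE KE) (aiE KE) (gcE KE)).
  - exact: (open_simplex_interior (aiE KE) (gcE KE)).
  - by move=> x [/interior_subset xK xI]; split.
apply: (eq_Rintegral_off_null mN N0) => x xK Nx.
by rewrite DhE//; exact: (inner_elt_domain Omega_reg Hm gcE KE).
Qed.

Lemma avg_on_sesqui K (u w : 'rV[R]_d) : K \in elements m ->
  vol K * (u *m avg_on DD K *m w^T) ord0 ord0 =
  \int[mu]_(x in inner_elt K) (u *m Dh x *m w^T) ord0 ord0.
Proof.
move=> KE.
have sq (M : 'M[R]_d) : (u *m M *m w^T) ord0 ord0 =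
    \sum_(ab : 'I_d * 'I_d) (u ord0 ab.1 * w ord0 ab.2) * M ab.1 ab.2.
  rewrite -(pair_big xpredT xpredT (fun a b => u ord0 a * w ord0 b * M a b))/=.
  rewrite exchange_big mxE/=; apply: eq_bigr => b _; rewrite mxE mulr_suml.
  by apply: eq_bigr => a _; rewrite mxE; ring.
under eq_Rintegral do rewrite sq.
rewrite (Rintegral_lincomb (fun ab : 'I_d * 'I_d => u ord0 ab.1 * w ord0 ab.2)
  (f := fun ab x => Dh x ab.1 ab.2))//; last by move=> ab; exact: integrable_Dh.
rewrite sq mulr_sumr; apply: eq_bigr => ab _.
by rewrite -avg_onE//; ring.
Qed.

Lemma avg_on_sym K : K \in elements m -> (avg_on DD K)^T = avg_on DD K.
Proof.
move=> KE; apply/matrixP => a b; rewrite mxE.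
have vK : vol K != 0 by rewrite gt_eqF// (vol_gt0 Hm gcE).
apply: (mulfI vK); rewrite !avg_onE//; apply: eq_Rintegral => x _.
by rewrite -[in RHS](reg_sym rD x) mxE.
Qed.

Lemma avg_on_lower K (u : 'rV[R]_d) : K \in elements m ->
  dmin * (u *m u^T) ord0 ord0 <= (u *m avg_on DD K *m u^T) ord0 ord0.
Proof.
move=> KE; have vK := vol_gt0 Hm gcE KE.
rewrite -(ler_pM2l vK) avg_on_sesqui//.
have -> : vol K * (dmin * (u *m u^T) ord0 ord0) =
    \int[mu]_(x in inner_elt K) (dmin * (u *m u^T) ord0 ord0).
  by rewrite Rintegral_cst// [X in fine X](muI KE)/= mulrC.
apply: le_Rintegral => //.
- by apply: (integrable_of_bound (B := `|dmin * (u *m u^T) ord0 ord0|)) => //; exact: Ifin.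
- have sq (M : 'M[R]_d) : (u *m M *m u^T) ord0 ord0 =
      \sum_a \sum_b (u ord0 a * u ord0 b) * M a b.
    rewrite exchange_big mxE/=; apply: eq_bigr => b _; rewrite mxE mulr_suml.
    by apply: eq_bigr => a _; rewrite mxE; ring.
  apply: (integrable_of_bound (B := \sum_a \sum_b `|u ord0 a * u ord0 b| * (2 * dmax))) => //.
  + exact: Ifin.
  + under eq_fun do rewrite sq.
    apply: measurable_funTS; apply: measurable_sum => a; apply: measurable_sum => b.
    by apply: measurable_funM => //; exact: (reg_measurable rD).
  + move=> x _; rewrite sq (le_trans (ler_norm_sum _ _ _))//; apply: ler_sum => a _.
    rewrite (le_trans (ler_norm_sum _ _ _))//; apply: ler_sum => b _.
    by rewrite normrM ler_wpM2l// (regular_diffusion_bounded x a b dmin_gt0 rD).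
- by move=> x _; have := reg_lower rD x u; rewrite scalar_qformE.
Qed.

Lemma stiffness_entry k j : stiffness_matrix Omega DD phi k j =
  \sum_(K in elements m) vol K *
    ((in_elt k K *: g K (v k)) *m avg_on DD K *m (in_elt j K *: g K (v j))^T) ord0 ord0.
Proof.
rewrite mxE (integral_domain_sum (N := N) (Fh := fun K x =>
  ((in_elt k K *: g K (v k)) *m Dh x *m (in_elt j K *: g K (v j))^T) ord0 ord0))//.
- by apply: eq_bigr => K KE; rewrite avg_on_sesqui.
- move=> K x KE xK Nx; rewrite !(grad_nodal _ KE xK) DhE//.
  exact: (inner_elt_domain Omega_reg Hm gcE KE).
- move=> K KE; set u := _ *: _; set w := _ *: _.
  have sq (M : 'M[R]_d) : (u *m M *m w^T) ord0 ord0 =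
      \sum_a \sum_b (u ord0 a * w ord0 b) * M a b.
    rewrite exchange_big mxE/=; apply: eq_bigr => b _; rewrite mxE mulr_suml.
    by apply: eq_bigr => a _; rewrite [w^T _ _]mxE; ring.
  apply: (integrable_of_bound (B := \sum_a \sum_b `|u ord0 a * w ord0 b| * (2 * dmax))) => //.
  + exact: Ifin.
  + under eq_fun do rewrite sq.
    apply: measurable_funTS; apply: measurable_sum => a; apply: measurable_sum => b.
    by apply: measurable_funM => //; exact: (reg_measurable rD).
  + move=> x _; rewrite sq (le_trans (ler_norm_sum _ _ _))//; apply: ler_sum => a _.
    rewrite (le_trans (ler_norm_sum _ _ _))//; apply: ler_sum => b _.
    by rewrite normrM ler_wpM2l// (regular_diffusion_bounded x a b dmin_gt0 rD).
Qed.

Lemma stiffness_qform (u : 'cV[R]_(nvi m)) :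
  qform (stiffness_matrix Omega DD phi) u u =
  \sum_(K in elements m) vol K *
    (elt_grad g (fun j => u j ord0) K *m avg_on DD K *m
     (elt_grad g (fun j => u j ord0) K)^T) ord0 ord0.
Proof.
have -> : qform (stiffness_matrix Omega DD phi) u u =
    \sum_k \sum_j u k ord0 * u j ord0 * stiffness_matrix Omega DD phi k j.
  rewrite /qform mxE; under eq_bigr do rewrite mxE mulr_suml.
  rewrite exchange_big/=; apply: eq_bigr => k _; apply: eq_bigr => j _.
  by rewrite mxE; ring.
under eq_bigr do under eq_bigr do rewrite stiffness_entry mulr_sumr.
under eq_bigr do rewrite exchange_big/=.
rewrite exchange_big/=; apply: eq_bigr => K KE.
rewrite /elt_grad linear_sum/= !mulmx_suml summxE mulr_sumr; apply: eq_bigr => k _.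
rewrite mulmx_sumr summxE mulr_sumr; apply: eq_bigr => j _.
have bE a1 a2 (x y : 'rV[R]_d) (A : 'M[R]_d) :
    ((a1 *: x) *m A *m (a2 *: y)^T) ord0 ord0 = a1 * a2 * (x *m A *m y^T) ord0 ord0.
  have tZ : (a2 *: y)^T = a2 *: y^T by apply/matrixP => k' j'; rewrite !mxE.
  rewrite tZ -!scalemxAl -scalemxAr.
  have EZ t (M : 'M[R]_1) : (t *: M) ord0 ord0 = t * M ord0 ord0 by rewrite mxE.
  by rewrite !EZ mulrA.
by rewrite !bE /in_elt; ring.
Qed.

Lemma mass_matrix_sym : (mass_matrix Omega phi)^T = mass_matrix Omega phi.
Proof.
apply/matrixP => k j; rewrite mxE !mass_entry; apply: eq_bigr => K _.
by apply: eq_Rintegral => x _; rewrite mulrC.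
Qed.

Lemma stiffness_matrix_sym :
  (stiffness_matrix Omega DD phi)^T = stiffness_matrix Omega DD phi.
Proof.
apply/matrixP => k j; rewrite mxE !stiffness_entry; apply: eq_bigr => K KE.
congr (_ * _); set A := _ *m _.
have -> : A ord0 ord0 = A^T ord0 ord0 by rewrite [RHS]mxE.
by rewrite /A !trmx_mul trmxK avg_on_sym// mulmxA.
Qed.

End matrix_entries.


(** * Estimates of the quadratic forms *)

Lemma Psi_gt0 (R : realType) (d : nat) (Omega : set 'rV[R]_d) (m : mesh R d) :
  (1 <= d)%N -> 0 < avg_vol Omega m -> (0 < #|elements m|)%N ->
  (forall K, K \in elements m -> 0 < vol K) -> 0 < min_vol m <= avg_vol Omega m ->
  0 < Psi Omega m.
Proof.
move=> d1 a0 /card_gt0P[K0 K0E] v0 /andP[m0 ma].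
case: (ltngtP d 2) => [h|h|h].
- by rewrite Psi_dim1//; apply/eqP; rewrite eqn_leq d1 -ltnS h.
- rewrite Psi_dim3// powR_gt0// mulr_gt0// ?invr_gt0 ?ltr0n//.
    by apply/card_gt0P; exists K0.
  have P0 : 0 < (avg_vol Omega m / vol K0) `^ ((d%:R - 2) / 2).
    by rewrite powR_gt0// divr_gt0// v0.
  rewrite (bigD1 K0)//= ltr_pwDl// sumr_ge0// => K _; exact: powR_ge0.
- by rewrite Psi_dim2// ltr_pwDl// ln_ge0// ler_pdivlMr// mul1r.
Qed.

Section estimates.
Context (R : realType) (d : nat) (Omega : set 'rV[R]_d) (m : mesh R d).
Hypothesis d1 : (1 <= d)%N.
Hypothesis Omega_reg : interior (closure Omega) = Omega.
Hypothesis Omega_neq0 : Omega !=set0.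
Hypothesis Hm : conforming_mesh Omega m.
Notation n := (nvi m + nvb m)%N.
Notation p := (@vertex R d m).
Variables (g : {set 'I_n} -> 'I_n -> 'rV[R]_d) (c : {set 'I_n} -> 'I_n -> R).
Hypothesis gcE : forall K, K \in elements m -> barycentric p K (g K) (c K).
Variable phi : 'I_(nvi m) -> 'rV[R]_d -> R.
Hypothesis Hphi : forall j, nodal_basis Omega j (phi j).

Notation bary K i := (affine_map (g K i) (c K i)).
Notation v j := (lshift (nvb m) j).
Notation mu := (lebesgue_rV d : {sigma_finite_measure set 'rV[R]_d -> \bar R}).
Notation inner_elt := (@inner_elt R d m g c).
Implicit Type u : 'I_(nvi m) -> R.

Let aiE K : K \in elements m -> affinely_independent p K.
Proof. by move=> KE; have [] := element_simplex Hm KE. Qed.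

Let cardE K : K \in elements m -> #|K| = d.+1.
Proof. by move=> KE; have [] := element_simplex Hm KE. Qed.

Let volE K : K \in elements m -> 0 < vol K.
Proof. exact: (vol_gt0 Hm gcE). Qed.

Lemma extremal_vertex u : exists k : {set 'I_n} -> 'I_n,
  forall K, K \in elements m -> k K \in K /\
    forall i, i \in K -> `|nodal_val u i| <= `|nodal_val u (k K)|.
Proof.
have /choice[k kP] : forall K : {set 'I_n}, exists i0 : 'I_n, K \in elements m ->
    i0 \in K /\ forall i, i \in K -> `|nodal_val u i| <= `|nodal_val u i0|.
  move=> K; have [KE|KE] := boolP (K \in elements m); last first.
    have /card_gt0P[L LE] := elements_gt0 Omega_neq0 Hm.
    have /card_gt0P[i iL] : (0 < #|L|)%N by rewrite cardE.
    by exists i => KE'; case/negP: KE.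
  have /card_gt0P[i0 i0K] : (0 < #|K|)%N by rewrite cardE.
  exists [arg max_(i > i0 in K) `|nodal_val u i|]%O => _.
  by case: arg_maxP.
by exists k.
Qed.

Lemma nodal_valN u i : nodal_val (\- u) i = - nodal_val u i.
Proof. by rewrite /nodal_val -sumrN; apply: eq_bigr => j _; rewrite mulNr. Qed.

Lemma zero_extN u x : zero_ext Omega phi (\- u) x = - zero_ext Omega phi u x.
Proof.
rewrite /zero_ext; case: ifP => _; last by rewrite oppr0.
by rewrite -sumrN; apply: eq_bigr => j _; rewrite mulNr.
Qed.

Lemma dirichlet_energyN u : dirichlet_energy g (\- u) = dirichlet_energy g u.
Proof.
apply: eq_bigr => K _; congr (_ * _).
have -> : elt_grad g (\- u) K = - elt_grad g u K.
  by rewrite /elt_grad -sumrN; apply: eq_bigr => j _; rewrite mulNr scaleNr.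
by rewrite mulNmx -mulmxN -linearN/= opprK.
Qed.

(** Double counting of pairs of an element and one of its vertices; the boundary vertices drop out
    because [nodal_val] vanishes there. *)
Lemma patch_sum u (f : {set 'I_n} -> 'I_n -> R) :
  \sum_(K in elements m) \sum_(i in K) nodal_val u i ^+ 2 * f K i =
  \sum_j u j ^+ 2 * \sum_(K in vpatch j) f K (v j).
Proof.
transitivity (\sum_(K in elements m) \sum_j (v j \in K)%:R * (u j ^+ 2 * f K (v j))).
  apply: eq_bigr => K _.
  transitivity (\sum_(i in K) nodal_val u i * (nodal_val u i * f K i)).
    by apply: eq_bigr => i _; rewrite mulrA.
  rewrite nodal_val_sum; apply: eq_bigr => j _.
  by rewrite nodal_val_lshift; ring.
rewrite exchange_big/=; apply: eq_bigr => j _.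
rewrite mulr_sumr [RHS]big_mkcond [LHS]big_mkcond/=; apply: eq_bigr => K _.
by rewrite inE; case: (K \in elements m); case: (v j \in K); rewrite /= ?mul1r ?mul0r.
Qed.

(** Every interior vertex lies in some element, and an element has [d + 1] vertices. *)
Lemma sqr_sum_le_extremal u (k : {set 'I_n} -> 'I_n) :
  (forall K, K \in elements m -> k K \in K /\
    forall i, i \in K -> `|nodal_val u i| <= `|nodal_val u (k K)|) ->
  \sum_j u j ^+ 2 <= d.+1%:R * \sum_(K in elements m) nodal_val u (k K) ^+ 2.
Proof.
move=> kP.
apply: (@le_trans _ _ (\sum_j u j ^+ 2 * \sum_(K in vpatch j) 1)).
  apply: ler_sum => j _; rewrite ler_peMr ?sqr_ge0//.
  have [K KE vK] := vertex_used Hm (v j).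
  by rewrite (bigD1 K)/= ?lerDl ?sumr_ge0// inE KE.
rewrite -(patch_sum u (fun _ _ => 1)) mulr_sumr; apply: ler_sum => K KE.
have [_ kmax] := kP K KE.
rewrite -(cardE KE) mulr_natl -sumr_const; apply: ler_sum => i iK.
rewrite mulr1 -[leLHS]real_normK ?num_real// -[leRHS]real_normK ?num_real//.
by rewrite ler_pXn2r ?nnegrE ?normr_ge0// kmax.
Qed.

(** The discrete Sobolev inequality. The factor 8 is 4, from halving the extremal values, times 2,
    from adding the bounds for [u] and [- u]. *)
Lemma dirichlet_bound u : \sum_j u j ^+ 2 <=
  8 * d.+1%:R * sum_const Omega * (nelt m * Psi Omega m * dirichlet_energy g u).
Proof.
have [k kP] := extremal_vertex u.
apply: (le_trans (sqr_sum_le_extremal kP)).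
pose y K := (`|nodal_val u (k K)| / 2) ^+ 2.
have y0 K : 0 <= y K by exact: sqr_ge0.
have yE K : nodal_val u (k K) ^+ 2 = 4 * y K.
  by rewrite /y expr_div_n real_normK ?num_real//; field.
have b1 := nonneg_part_bound Omega_reg Omega_neq0 Hm gcE Hphi d1 kP.
have kPN K : K \in elements m -> k K \in K /\
    forall i, i \in K -> `|nodal_val (\- u) i| <= `|nodal_val (\- u) (k K)|.
  move=> KE; have [h1 h2] := kP K KE; split => // i iK.
  by rewrite !nodal_valN !normrN h2.
have b2 := nonneg_part_bound Omega_reg Omega_neq0 Hm gcE Hphi d1 kPN.
rewrite dirichlet_energyN in b2.
set B := sum_const Omega * nelt m * Psi Omega m * dirichlet_energy g u in b1 b2.
have b3 : \sum_(K in elements m) y K <= B + B.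
  apply: le_trans (lerD b1 b2).
  have bE (P : pred {set 'I_n}) : \sum_(K in [set K in elements m | P K]) y K =
      \sum_(K in elements m) (if P K then y K else 0).
    by rewrite -big_mkcondr/=; apply: eq_bigl => K; rewrite inE.
  rewrite (bE (fun K => 0 <= nodal_val u (k K))).
  rewrite (_ : \sum_(K in [set K in elements m | 0 <= nodal_val (\- u) (k K)]) _ =
    \sum_(K in [set K in elements m | 0 <= nodal_val (\- u) (k K)]) y K); last first.
    by apply: eq_bigr => K _; rewrite nodal_valN normrN.
  rewrite (bE (fun K => 0 <= nodal_val (\- u) (k K))) -big_split/=.
  apply: ler_sum => K KE; rewrite nodal_valN oppr_ge0.
  by case: (leP 0 (nodal_val u (k K))) => h; [case: ifP|rewrite (ltW h)];
    rewrite ?lerDl ?addr0 ?add0r.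
under eq_bigr do rewrite yE.
rewrite -mulr_sumr.
apply: (@le_trans _ _ (d.+1%:R * (4 * (B + B)))).
  by rewrite ler_pM2l// ler_pM2l.
by rewrite /B le_eqVlt; apply/orP; left; apply/eqP; ring.
Qed.

Lemma abs_corner_value u K k x : K \in elements m -> elt K x -> k \in K ->
  (forall i, i \in K -> `|nodal_val u i| <= `|nodal_val u k|) ->
  1 - 4^-1 <= bary K k x -> `|nodal_val u k| / 2 <= `|zero_ext Omega phi u x|.
Proof.
move=> KE xK kK kmax b34; have [u0|u0] := leP 0 (nodal_val u k).
  rewrite (ger0_norm u0); apply: le_trans (ler_norm _).
  exact: (corner_value Hm gcE Hphi KE xK kK kmax b34 u0).
rewrite (ltr0_norm u0) -normrN -zero_extN -nodal_valN.
apply: le_trans (ler_norm _).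
apply: (corner_value Hm gcE Hphi KE xK kK _ b34).
  by move=> i iK; rewrite !nodal_valN !normrN kmax.
by rewrite nodal_valN oppr_ge0 ltW.
Qed.

Lemma zero_ext_le u K k x : K \in elements m -> elt K x -> k \in K ->
  (forall i, i \in K -> `|nodal_val u i| <= `|nodal_val u k|) ->
  `|zero_ext Omega phi u x| <= `|nodal_val u k|.
Proof.
move=> KE xK kK kmax; rewrite (zero_ext_bary Hm gcE Hphi u KE xK).
have x0 : forall i, i \in K -> 0 <= bary K i x.
  by move: xK; rewrite /elt (conv_ofE (aiE KE) (gcE KE)).
apply: (le_trans (ler_norm_sum _ _ _)).
rewrite -[leRHS]mulr1 -[X in _ <= _ * X]((gcE KE).1 x) mulr_sumr.
apply: ler_sum => i iK; rewrite normrM [X in _ * X]ger0_norm ?x0//.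
by rewrite ler_wpM2r ?x0// kmax.
Qed.

Let mI (K : {set 'I_n}) : measurable (inner_elt K).
Proof. exact: measurable_open_simplex. Qed.

Let I_elt K : K \in elements m -> inner_elt K `<=` elt K.
Proof. by move=> KE; exact: (open_simplex_conv (aiE KE) (gcE KE)). Qed.

Let muI K : K \in elements m -> mu (inner_elt K) = (vol K)%:E.
Proof.
move=> KE; rewrite -(volumeE (aiE KE) (gcE KE)).
exact/esym/(conv_of_open_simplex (cardE KE) (aiE KE) (gcE KE)).
Qed.

Let integrable_sqr u K k : K \in elements m -> k \in K ->
  (forall i, i \in K -> `|nodal_val u i| <= `|nodal_val u k|) ->
  mu.-integrable (inner_elt K) (EFin \o (fun x => zero_ext Omega phi u x ^+ 2)).
Proof.
move=> KE kK kmax.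
apply: (integrable_of_bound (B := `|nodal_val u k| ^+ 2)) => //.
- by rewrite [X in (X < _)%E](muI KE) ltry.
- apply: measurable_funX.
  apply: (eq_measurable_fun _ _ (measurable_funTS (measurable_affine_map
    (\sum_j (u j * (v j \in K)%:R) *: g K (v j))
    (\sum_j (u j * (v j \in K)%:R) * c K (v j))))) => x.
  by rewrite inE => /(I_elt KE) xK; rewrite (zero_ext_elt Hm gcE Hphi u KE xK).
- move=> x xK; rewrite normrX ler_pXn2r ?nnegrE ?normr_ge0//.
  exact: (zero_ext_le KE (I_elt KE xK) kK kmax).
Qed.

(** A corner fills the fraction [4^-1 ^+ d] of its element, the function squared is there at least a
    quarter of its maximum, and the maximum dominates the average over [d + 1] vertices. *)
Definition mass_const : R := 4^-1 ^+ d.+1 / d.+1%:R.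

Lemma mass_lower (u : 'cV[R]_(nvi m)) :
  mass_const * \sum_j u j ord0 ^+ 2 * patch_vol j <=
  qform (mass_matrix Omega phi) u u.
Proof.
pose w j := u j ord0; have [k kP] := extremal_vertex w.
rewrite (mass_qform Omega_reg Hm gcE Hphi) /mass_const.
have -> : \sum_j u j ord0 ^+ 2 * patch_vol j =
    \sum_(K in elements m) \sum_(i in K) nodal_val w i ^+ 2 * vol K.
  by rewrite (patch_sum w (fun K _ => vol K)).
rewrite mulr_sumr; apply: ler_sum => K KE.
have [kK kmax] := kP K KE; set U := `|nodal_val w (k K)|.
have U0 : 0 <= U by exact: normr_ge0.
have D0 : 0 < d.+1%:R :> R by rewrite ltr0n.
apply: (@le_trans _ _ (4^-1 ^+ d.+1 * (U ^+ 2 * vol K))).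
  rewrite -mulrA ler_pM2l ?exprn_gt0 ?invr_gt0//.
  rewrite ler_pdivrMl// -(cardE KE) mulr_natl -sumr_const.
  apply: ler_sum => i iK; rewrite ler_pM2r ?volE//.
  rewrite -[leLHS]real_normK ?num_real//.
  by rewrite ler_pXn2r ?nnegrE ?normr_ge0// kmax.
pose Q := elt K `&` [set x | 1 - 4^-1 <= bary K (k K) x].
have mQ : measurable Q by exact: (measurable_corner (aiE KE) (gcE KE)).
pose D := inner_elt K `&` Q.
have mD : measurable D by exact: measurableI.
have fD : mu D \is a fin_num.
  rewrite ge0_fin_numE//; apply: (@le_lt_trans _ _ (mu (inner_elt K))).
    by rewrite le_measure ?inE//; exact: subIsetl.
  by rewrite [X in (X < _)%E](muI KE) ltry.
have volD : 4^-1 ^+ d * vol K <= fine (mu D).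
  rewrite -lee_fin fineK//.
  have e41 : 4^-1 <= 1 :> R by rewrite invf_le1// ler1n.
  have e40 : 0 < 4^-1 :> R by rewrite invr_gt0.
  exact: (corner_open_volume (cardE KE) (aiE KE) (gcE KE) kK e40 e41).
apply: (@le_trans _ _ (\int[mu]_(x in inner_elt K) ((U / 2) ^+ 2 * \1_D x))).
  have -> : \int[mu]_(x in inner_elt K) ((U / 2) ^+ 2 * \1_D x) =
      (U / 2) ^+ 2 * fine (mu D).
    rewrite RintegralZl//; last first.
      apply: (integrable_of_bound (B := 1)) => //.
        by rewrite [X in (X < _)%E](muI KE) ltry.
      by move=> x _; rewrite ger0_norm// indicE; case: (x \in D).
    congr (_ * _); rewrite /Rintegral integral_indic//.
    by congr fine; congr (mu _); apply/setIidPl; exact: subIsetl.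
  have -> : 4^-1 ^+ d.+1 * (U ^+ 2 * vol K) = (U / 2) ^+ 2 * (4^-1 ^+ d * vol K).
    by rewrite exprS; field.
  by rewrite ler_wpM2l// sqr_ge0.
apply: le_Rintegral => //.
- apply: (integrable_of_bound (B := (U / 2) ^+ 2)) => //.
  + by rewrite [X in (X < _)%E](muI KE) ltry.
  + by apply: measurable_funM.
  + move=> x _; rewrite indicE normrM (ger0_norm (sqr_ge0 _)).
    by case: (x \in D); rewrite ?normr1 ?mulr1// normr0 mulr0 sqr_ge0.
- exact: (integrable_sqr KE kK kmax).
- move=> x xK; rewrite indicE; case: (boolP (x \in D)); last by rewrite mulr0 sqr_ge0.
  rewrite inE mulr1 => -[_ [xE xb]].
  rewrite -[leRHS]real_normK ?num_real// ler_pXn2r ?nnegrE ?normr_ge0 ?divr_ge0//.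
  exact: (abs_corner_value KE xE kK kmax xb).
Qed.

Lemma mass_upper (u : 'cV[R]_(nvi m)) :
  qform (mass_matrix Omega phi) u u <= \sum_j u j ord0 ^+ 2 * patch_vol j.
Proof.
pose w j := u j ord0; have [k kP] := extremal_vertex w.
rewrite (mass_qform Omega_reg Hm gcE Hphi).
have -> : \sum_j u j ord0 ^+ 2 * patch_vol j =
    \sum_(K in elements m) \sum_(i in K) nodal_val w i ^+ 2 * vol K.
  by rewrite (patch_sum w (fun K _ => vol K)).
apply: ler_sum => K KE; have [kK kmax] := kP K KE.
apply: (@le_trans _ _ (nodal_val w (k K) ^+ 2 * vol K)); last first.
  rewrite (bigD1 (k K))//= lerDl; apply: sumr_ge0 => i _.
  by rewrite mulr_ge0 ?sqr_ge0// ltW// volE.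
have -> : nodal_val w (k K) ^+ 2 * vol K =
    \int[mu]_(x in inner_elt K) (nodal_val w (k K) ^+ 2).
  by rewrite Rintegral_cst// [X in fine X](muI KE).
apply: le_Rintegral => //.
- exact: (integrable_sqr KE kK kmax).
- apply: (integrable_of_bound (B := `|nodal_val w (k K) ^+ 2|)) => //.
  by rewrite [X in (X < _)%E](muI KE) ltry.
- move=> x /(I_elt KE) xK.
  rewrite -[leLHS]real_normK ?num_real// -[leRHS]real_normK ?num_real//.
  by rewrite ler_pXn2r ?nnegrE ?normr_ge0//; exact: (zero_ext_le KE xK kK kmax).
Qed.

Variables (DD : 'rV[R]_d -> 'M[R]_d) (dmin dmax : R).
Hypotheses (dmin_gt0 : 0 < dmin).
Variables (Dh : 'rV[R]_d -> 'M[R]_d) (N : set 'rV[R]_d).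
Hypotheses (rD : regular_diffusion dmin dmax Dh) (mN : measurable N).
Hypotheses (N0 : mu N = 0) (DhE : forall x, Omega x -> ~ N x -> DD x = Dh x).

Lemma avg_on_gt0 K (u : 'rV[R]_d) : K \in elements m -> u != 0 ->
  0 < (u *m avg_on DD K *m u^T) ord0 ord0.
Proof.
move=> KE u0.
apply: lt_le_trans (avg_on_lower Omega_reg Hm gcE dmin_gt0 rD mN N0 DhE u KE).
have uu : (u *m u^T) ord0 ord0 = norm2 u^T ^+ 2 by rewrite -dot_norm2 trmxK.
rewrite mulr_gt0// uu exprn_gt0// lt_neqAle norm2_ge0 andbT eq_sym.
by apply: contra u0 => /eqP/norm2_eq0/(congr1 trmx); rewrite trmxK trmx0 => ->.
Qed.

Lemma avg_on_ge0 K (u : 'rV[R]_d) : K \in elements m ->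
  0 <= (u *m avg_on DD K *m u^T) ord0 ord0.
Proof.
move=> KE; have [->|u0] := eqVneq u 0; first by rewrite !mul0mx mxE.
exact/ltW/avg_on_gt0.
Qed.

Lemma stiffness_lower (u : 'cV[R]_(nvi m)) :
  dmin * dirichlet_energy g (fun j => u j ord0) <=
  qform (stiffness_matrix Omega DD phi) u u.
Proof.
rewrite (stiffness_qform Omega_reg Hm gcE Hphi dmin_gt0 rD mN N0 DhE).
rewrite mulr_sumr; apply: ler_sum => K KE; rewrite mulrA mulrC ler_pM2l ?volE//.
exact: (avg_on_lower Omega_reg Hm gcE dmin_gt0 rD mN N0 DhE).
Qed.

Lemma stiffness_upper (u : 'cV[R]_(nvi m)) :
  qform (stiffness_matrix Omega DD phi) u u <=
  d.+1%:R * \sum_j u j ord0 ^+ 2 *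
    \sum_(K in vpatch j) vol K * elt_min_height DD K ^- 2.
Proof.
pose w j := u j ord0.
rewrite (stiffness_qform Omega_reg Hm gcE Hphi dmin_gt0 rD mN N0 DhE).
rewrite -(patch_sum w (fun K _ => vol K * elt_min_height DD K ^- 2)) mulr_sumr.
apply: ler_sum => K KE.
have sK := avg_on_sym Omega_reg Hm gcE rD mN N0 DhE KE.
have -> : elt_grad g w K = \sum_(i in K) nodal_val w i *: g K i.
  apply/rowP => a; rewrite /elt_grad !summxE.
  under [RHS]eq_bigr do rewrite mxE.
  by rewrite nodal_val_sum; apply: eq_bigr => j _; rewrite mxE.
apply: (@le_trans _ _ (vol K * (#|K|%:R * \sum_(i in K) nodal_val w i ^+ 2 *
    (g K i *m avg_on DD K *m (g K i)^T) ord0 ord0))).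
  rewrite ler_pM2l ?volE//; apply: qform_sum_le => // z; exact: avg_on_ge0.
rewrite (cardE KE) mulrCA ler_pM2l ?ltr0n// mulr_sumr; apply: ler_sum => i iK.
rewrite mulrCA ler_wpM2l ?sqr_ge0// ler_pM2l ?volE//.
apply: (grad_le_min_height d1 (cardE KE) (aiE KE) (gcE KE) sK) => // z z0.
exact: avg_on_gt0.
Qed.

Lemma metric_h_gt0 : 0 < metric_h m DD.
Proof.
apply: powR_gt0; apply: divr_gt0; last by rewrite ltr0n (elements_gt0 Omega_neq0 Hm).
have /card_gt0P[K0 K0E] := elements_gt0 Omega_neq0 Hm.
have t0 K : K \in elements m -> 0 < vol K * Num.sqrt (\det (invmx (avg_on DD K))).
  move=> KE; rewrite mulr_gt0 ?volE// sqrtr_gt0 det_inv invr_gt0 det_gt0// => u.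
  exact: avg_on_gt0.
rewrite /metric_vol (bigD1 K0)//= ltr_pwDl ?t0// sumr_ge0// => K /andP[KE _].
by rewrite ltW// t0.
Qed.

Lemma patch_vol_gt0 (j : 'I_(nvi m)) : 0 < patch_vol j.
Proof.
have [K KE vK] := vertex_used Hm (v j).
rewrite /patch_vol (bigD1 K)/=; last by rewrite inE KE.
rewrite ltr_pwDl ?volE// sumr_ge0// => L /andP[+ _].
by rewrite inE => /andP[LE _]; rewrite ltW// volE.
Qed.

Lemma min_patch_vol_le (j : 'I_(nvi m)) : min_patch_vol m <= patch_vol j.
Proof.
apply: ge_inf; last by exists j.
by exists 0 => _ [k _ <-]; exact/ltW/patch_vol_gt0.
Qed.

Lemma min_patch_vol_gt0 : (0 < nvi m)%N -> 0 < min_patch_vol m.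
Proof.
move=> n0; pose j0 := Ordinal n0.
apply: (@lt_le_trans _ _ (\big[Num.min/patch_vol j0]_(j < nvi m) patch_vol j)).
  by apply: lt_bigmin => [|j _]; exact: patch_vol_gt0.
apply: lb_le_inf; first by exists (patch_vol j0); exists j0.
by move=> _ [j _ <-]; exact: bigmin_le_cond.
Qed.

End estimates.

(** * Assembly of the condition number bound *)

Lemma barycentric_mesh (R : realType) (d : nat) (Omega : set 'rV[R]_d) (m : mesh R d) :
  conforming_mesh Omega m -> exists g c,
  forall K, K \in elements m -> barycentric (@vertex R d m) K (g K) (c K).
Proof.
move=> Hm.
have /choice[gc gcP] : forall K : {set 'I_(nvi m + nvb m)}, exists gc,
    K \in elements m -> barycentric (@vertex R d m) K gc.1 gc.2.
  move=> K; have [KE|KE] := boolP (K \in elements m); last first.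
    by exists (fun=> 0, fun=> 0).
  have [cK aiK] := element_simplex Hm KE.
  by have [g [c gcK]] := barycentric_exists cK aiK; exists (g, c).
by exists (fun K => (gc K).1), (fun K => (gc K).2).
Qed.

Theorem theorem4p1 (R : realType) (d : nat) (d_ge1 : (1 <= d)%N)
    (Omega : set 'rV[R]_d) (Omega_poly : polyhedral_domain Omega) :
  exists2 C : R, 0 < C &
  forall (m : mesh R d) (DD : 'rV[R]_d -> 'M[R]_d) (dmin dmax dt : R)
      (phi : 'I_(nvi m) -> 'rV[R]_d -> R),
    conforming_mesh Omega m ->
    0 < dmin -> 0 < dmax -> diffusion_matrix Omega dmin dmax DD ->
    0 < dt ->
    (forall j, nodal_basis Omega j (phi j)) ->
    (cond2 (mass_matrix Omega phi + dt *: stiffness_matrix Omega DD phi) <=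
     (C *
      (\big[Num.max/0]_(j < nvi m)
         (patch_vol j / min_patch_vol m *
          (1 + dt * metric_h m DD ^- 2 *
             \sum_(K in vpatch j)
               vol K / patch_vol j *
               (metric_h m DD / elt_min_height DD K) ^+ 2)) /
       (1 + dt * dmin * (nelt m)^-1 * (min_patch_vol m)^-1 *
            (Psi Omega m)^-1)))%:E)%E.
Proof.
case: (Omega_poly) => Omega_neq0 _ Omega_reg _.
(* The absolute value and the summand 1 make [c3] positive without a discussion of the sign of
   [sum_const]. *)
pose c3 := 8 * d.+1%:R * `|sum_const Omega| + 1.
have c30 : 0 < c3 by rewrite ltr_wpDl// !mulr_ge0.
pose cM : R := mass_const R d.
have cM0 : 0 < cM by rewrite /cM /mass_const divr_gt0 ?exprn_gt0 ?invr_gt0 ?ltr0n.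
pose cm := Num.min cM c3^-1.
have cm0 : 0 < cm by rewrite lt_min cM0 invr_gt0.
exists (d.+1%:R / cm); first by rewrite divr_gt0 ?ltr0n.
move=> m DD dmin dmax dt phi Hm dmin0 dmax0 HD dt0 Hphi.
have [g [c gcE]] := barycentric_mesh Hm.
have oO := domain_open Omega_reg.
have [Dh [N [rD mN N0 DhE]]] := regular_diffusion_exists oO Omega_neq0 HD.
set B := _ + _.
have Bs : B^T = B.
  rewrite /B linearD/= linearZ/= (mass_matrix_sym Omega_reg Hm gcE Hphi).
  by rewrite (stiffness_matrix_sym Omega_reg Hm gcE Hphi dmin0 rD mN N0 DhE).
have qB u : qform B u u = qform (mass_matrix Omega phi) u u +
    dt * qform (stiffness_matrix Omega DD phi) u u.
  rewrite /qform /B mulmxDr mulmxDl -scalemxAr -scalemxAl.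
  by rewrite mxE [X in _ + X]mxE.
(* Without interior vertices the matrix is empty, and the maximum on the right takes its default
   value 0; [min_patch_vol] would be the infimum of an empty set. *)
have [n0|n0] := posnP (nvi m).
  have norm0 (u : 'cV[R]_(nvi m)) : norm2 u = 0.
    rewrite /norm2 big1 ?sqrtr0// => -[i] ilt _; exfalso.
    by move: ilt; rewrite n0.
  have u0 (u : 'cV[R]_(nvi m)) : u = 0 by exact: norm2_eq0.
  apply: (@le_trans _ _ (0 / 1)%:E).
    apply: cond2_le => // u; rewrite norm0 [u]u0 /qform mulmx0 mxE expr0n !mulr0.
    by rewrite lexx.
  rewrite lee_fin mul0r big_pred0 ?mul0r ?mulr0// => -[j jn]; exfalso.
  by move: jn; rewrite n0.
pose T (j : 'I_(nvi m)) := patch_vol j / min_patch_vol m *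
  (1 + dt * metric_h m DD ^- 2 * \sum_(K in vpatch j)
     vol K / patch_vol j * (metric_h m DD / elt_min_height DD K) ^+ 2).
set Tm := \big[Num.max/0]_(j < nvi m) T j; set den := 1 + _.
have w0 := min_patch_vol_gt0 Hm gcE n0; set w := min_patch_vol m in w0 *.
have vK K := vol_gt0 Hm gcE (K := K).
have Npos : 0 < nelt m :> R by rewrite ltr0n (elements_gt0 Omega_neq0 Hm).
have NV : nelt m * min_vol m <= domain_vol Omega.
  rewrite (domain_volE Omega_reg Hm gcE) /nelt mulr_natl -sumr_const.
  by apply: ler_sum => K KE; exact: (min_vol_le Hm gcE).
have av0 : 0 < avg_vol Omega m.
  by rewrite /avg_vol divr_gt0// (domain_vol_gt0 Omega_reg Omega_neq0 Hm gcE).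
have mv0 := min_vol_gt0 Omega_neq0 Hm gcE.
have Psi0 : 0 < Psi Omega m.
  apply: Psi_gt0 => //; first exact: (elements_gt0 Omega_neq0 Hm).
  by rewrite mv0 /avg_vol ler_pdivlMr// mulrC.
have h0 := metric_h_gt0 Omega_reg Omega_neq0 Hm gcE dmin0 rD mN N0 DhE.
have den0 : 0 < den.
  by rewrite /den ltr_pwDl// !mulr_ge0 ?invr_ge0// ltW.
pose S (j : 'I_(nvi m)) := \sum_(K in vpatch j) vol K * elt_min_height DD K ^- 2.
have patch0 (j : 'I_(nvi m)) := patch_vol_gt0 Hm gcE j.
(* The scale [metric_h] cancels, so only its being nonzero matters. *)
have TE j : w * T j = patch_vol j + dt * S j.
  rewrite /T.
  have -> : \sum_(K in vpatch j) vol K / patch_vol j *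
      (metric_h m DD / elt_min_height DD K) ^+ 2 =
      metric_h m DD ^+ 2 / patch_vol j * S j.
    rewrite /S mulr_sumr; apply: eq_bigr => K _.
    by rewrite expr_div_n; ring.
  by field; rewrite !gt_eqF.
have Tm_ge j : T j <= Tm by rewrite /Tm; exact: (le_bigmax _ T).
have Tm0 : 0 <= Tm by exact: bigmax_ge_id.
pose mm := cm * w * den; pose LL := d.+1%:R * w * Tm.
have mm0 : 0 < mm by rewrite !mulr_gt0.
have -> : (d.+1%:R / cm * (Tm / den))%:E = (LL / mm)%:E.
  by congr EFin; rewrite /LL /mm; field; rewrite !gt_eqF.
have d1r : 1 <= d.+1%:R :> R by rewrite ler1n.
apply: cond2_le => //; last by rewrite !mulr_ge0// ltW.
move=> u; rewrite qB norm2_sqr; set s := \sum_i _.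
have s0 : 0 <= s by apply: sumr_ge0 => i _; exact: sqr_ge0.
apply/andP; split.
  set E := dirichlet_energy g (fun j => u j ord0).
  have E0 : 0 <= E.
    apply: sumr_ge0 => K KE; rewrite mulr_ge0 ?(ltW (vK K KE))//.
    by rewrite -[elt_grad _ _ K in X in X *m _]trmxK dot_norm2 sqr_ge0.
  have m1 : cM * (w * s) <= qform (mass_matrix Omega phi) u u.
    apply: le_trans (mass_lower Omega_reg Omega_neq0 Hm gcE Hphi u).
    rewrite ler_pM2l// /s mulr_sumr; apply: ler_sum => j _.
    by rewrite mulrC ler_wpM2l ?sqr_ge0//; exact: (min_patch_vol_le Hm gcE).
  have m2 : dmin * E <= qform (stiffness_matrix Omega DD phi) u u.
    exact: (stiffness_lower Omega_reg Hm gcE Hphi dmin0 rD mN N0 DhE).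
  have m3 : s <= c3 * (nelt m * Psi Omega m * E).
    apply: (le_trans (dirichlet_bound d_ge1 Omega_reg Omega_neq0 Hm gcE Hphi _)).
    rewrite ler_wpM2r ?mulr_ge0 ?(ltW Npos) ?(ltW Psi0)// /c3.
    by rewrite -[leLHS]addr0 lerD// ler_wpM2l// ?mulr_ge0// ler_norm.
  have m4 : c3^-1 * (s / (nelt m * Psi Omega m)) <= E.
    rewrite ler_pdivrMl// ler_pdivrMr ?mulr_gt0//.
    by apply: (le_trans m3); rewrite le_eqVlt; apply/orP; left; apply/eqP; ring.
  have sN0 : 0 <= s / (nelt m * Psi Omega m) by rewrite divr_ge0// mulr_ge0// ltW.
  (* Multiplying out [den] separates the share of the mass matrix from that of the stiffness matrix;
     [cm], a minimum of two constants, serves both. *)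
  have -> : mm * s = cm * (w * s) + dt * (dmin * (cm * (s / (nelt m * Psi Omega m)))).
    by rewrite /mm /den -/w; field; rewrite !gt_eqF.
  apply: lerD.
    apply: le_trans m1; rewrite ler_wpM2r ?mulr_ge0 ?(ltW w0)//.
    by rewrite /cm ge_min lexx.
  rewrite ler_pM2l//; apply: le_trans m2; rewrite ler_pM2l//.
  apply: le_trans m4; rewrite ler_wpM2r//.
  by rewrite /cm ge_min lexx orbT.
have m1 := mass_upper Omega_reg Omega_neq0 Hm gcE Hphi u.
have m2 := stiffness_upper d_ge1 Omega_reg Hm gcE Hphi dmin0 rD mN N0 DhE u.
apply: (@le_trans _ _ (d.+1%:R * \sum_j u j ord0 ^+ 2 * (w * T j))).
  have -> : d.+1%:R * \sum_j u j ord0 ^+ 2 * (w * T j) =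
      d.+1%:R * (\sum_j u j ord0 ^+ 2 * patch_vol j) +
      dt * (d.+1%:R * \sum_j u j ord0 ^+ 2 * S j).
    under eq_bigr do rewrite TE mulrDr mulrCA.
    by rewrite big_split/= -mulr_sumr; ring.
  apply: lerD; last by rewrite ler_pM2l.
  apply: (le_trans m1); rewrite ler_peMl//.
  by apply: sumr_ge0 => j _; rewrite mulr_ge0 ?sqr_ge0// ltW.
rewrite /LL -!mulrA ler_pM2l ?ltr0n// /s !mulr_sumr; apply: ler_sum => j _.
by rewrite mulrCA ler_pM2l// mulrC ler_wpM2r ?sqr_ge0.
Qed.
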